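(* Let $Q$ be a commutative ring, $R=Q/I$ a cyclic $Q$-algebra, and $M$ an $R$-module. Let $A\xrightarrow{\simeq}R$ (with $A_0=Q$) and $G\xrightarrow{\simeq}M$ be $Q$-projective resolutions, let $m=(m_n)$ be an $A_\infty$-algebra structure on $A$ and $m^G=(m^G_n)$ an $A_\infty$ $A$-module structure on $G$. Then the bar resolution $R\otimes \operatorname{Bar}A\otimes G$ built from these data is a complex of projective $R$-modules, and the map $\epsilon_{\operatorname{Bar}}:R\otimes\operatorname{Bar}A\otimes G\to M$ makes it an $R$-projective resolution of $M$. If moreover $Q$ is local Noetherian, $M$ is finitely generated, and $A$ and $G$ are minimal $Q$-free resolutions, then the bar resolution is minimal if and only if $M$ is a Golod module over $Q$.
   Context: Conventions: $\otimes=\otimes_Q$. Complexes are graded homologically. $M[1]_n=M_{n-1}$, $d_{M[1]}=-d_M$, and $s:M\to M[1]$ is the degree $1$ map $s(m)=m$. Signs: $(f\otimes g)(x\otimes y)=(-1)^{|g||x|}f(x)\otimes g(y)$. Put $A_+=A_{\ge 1}$. An $A_\infty$-algebra structure on $A$ is a sequence of degree $-1$ maps $m_n:A_+[1]^{\otimes n}\to A_+[1]$, $n\ge1$, such that $m_1=d^{A[1]}|_{A_+[1]}$ (followed by projection to $A_+[1]$, i.e. the differential of the complex $A_+[1]$); $m_1m_2+m_2(m_1\otimes1+1\otimes m_1)=d_1^A\otimes1-1\otimes d_1^A$, where $d_1^A:A_1\to A_0=Q$ is viewed as a degree $-2$ map $A_+[1]\to A_0$ and $A_0\otimes A_+[1]=A_+[1]=A_+[1]\otimes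 A_0$; and $\sum_{i=1}^n\sum_{j=0}^{n-i}m_{n-i+1}(1^{\otimes j}\otimes m_i\otimes1^{\otimes n-i-j})=0$ for all $n\ge3$. Given $(m_n)$, an $A_\infty$ $A$-module structure on $G$ is a sequence of degree $-1$ maps $m_n^G:A_+[1]^{\otimes n-1}\otimes G\to G$, $n\ge1$, such that $m_1^G=d^G$; $m_1^Gm_2^G+m_2^G(m_1\otimes1+1\otimes m_1^G)=d_1^A\otimes1$; and $\sum_{i=1}^n\sum_{j=0}^{n-i}m^G_{n-i+1}(1^{\otimes j}\otimes m_i\otimes1^{\otimes n-i-j})=0$ for all $n\ge3$, where $m_i$ means $m_i^G$ when $j=n-i$. Bar resolution: $\operatorname{Bar}A=\bigoplus_{n\ge0}A_+[1]^{\otimes n}$, with $[x_1|\dots|x_n]=s(x_1)\otimes\dots\otimes s(x_n)$. The underlying graded module is $R\otimes\operatorname{Bar}A\otimes G$, and the $R$-linear differential is $R\otimes(-)$ applied to $$d([x_1|\dots|x_n]\otimes g)=\sum_{i=1}^n\sum_{j=0}^{n-i}[\underline{x}_1|\dots|\underline{x}_j|m_i([x_{j+1}|\dots|x_{j+i}])|x_{j+i+1}|\dots|x_n]\otimes g+\sum_{i=1}^{n+1}[\underline{x}_1|\dots|\underline{x}_{n-i+1}]\otimes m_i^G([x_{n-i+2}|\dots|x_n]\otimes g),$$ where $\underline{x}=(-1)^{|x|+1}x$. With $\epsilon_G:G\to M$ the augmentation, $\epsilon_{\operatorname{Bar}}(r\otimes[\,]\otimes g)=r\,\epsilon_G(g)$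 and $\epsilon_{\operatorname{Bar}}(r\otimes[x_1|\dots|x_n]\otimes g)=0$ for $n\ge1$. A free resolution over a local ring with maximal ideal $\mathfrak m$ is minimal if each differential $F_{i+1}\to F_i$ has image in $\mathfrak mF_i$. For a local ring $R$ with residue field $k$ and a finitely generated module $M$, the Poincaré series is $P^R_M(t)=\sum_{n\ge0}\dim_k\operatorname{Tor}^R_n(M,k)\,t^n$. When $Q$ is local Noetherian with residue field $k$, a finitely generated $R$-module $M$ is a Golod module over $Q$ if $P^R_M(t)=\dfrac{P^Q_M(t)}{1-t(P^Q_R(t)-1)}$. *)

(* Defs.v *)
From HB Require Import structures.
From mathcomp Require Import all_boot all_order all_algebra.
From mathcomp Require Import boolp.

Set Implicit Arguments.
Unset Strict Implicit.
Unset Printing Implicit Defensive.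
Import GRing.Theory.
Local Open Scope ring_scope.

Definition mklin (K : pzRingType) (U V : lmodType K) (f : U -> V)
    (hf : linear f) : {linear U -> V} :=
  HB.pack f (GRing.isLinear.Build K U V *:%R f hf).

Lemma mklinE (K : pzRingType) (U V : lmodType K) (f : U -> V) (hf : linear f) :
  mklin hf =1 f.
Proof. by []. Qed.

Inductive span (K : pzRingType) (V : lmodType K) (S : V -> Prop) : V -> Prop :=
| span_0 : span S 0
| span_cons a x y : S x -> span S y -> span S (a *: x + y).

Section SpanTheory.
Context (K : pzRingType) (V : lmodType K) (S : V -> Prop).

Lemma span_gen x : S x -> span S x.
Proof. by move=> Sx; rewrite -[x]scale1r -[_ *: _]addr0; constructor=> //; constructor. Qed.

Lemma spanD x y : span S x -> span S y -> span S (x + y).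
Proof.
move=> hx hy; elim: hx => [|a u v Su _ IH]; first by rewrite add0r.
by rewrite -addrA; constructor.
Qed.

Lemma spanZ a x : span S x -> span S (a *: x).
Proof.
elim=> [|b u v Su _ IH]; first by rewrite scaler0; constructor.
by rewrite scalerDr scalerA; constructor.
Qed.

Lemma span_lin (W : lmodType K) (f : {linear V -> W}) :
  (forall x, S x -> f x = 0) -> forall x, span S x -> f x = 0.
Proof.
move=> hf x; elim=> [|a u v Su _ IH]; first by rewrite linear0.
by rewrite linearP hf // IH scaler0 addr0.
Qed.

End SpanTheory.

Section Kernel.
Context (K : pzRingType) (U V : lmodType K) (f : {linear U -> V}).

Definition kerp : pred U := fun x => f x == 0.

Lemma kerp_closed : subsemimod_closed kerp.
Proof.
split; first split; rewrite ?unfold_in /kerp ?linear0 //.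
- by move=> x y /eqP fx /eqP fy; rewrite unfold_in linearD fx fy addr0.
- by move=> a x /eqP fx; rewrite unfold_in linearZ_LR fx scaler0.
Qed.

Record kermod := KerMod { ker_val : U; ker_valP : ker_val \in kerp }.
HB.instance Definition _ := [isSub for ker_val].
HB.instance Definition _ := [Choice of kermod by <:].
HB.instance Definition _ := GRing.SubChoice_isSubLmodule.Build K U kerp kermod kerp_closed.

Definition ker_incl : {linear kermod -> U} := \val.

End Kernel.

Section Quotient.
Context (K : pzRingType) (V : lmodType K) (S : V -> Prop).
Local Open Scope quotient_scope.

Definition qrel (x y : V) : bool := `[< span S (x - y) >].

Lemma qrel_equiv : equiv_class_of qrel.
Proof.
split=> [x|x y|y x z]; rewrite /qrel.
- by apply/asboolP; rewrite subrr; constructor.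
- by apply/idP/idP => /asboolP h; apply/asboolP;
     rewrite -opprB -scaleN1r; apply: spanZ.
- move=> /asboolP h1 /asboolP h2; apply/asboolP.
  by rewrite -[x](addrNK y) -addrA; apply: spanD.
Qed.

Canonical qrel_equivRel := EquivRelPack qrel_equiv.

Definition quotmod := {eq_quot qrel}.
HB.instance Definition _ := EqQuotient.on quotmod.
HB.instance Definition _ := Choice.on quotmod.

Definition qpi (x : V) : quotmod := \pi_quotmod x.

Lemma qpi_eq x y : qpi x = qpi y <-> span S (x - y).
Proof.
split=> [/eqmodP/asboolP //|h].
by apply/eqmodP/asboolP.
Qed.

Lemma qpi_repr (x : quotmod) : qpi (repr x) = x.
Proof. exact: reprK. Qed.

Lemma qpi_surj (x : quotmod) : exists y, qpi y = x.
Proof. by exists (repr x); apply: qpi_repr. Qed.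

Definition qadd (x y : quotmod) := qpi (repr x + repr y).
Definition qopp (x : quotmod) := qpi (- repr x).
Definition qscale (a : K) (x : quotmod) := qpi (a *: repr x).

Lemma qpi_rep x : span S (repr (qpi x) - x).
Proof. by apply/qpi_eq; apply: qpi_repr. Qed.

Lemma qpiD x y : qpi (x + y) = qadd (qpi x) (qpi y).
Proof.
apply/esym/qpi_eq; rewrite opprD addrACA.
by apply: spanD; apply: qpi_rep.
Qed.

Lemma qpiN x : qpi (- x) = qopp (qpi x).
Proof.
apply/esym/qpi_eq; rewrite -opprD -[- _]scaleN1r.
by apply: spanZ; apply: qpi_rep.
Qed.

Lemma qpiZ a x : qpi (a *: x) = qscale a (qpi x).
Proof. by apply/esym/qpi_eq; rewrite -scalerBr; apply: spanZ; apply: qpi_rep. Qed.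

Lemma qaddA : associative qadd.
Proof.
move=> x y z; case: (qpi_surj x) (qpi_surj y) (qpi_surj z) => a <- [b <-] [c <-].
by rewrite -!qpiD addrA.
Qed.
Lemma qaddC : commutative qadd.
Proof.
by move=> x y; case: (qpi_surj x) (qpi_surj y) => a <- [b <-]; rewrite -!qpiD addrC.
Qed.
Lemma qadd0 : left_id (qpi 0) qadd.
Proof. by move=> x; case: (qpi_surj x) => a <-; rewrite -qpiD add0r. Qed.
Lemma qaddN : left_inverse (qpi 0) qopp qadd.
Proof. by move=> x; case: (qpi_surj x) => a <-; rewrite -qpiN -qpiD addNr. Qed.

HB.instance Definition _ := GRing.isZmodule.Build quotmod qaddA qaddC qadd0 qaddN.

Lemma qaddE (x y : quotmod) : x + y = qadd x y. Proof. by []. Qed.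

Lemma qscaleA a b x : qscale a (qscale b x) = qscale (a * b) x.
Proof. by case: (qpi_surj x) => u <-; rewrite -!qpiZ scalerA. Qed.
Lemma qscale1 : left_id 1 qscale.
Proof. by move=> x; case: (qpi_surj x) => u <-; rewrite -!qpiZ scale1r. Qed.
Lemma qscaleDr : right_distributive qscale +%R.
Proof.
move=> a x y; case: (qpi_surj x) (qpi_surj y) => u <- [v <-].
by rewrite qaddE -qpiD -!qpiZ scalerDr qpiD.
Qed.
Lemma qscaleDl x : {morph qscale^~ x : a b / a + b}.
Proof.
move=> a b; case: (qpi_surj x) => u <-.
by rewrite -!qpiZ scalerDl qpiD.
Qed.

HB.instance Definition _ := GRing.Zmodule_isLmodule.Build K quotmod
  qscaleA qscale1 qscaleDr qscaleDl.

Lemma qpi_linear : linear qpi.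
Proof. by move=> a x y; rewrite qpiD qpiZ. Qed.

Definition qproj : {linear V -> quotmod} := mklin qpi_linear.

Lemma qproj_surj (x : quotmod) : exists y, qproj y = x.
Proof. exact: qpi_surj. Qed.

Lemma qproj_eq0 x : qproj x = 0 <-> span S x.
Proof. by rewrite -[x in span _ x]subr0; apply: qpi_eq. Qed.

Section Lift.
Context (W : lmodType K) (f : {linear V -> W}) (hf : forall x, S x -> f x = 0).

Definition qlift_fun (x : quotmod) : W := f (repr x).

Lemma qlift_qpi x : qlift_fun (qpi x) = f x.
Proof.
by apply/eqP; rewrite -subr_eq0 -linearB; apply/eqP/(span_lin hf)/qpi_rep.
Qed.

Lemma qlift_linear : linear qlift_fun.
Proof.
move=> a x y; case: (qpi_surj x) (qpi_surj y) => u <- [v <-].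
by rewrite -[a *: qpi u]qpiZ qaddE -qpiD !qlift_qpi linearP.
Qed.

Definition qlift : {linear quotmod -> W} := mklin qlift_linear.

Lemma qliftE x : qlift (qproj x) = f x.
Proof. exact: qlift_qpi. Qed.

End Lift.

End Quotient.
Section DirectSum.
Context (K : pzRingType) (I : choiceType) (V : I -> lmodType K).

Record dsum := DSum {
  dval :> forall i, V i;
  dvalP : exists s : seq I, forall i, i \notin s -> dval i = 0 }.

HB.instance Definition _ := gen_eqMixin dsum.
HB.instance Definition _ := gen_choiceMixin dsum.

Lemma dsum_ext (x y : dsum) : (forall i, x i = y i) -> x = y.
Proof.
case: x y => [f hf] [g hg] /= fg.
have E : f = g by apply: functional_extensionality_dep.
by rewrite E in hf *; congr DSum; apply: Prop_irrelevance.
Qed.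

Lemma dzeroP : exists s : seq I, forall i, i \notin s -> (fun i => 0 : V i) i = 0.
Proof. by exists [::]. Qed.
Definition dzero := DSum dzeroP.

Lemma daddP (x y : dsum) :
  exists s : seq I, forall i, i \notin s -> (fun i => x i + y i) i = 0.
Proof.
case: (dvalP x) (dvalP y) => s hs [t ht]; exists (s ++ t) => i.
by rewrite mem_cat negb_or => /andP[/hs -> /ht ->]; rewrite addr0.
Qed.
Definition dadd x y := DSum (daddP x y).

Lemma doppP (x : dsum) :
  exists s : seq I, forall i, i \notin s -> (fun i => - x i) i = 0.
Proof. by case: (dvalP x) => s hs; exists s => i /hs ->; rewrite oppr0. Qed.
Definition dopp x := DSum (doppP x).

Lemma dscaleP a (x : dsum) :
  exists s : seq I, forall i, i \notin s -> (fun i => a *: x i) i = 0.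
Proof. by case: (dvalP x) => s hs; exists s => i /hs ->; rewrite scaler0. Qed.
Definition dscale a x := DSum (dscaleP a x).

Lemma daddA : associative dadd.
Proof. by move=> x y z; apply: dsum_ext => i /=; rewrite addrA. Qed.
Lemma daddC : commutative dadd.
Proof. by move=> x y; apply: dsum_ext => i /=; rewrite addrC. Qed.
Lemma dadd0 : left_id dzero dadd.
Proof. by move=> x; apply: dsum_ext => i /=; rewrite add0r. Qed.
Lemma daddN : left_inverse dzero dopp dadd.
Proof. by move=> x; apply: dsum_ext => i /=; rewrite addNr. Qed.
HB.instance Definition _ := GRing.isZmodule.Build dsum daddA daddC dadd0 daddN.

Lemma dscaleA a b x : dscale a (dscale b x) = dscale (a * b) x.
Proof. by apply: dsum_ext => i /=; rewrite scalerA. Qed.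
Lemma dscale1 : left_id 1 dscale.
Proof. by move=> x; apply: dsum_ext => i /=; rewrite scale1r. Qed.
Lemma dscaleDr : right_distributive dscale +%R.
Proof. by move=> a x y; apply: dsum_ext => i /=; rewrite scalerDr. Qed.
Lemma dscaleDl x : {morph dscale^~ x : a b / a + b}.
Proof. by move=> a b; apply: dsum_ext => i /=; rewrite scalerDl. Qed.
HB.instance Definition _ := GRing.Zmodule_isLmodule.Build K dsum
  dscaleA dscale1 dscaleDr dscaleDl.

Lemma dcomp_linear i : linear (fun x : dsum => x i).
Proof. by []. Qed.
Definition dcomp i : {linear dsum -> V i} := mklin (@dcomp_linear i).

Lemma dinP i (v : V i) :
  exists s : seq I, forall j, j \notin s -> dfwith (fun j => 0 : V j) v j = 0.
Proof. by exists [:: i] => j; rewrite inE => ij; rewrite dfwith_out // eq_sym. Qed.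

Lemma din_linear i : linear (fun v : V i => DSum (dinP v)).
Proof.
move=> a u v; apply: dsum_ext => j /=.
by case: dfwithP => [|k ik]; rewrite ?dfwith_in // !dfwith_out // scaler0 addr0.
Qed.
Definition din i : {linear V i -> dsum} := mklin (@din_linear i).

Lemma din_in i v : din i v i = v.
Proof. exact: dfwith_in. Qed.
Lemma din_out i j v : i != j -> din i v j = 0.
Proof. exact: dfwith_out. Qed.

Lemma dsum_sum (J : Type) (r : seq J) (F : J -> dsum) i :
  (\sum_(j <- r) F j) i = \sum_(j <- r) F j i.
Proof. exact: (linear_sum (dcomp i)). Qed.

Definition dsupp (x : dsum) : seq I := undup (projT1 (cid (dvalP x))).

Lemma dsupp_uniq x : uniq (dsupp x). Proof. exact: undup_uniq. Qed.

Lemma dsupp_out (x : dsum) i : i \notin dsupp x -> x i = 0.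
Proof. by rewrite mem_undup; case: cid => s /= hs; apply: hs. Qed.

Lemma dsum_sub (x : dsum) (s : seq I) :
    uniq s -> (forall i, i \notin s -> x i = 0) ->
  x = \sum_(i <- s) din i (x i).
Proof.
move=> us hs; apply: dsum_ext => i; rewrite dsum_sum.
have [si|/[dup] /hs -> ns] := boolP (i \in s).
  rewrite (bigD1_seq i) // [X in _ = X + _]din_in big1 ?addr0 // => j ji.
  by rewrite din_out.
rewrite big_seq big1 // => j sj; rewrite din_out //.
by apply: contraNneq ns => <-.
Qed.

Lemma dsumE (x : dsum) : x = \sum_(i <- dsupp x) din i (x i).
Proof. by apply: dsum_sub; [apply: dsupp_uniq | apply: dsupp_out]. Qed.

Lemma dsum_lin_ext (W : lmodType K) (f g : {linear dsum -> W}) :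
  (forall i v, f (din i v) = g (din i v)) -> f =1 g.
Proof.
by move=> fg x; rewrite (dsumE x) !linear_sum; apply: eq_bigr => i _; apply: fg.
Qed.

Section Lift.
Context (W : lmodType K) (f : forall i, {linear V i -> W}).

Definition dlift_fun (x : dsum) : W := \sum_(i <- dsupp x) f i (x i).

Lemma dlift_sub (x : dsum) (s : seq I) :
    uniq s -> (forall i, i \notin s -> x i = 0) ->
  dlift_fun x = \sum_(i <- s) f i (x i).
Proof.
move=> us hs; rewrite /dlift_fun.
rewrite (bigID (mem s)) /= [X in _ + X]big1 ?addr0; last first.
  by move=> i /hs ->; rewrite linear0.
rewrite [RHS](bigID (mem (dsupp x))) /= [X in _ + X]big1 ?addr0; last first.
  by move=> i /dsupp_out ->; rewrite linear0.
rewrite -[LHS]big_filter -[RHS]big_filter; apply: perm_big; apply: uniq_perm.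
- by rewrite filter_uniq ?dsupp_uniq.
- by rewrite filter_uniq.
- by move=> i; rewrite !mem_filter andbC.
Qed.

Lemma dlift_linear : linear dlift_fun.
Proof.
move=> a x y; set s := undup (dsupp x ++ dsupp y).
have us : uniq s by apply: undup_uniq.
have hx i : i \notin s -> x i = 0.
  by rewrite mem_undup mem_cat negb_or => /andP[/dsupp_out].
have hy i : i \notin s -> y i = 0.
  by rewrite mem_undup mem_cat negb_or => /andP[_ /dsupp_out].
rewrite !(@dlift_sub _ s) //; last first.
  by move=> i si /=; rewrite hx // hy // scaler0 addr0.
rewrite scaler_sumr -big_split; apply: eq_bigr => i _ /=.
by rewrite linearP.
Qed.

Definition dlift : {linear dsum -> W} := mklin dlift_linear.

Lemma dlift_din i v : dlift (din i v) = f i v.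
Proof.
have h j : j \notin [:: i] -> din i v j = 0.
  by rewrite inE => ij; rewrite din_out // eq_sym.
by rewrite [LHS](dlift_sub (s := [:: i])) // big_seq1 din_in.
Qed.

End Lift.

End DirectSum.
Arguments din {K I V} i.
Arguments dcomp {K I V} i.

Section DirectSumMap.
Context (K : pzRingType) (I : choiceType) (V W : I -> lmodType K).
Context (f : forall i, {linear V i -> W i}).

Lemma dmapP (x : dsum V) :
  exists s : seq I, forall i, i \notin s -> (fun i => f i (x i)) i = 0.
Proof. by case: (dvalP x) => s hs; exists s => i /hs ->; rewrite linear0. Qed.

Lemma dmap_linear : linear (fun x : dsum V => DSum (dmapP x)).
Proof. by move=> a x y; apply: dsum_ext => i /=; rewrite linearP. Qed.

Definition dmap : {linear dsum V -> dsum W} := mklin dmap_linear.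

Lemma dmapE x i : dmap x i = f i (x i). Proof. by []. Qed.

End DirectSumMap.

Section FreeModule.
Context (K : pzRingType) (X : choiceType).

Definition freemod : lmodType K := dsum (fun _ : X => K^o).
Definition fgen (x : X) : freemod := din (V := fun _ => K^o) x 1.

Context (W : lmodType K) (f : X -> W).

Lemma scalel_linear (w : W) : linear (fun a : K^o => (a : K) *: w).
Proof. by move=> a b c; rewrite scalerDl scalerA. Qed.

Definition flift : {linear freemod -> W} := dlift (fun x => mklin (scalel_linear (f x))).

Lemma fliftE x : flift (fgen x) = f x.
Proof. by rewrite [LHS]dlift_din /= scale1r. Qed.

Lemma fmod_ext (g h : {linear freemod -> W}) :
  (forall x, g (fgen x) = h (fgen x)) -> g =1 h.
Proof.
move=> gh; apply: dsum_lin_ext => x a.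
have -> : din x a = (a : K) *: fgen x.
  by rewrite /fgen -linearZ_LR; congr (din _ _); rewrite /= [RHS]mulr1.
by rewrite !linearZ_LR gh.
Qed.

End FreeModule.

Definition bilin (K : pzRingType) (M N P : lmodType K) (f : M -> N -> P) : Prop :=
  (forall x, linear (f x)) /\ (forall y, linear (f^~ y)).

Section Tensor.
Context (Q : comPzRingType) (M N : lmodType Q).

Let e (x : M) (y : N) : freemod Q (M * N)%type := fgen Q (x, y).

Inductive tens_rel : freemod Q (M * N)%type -> Prop :=
| tens_rel_l a x x' y : tens_rel (e (a *: x + x') y - (a *: e x y + e x' y))
| tens_rel_r a x y y' : tens_rel (e x (a *: y + y') - (a *: e x y + e x y')).

Definition tensor : lmodType Q := quotmod tens_rel.
Definition tens (x : M) (y : N) : tensor := qproj tens_rel (e x y).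

Lemma tens_bilin : bilin tens.
Proof.
split=> [x a y y'|y a x x']; rewrite /tens -linearP; apply/qpi_eq/span_gen.
  exact: tens_rel_r.
exact: tens_rel_l.
Qed.

Lemma tens_ext (P : lmodType Q) (f g : {linear tensor -> P}) :
  (forall x y, f (tens x y) = g (tens x y)) -> f =1 g.
Proof.
move=> fg t; case: (qproj_surj t) => u <-.
have E : f \o qproj tens_rel =1 g \o qproj tens_rel.
  by apply: fmod_ext => -[x y]; apply: fg.
exact: E.
Qed.

Section Lift.
Context (P : lmodType Q) (f : M -> N -> P) (hf : bilin f).

Let f' : {linear freemod Q (M * N)%type -> P} := flift (fun p => f p.1 p.2).

Lemma tlift_rel u : tens_rel u -> f' u = 0.
Proof.
by case=> [a x x' y|a x y y']; rewrite linearB linearP /f' !fliftE /=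
  ?(hf.1 x) ?(hf.2 y) subrr.
Qed.

Definition tlift : {linear tensor -> P} := qlift tlift_rel.

Lemma tliftE x y : tlift (tens x y) = f x y.
Proof. by rewrite [LHS]qliftE /f' fliftE. Qed.

End Lift.

Lemma tens_linl (y : N) : linear (tens^~ y). Proof. exact: tens_bilin.2. Qed.
Lemma tens_linr (x : M) : linear (tens x). Proof. exact: tens_bilin.1. Qed.
Definition tensl (y : N) : {linear M -> tensor} := mklin (tens_linl y).
Definition tensr (x : M) : {linear N -> tensor} := mklin (tens_linr x).

End Tensor.
Arguments tensl {Q M N} y.
Arguments tensr {Q M N} x.

Section TensorMap.
Context (Q : comPzRingType) (M N M' N' : lmodType Q).
Context (f : {linear M -> M'}) (g : {linear N -> N'}).

Lemma tmap_bilin : bilin (fun x y => tens (f x) (g y)).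
Proof.
split=> [x a y y'|y a x x'] /=; rewrite linearP.
  exact: tens_linr.
exact: tens_linl.
Qed.

Definition tmap : {linear tensor M N -> tensor M' N'} := tlift tmap_bilin.

Lemma tmapE x y : tmap (tens x y) = tens (f x) (g y).
Proof. exact: tliftE. Qed.

End TensorMap.

Lemma tens_elt (Q : comPzRingType) (M N : lmodType Q) (t : tensor M N) :
  exists s : seq (M * N), t = \sum_(p <- s) tens p.1 p.2.
Proof.
case: (qproj_surj t) => u <-; rewrite (dsumE u).
exists [seq (u p *: p.1, p.2) | p <- dsupp u].
rewrite linear_sum big_map; apply: eq_bigr => -[x y] _ /=.
rewrite -[RHS]/(tensl y (u (x, y) *: x)) linearZ_LR /= /tens -linearZ_LR.
by congr (qpi _ _); rewrite -[RHS]linearZ_LR; congr (din _ _); rewrite /= [RHS]mulr1.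
Qed.
Definition restr (Q R : pzRingType) (phi : {rmorphism Q -> R}) (M : lmodType R) : Type := M.

Section Restriction.
Context (Q R : pzRingType) (phi : {rmorphism Q -> R}) (M : lmodType R).

HB.instance Definition _ := GRing.Zmodule.copy (restr phi M) M.

Definition rscale (q : Q) (x : restr phi M) : restr phi M := phi q *: (x : M).

Lemma rscaleA a b x : rscale a (rscale b x) = rscale (a * b) x.
Proof. by rewrite /rscale rmorphM scalerA. Qed.
Lemma rscale1 : left_id 1 rscale.
Proof. by move=> x; rewrite /rscale rmorph1 scale1r. Qed.
Lemma rscaleDr : right_distributive rscale +%R.
Proof. by move=> a x y; rewrite /rscale scalerDr. Qed.
Lemma rscaleDl x : {morph rscale^~ x : a b / a + b}.
Proof. by move=> a b; rewrite /rscale rmorphD scalerDl. Qed.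
HB.instance Definition _ := GRing.Zmodule_isLmodule.Build Q (restr phi M)
  rscaleA rscale1 rscaleDr rscaleDl.

Lemma restrZ (q : Q) (x : restr phi M) : q *: x = phi q *: (x : M).
Proof. by []. Qed.

End Restriction.

(** Base change R \otimes_Q N along [phi], as an R-module. *)
Section BaseChange.
Context (Q R : comPzRingType) (phi : {rmorphism Q -> R}) (N : lmodType Q).

Lemma mulmap_linear (a : R) :
  linear (fun x : restr phi R^o => a * (x : R) : restr phi R^o).
Proof.
move=> q x y; rewrite mulrDr; congr (_ + _).
exact: (mulrCA a (phi q) (x : R)).
Qed.
Definition mulmap a := mklin (mulmap_linear a).

Definition bchange : Type := tensor (restr phi R^o) N.
HB.instance Definition _ := GRing.Zmodule.copy bchange (tensor (restr phi R^o) N).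

Definition bscale (a : R) (t : bchange) : bchange := tmap (mulmap a) idfun t.

Lemma bscale_tens a (x : restr phi R^o) (y : N) :
  bscale a (tens x y) = tens (a * (x : R) : restr phi R^o) y.
Proof. exact: tmapE. Qed.

Lemma bscale_elt (P : bchange -> Prop) :
  (forall x y, P (tens x y)) -> (forall s t, P s -> P t -> P (s + t)) -> P 0 ->
  forall t, P t.
Proof.
move=> h hD h0 t; case: (tens_elt t) => s ->.
by elim/big_ind: _ => // p _; apply: h.
Qed.

Lemma bscaleDr : right_distributive bscale +%R.
Proof. by move=> a s t; apply: linearD. Qed.
Lemma bscale_0 a : bscale a 0 = 0.
Proof. exact: linear0. Qed.
Lemma bscaleA a b t : bscale a (bscale b t) = bscale (a * b) t.
Proof.
elim/bscale_elt: t => [x y|s t hs ht|]; last by rewrite !bscale_0.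
  by rewrite !bscale_tens mulrA.
by rewrite !bscaleDr hs ht.
Qed.
Lemma bscale1 : left_id 1 bscale.
Proof.
elim/bscale_elt=> [x y|s t hs ht|]; last by rewrite !bscale_0.
  by rewrite bscale_tens mul1r.
by rewrite !bscaleDr hs ht.
Qed.
Lemma bscaleDl t : {morph bscale^~ t : a b / a + b}.
Proof.
move=> a b; elim/bscale_elt: t => [x y|s t hs ht|]; last by rewrite !bscale_0 addr0.
  by rewrite !bscale_tens mulrDl -[LHS]/(tensl y _) linearD.
by rewrite !bscaleDr hs ht addrACA.
Qed.
HB.instance Definition _ := GRing.Zmodule_isLmodule.Build R bchange
  bscaleA bscale1 bscaleDr bscaleDl.

Definition btens (r : R) (y : N) : bchange := tens (r : restr phi R^o) y.

Lemma bchangeZ a r y : a *: btens r y = btens (a * r) y.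
Proof. exact: bscale_tens. Qed.

Lemma btensDr r y y' : btens r (y + y') = btens r y + btens r y'.
Proof. exact: (linearD (tensr (r : restr phi R^o))). Qed.

Lemma btensZr r q y : btens r (q *: y) = btens (r * phi q) y.
Proof.
rewrite /btens -[LHS]/(tensr (r : restr phi R^o) (q *: y)) linearZ_LR.
by rewrite -[RHS]/(tensl y _) mulrC -[_ * _]/(q *: (r : restr phi R^o)) linearZ_LR.
Qed.

Lemma btens_ext (P : lmodType R) (f g : {linear bchange -> P}) :
  (forall y, f (btens 1 y) = g (btens 1 y)) -> f =1 g.
Proof.
move=> fg; elim/bscale_elt=> [x y|s t hs ht|]; last by rewrite !linear0.
  have -> : tens x y = (x : R) *: btens 1 y by rewrite bchangeZ mulr1.
  by rewrite !linearZ_LR fg.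
by rewrite !linearD hs ht.
Qed.

Section Lift.
Context (W : lmodType R) (f : {linear N -> restr phi W}).

Lemma bclift_bilin :
  bilin (fun (x : restr phi R^o) (y : N) => (x : R) *: (f y : W) : restr phi W).
Proof.
split=> [x a y y'|y a x x'] /=.
  rewrite linearP scalerDr; congr (_ + _).
  change ((x : R) *: (phi a *: (f y : W)) = phi a *: ((x : R) *: (f y : W))).
  by rewrite !scalerA mulrC.
rewrite scalerDl; congr (_ + _).
change ((phi a * (x : R)) *: (f y : W) = phi a *: ((x : R) *: (f y : W))).
by rewrite scalerA.
Qed.

Definition bclift_fun (t : bchange) : W := tlift bclift_bilin t.

Lemma bclift_tens (x : R) y : bclift_fun (btens x y) = x *: (f y : W).
Proof. exact: (tliftE bclift_bilin). Qed.

Lemma bclift_add s t : bclift_fun (s + t) = bclift_fun s + bclift_fun t.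
Proof. exact: (linearD (tlift bclift_bilin)). Qed.

Lemma bclift_linear : linear bclift_fun.
Proof.
move=> a s t; rewrite bclift_add; congr (_ + _); elim/bscale_elt: s => [x y|u v hu hv|].
- by rewrite -/(btens x y) bchangeZ !bclift_tens scalerA.
- by rewrite scalerDr !bclift_add hu hv scalerDr.
- by rewrite scaler0 /bclift_fun linear0 scaler0.
Qed.

Definition bclift : {linear bchange -> W} := mklin bclift_linear.

Lemma bcliftE x y : bclift (btens x y) = x *: (f y : W).
Proof. exact: bclift_tens. Qed.

End Lift.

End BaseChange.

Section BaseChangeMap.
Context (Q R : comPzRingType) (phi : {rmorphism Q -> R}) (N N' : lmodType Q).
Context (f : {linear N -> N'}).

Lemma bcunit_linear : linear (fun y => btens phi 1 (f y) : restr phi (bchange phi N')).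
Proof.
move=> q y y'; rewrite linearD linearZ_LR btensDr; congr (_ + _).
by rewrite btensZr restrZ bchangeZ mul1r mulr1.
Qed.

Definition bcmap : {linear bchange phi N -> bchange phi N'} :=
  bclift (mklin bcunit_linear).

Lemma bcmapE r y : bcmap (btens phi r y) = btens phi r (f y).
Proof. by rewrite [LHS]bcliftE /= bchangeZ mulr1. Qed.

End BaseChangeMap.
(** Graded modules X = \bigoplus_n X_n (n : nat), given by the projections
    [gpr n] of X onto X_n. *)
Record gmod (K : pzRingType) := GMod {
  gsort :> lmodType K;
  gpr : nat -> {linear gsort -> gsort};
  gpr_gpr : forall i j x, gpr i (gpr j x) = if i == j then gpr j x else 0;
  gpr_sum : forall x, exists N, x = \sum_(i < N) gpr i x }.
Arguments gpr {K} X n : rename.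

Definition homog (K : pzRingType) (X : gmod K) (n : nat) (x : X) : Prop :=
  gpr X n x = x.

Section GmodBuild.
Context (K : pzRingType) (V : lmodType K) (pr : nat -> {linear V -> V}).

Definition exhaust (x : V) : Prop :=
  exists N, forall N', (N <= N')%N -> x = \sum_(i < N') pr i x.

Lemma exhaustD x y : exhaust x -> exhaust y -> exhaust (x + y).
Proof.
move=> [a ha] [b hb]; exists (maxn a b) => N; rewrite geq_max => /andP[/ha hx /hb hy].
rewrite {1}hx {1}hy -big_split; apply: eq_bigr => i _ /=.
by rewrite linearD.
Qed.

Lemma exhaust0 : exhaust 0.
Proof. by exists 0 => N _; rewrite big1 // => i _; rewrite linear0. Qed.

Lemma exhaust_sum (I : Type) (r : seq I) (F : I -> V) :
  (forall i, exhaust (F i)) -> exhaust (\sum_(i <- r) F i).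
Proof.
by move=> h; elim/big_ind: _ => // [|x y]; [apply: exhaust0 | apply: exhaustD].
Qed.

Lemma exhaust_homog n x :
  (forall i, pr i x = if i == n then x else 0) -> exhaust x.
Proof.
move=> h; exists n.+1 => N nN; rewrite (bigD1 (Ordinal nN)) //= h eqxx.
rewrite big1 ?addr0 // => i /eqP hi; rewrite h ifN //.
by apply/eqP => E; apply: hi; apply: val_inj.
Qed.

Lemma exhaustW x : exhaust x -> exists N, x = \sum_(i < N) pr i x.
Proof. by case=> N h; exists N; apply: h. Qed.

End GmodBuild.

Lemma gpr_exhaust (K : pzRingType) (X : gmod K) (x : X) : exhaust (gpr X) x.
Proof.
case: (gpr_sum x) => N {1}->; apply: exhaust_sum => i.
by apply: (exhaust_homog (n := i)) => j; apply: gpr_gpr.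
Qed.

Section GBase.
Context (K : pzRingType).

Definition gbase_pr (n : nat) : {linear K^o -> K^o} :=
  if n == 0%N then (idfun : {linear K^o -> K^o}) else (\0 : {linear K^o -> K^o}).

Lemma gbase_gpr i j x :
  gbase_pr i (gbase_pr j x) = if i == j then gbase_pr j x else 0.
Proof. by case: i j => [|i] [|j] //=; case: ifP. Qed.

Lemma gbase_sum x : exists N, x = \sum_(i < N) gbase_pr i x.
Proof. by exists 1%N; rewrite big_ord1. Qed.

Definition gbase : gmod K := GMod gbase_gpr gbase_sum.

End GBase.

(** \bigoplus_n C n, with C n placed in degree n + s. *)
Section GTot.
Context (K : pzRingType) (s : nat) (C : nat -> lmodType K).

Definition gtot_pr (n : nat) : {linear dsum C -> dsum C} :=
  
  if (s <= n)%N then (din (n - s)%N \o dcomp (n - s)%N : {linear dsum C -> dsum C})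
  else (\0 : {linear dsum C -> dsum C}).

Lemma gtot_prE n x i : gtot_pr n x i = if (i + s == n)%N then x i else 0.
Proof.
rewrite /gtot_pr; case: (leqP s n) => [sn|ns] /=; last first.
  by rewrite gtn_eqF // (leq_trans ns) // leq_addl.
have [<-|ne] := eqVneq; first by rewrite addnK; apply: din_in.
by apply: din_out; apply: contraNneq ne => <-; rewrite subnK.
Qed.

Lemma gtot_gpr i j x : gtot_pr i (gtot_pr j x) = if i == j then gtot_pr j x else 0.
Proof.
apply: dsum_ext => k; rewrite gtot_prE.
case: (eqVneq i j) => [<-|ij]; first by rewrite gtot_prE; case: eqP.
rewrite gtot_prE; case: (eqVneq (k + s)%N i) => [->|//].
by rewrite (negPf ij).
Qed.

Lemma gtot_sum x : exists N, x = \sum_(i < N) gtot_pr i x.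
Proof.
apply: exhaustW; rewrite [x in exhaust _ x]dsumE; apply: exhaust_sum => i.
apply: (exhaust_homog (n := (i + s)%N)) => j; apply: dsum_ext => k.
rewrite gtot_prE; have [<-|ik] := eqVneq i k.
  by rewrite din_in eq_sym; case: eqP => // _; rewrite din_in.
rewrite din_out // if_same; case: eqP => // _.
by rewrite din_out.
Qed.

Definition gtot : gmod K := GMod gtot_gpr gtot_sum.

End GTot.

Section GDsum.
Context (K : pzRingType) (X : nat -> gmod K).

Definition gdsum_pr (n : nat) : {linear dsum X -> dsum X} :=
  dmap (fun i => gpr (X i) n).

Lemma gdsum_gpr i j x : gdsum_pr i (gdsum_pr j x) = if i == j then gdsum_pr j x else 0.
Proof.
by apply: dsum_ext => k; rewrite /= gpr_gpr; case: ifP.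
Qed.

Lemma gdsum_din n i (v : X i) : gdsum_pr n (din i v) = din i (gpr (X i) n v).
Proof.
apply: dsum_ext => k; rewrite /gdsum_pr dmapE; have [<-|ik] := eqVneq i k.
  by rewrite !din_in.
by rewrite !din_out // linear0.
Qed.

Lemma gdsum_sum x : exists N, x = \sum_(i < N) gdsum_pr i x.
Proof.
apply: exhaustW; rewrite [x in exhaust _ x]dsumE; apply: exhaust_sum => i.
case: (gpr_exhaust (x i)) => N h; exists N => N' /h E.
rewrite {1}E linear_sum; apply: eq_bigr => j _.
by rewrite gdsum_din.
Qed.

Definition gdsum : gmod K := GMod gdsum_gpr gdsum_sum.

End GDsum.

Section GTens.
Context (Q : comPzRingType) (X Y : gmod Q).

Definition gtens_prf (n : nat) (t : tensor X Y) : tensor X Y :=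
  \sum_(i < n.+1) tmap (gpr X i) (gpr Y (n - i)%N) t.

Lemma gtens_pr_linear n : linear (gtens_prf n).
Proof.
move=> a s t; rewrite /gtens_prf scaler_sumr -big_split; apply: eq_bigr => i _.
exact: linearP.
Qed.

Definition gtens_pr n : {linear tensor X Y -> tensor X Y} := mklin (gtens_pr_linear n).

Lemma gtens_prE n x y :
  gtens_pr n (tens x y) = \sum_(i < n.+1) tens (gpr X i x) (gpr Y (n - i)%N y).
Proof. by apply: eq_bigr => i _; rewrite tmapE. Qed.

Lemma tens0l (y : Y) : tens (0 : X) y = 0.
Proof. exact: (linear0 (tensl y)). Qed.
Lemma tens0r (x : X) : tens x (0 : Y) = 0.
Proof. exact: (linear0 (tensr x)). Qed.

Lemma gtens_pr_homog n a b (x : X) (y : Y) :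
  gtens_pr n (tens (gpr X a x) (gpr Y b y)) =
  if n == (a + b)%N then tens (gpr X a x) (gpr Y b y) else 0.
Proof.
rewrite gtens_prE; case: (eqVneq n (a + b)%N) => [->|ne].
  have ha : (a < (a + b).+1)%N by rewrite ltnS leq_addr.
  rewrite (bigD1 (Ordinal ha)) //= gpr_gpr eqxx addKn gpr_gpr eqxx.
  rewrite big1 ?addr0 // => i /eqP hi; rewrite gpr_gpr ifN ?tens0l //.
  by apply/eqP => E; apply: hi; apply: val_inj.
rewrite big1 // => i _; rewrite !gpr_gpr.
have [E|_] := eqVneq (i : nat) a; last by rewrite tens0l.
have [E'|_] := eqVneq (n - i)%N b; last by rewrite tens0r.
by case/eqP: ne; rewrite -E -E' subnKC // -ltnS.
Qed.

Lemma gtens_decomp (t : tensor X Y) :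
  exists s : seq (nat * nat * X * Y), t =
    \sum_(p <- s) tens (gpr X p.1.1.1 p.1.2) (gpr Y p.1.1.2 p.2).
Proof.
case: (tens_elt t) => s ->; elim: s => [|[x y] s [s' IH]].
  by exists [::]; rewrite !big_nil.
rewrite big_cons IH /=.
case: (gpr_sum x) (gpr_sum y) => a hx [b hy].
rewrite -(big_mkord xpredT (fun i => gpr X i x)) /index_iota subn0 in hx.
rewrite -(big_mkord xpredT (fun i => gpr Y i y)) /index_iota subn0 in hy.
exists ([seq (i, j, x, y) | i <- iota 0 a, j <- iota 0 b] ++ s').
rewrite big_cat; congr (_ + _).
rewrite big_allpairs_dep /= {1}hx {1}hy.
rewrite -[LHS]/(tensl _ _) linear_sum; apply: eq_bigr => i _.
by rewrite -[LHS]/(tensr _ _) linear_sum; apply: eq_bigr.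
Qed.

Lemma gtens_gpr i j t : gtens_pr i (gtens_pr j t) = if i == j then gtens_pr j t else 0.
Proof.
case: (gtens_decomp t) => s ->.
transitivity (\sum_(p <- s) if i == j then
    gtens_pr j (tens (gpr X p.1.1.1 p.1.2) (gpr Y p.1.1.2 p.2)) else 0).
  rewrite (linear_sum (gtens_pr j)) (linear_sum (gtens_pr i)).
  apply: eq_bigr => p _; rewrite gtens_pr_homog.
  have [E|ne] := eqVneq j (p.1.1.1 + p.1.1.2)%N; last by rewrite linear0 if_same.
  by rewrite gtens_pr_homog -E.
by case: ifP => _; [rewrite (linear_sum (gtens_pr j)) | rewrite big1].
Qed.

Lemma gtens_sum t : exists N, t = \sum_(i < N) gtens_pr i t.
Proof.
apply: exhaustW; case: (gtens_decomp t) => s ->; apply: exhaust_sum => p.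
apply: (exhaust_homog (n := (p.1.1.1 + p.1.1.2)%N)) => i.
exact: gtens_pr_homog.
Qed.

Definition gtens : gmod Q := GMod gtens_gpr gtens_sum.

End GTens.

Section GBaseChange.
Context (Q R : comPzRingType) (phi : {rmorphism Q -> R}) (X : gmod Q).

Definition gbc_pr n : {linear bchange phi X -> bchange phi X} := bcmap phi (gpr X n).

Lemma gbc_gpr i j t : gbc_pr i (gbc_pr j t) = if i == j then gbc_pr j t else 0.
Proof.
elim/bscale_elt: t => [x y|s t hs ht|].
- rewrite -/(btens phi x y) /gbc_pr !bcmapE gpr_gpr; case: ifP => // _.
  exact: (linear0 (tensr (x : restr phi R^o))).
- by rewrite !linearD hs ht; case: ifP => // _; rewrite addr0.
- by rewrite !linear0 if_same.
Qed.

Lemma gbc_sum t : exists N, t = \sum_(i < N) gbc_pr i t.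
Proof.
apply: exhaustW; elim/bscale_elt: t => [x y|s t|]; last exact: exhaust0.
  case: (gpr_exhaust y) => N h; exists N => N' /h {1}->.
  rewrite -[LHS]/(tensr (x : restr phi R^o) _) linear_sum; apply: eq_bigr => i _.
  by rewrite -/(btens phi x y) /gbc_pr bcmapE.
exact: exhaustD.
Qed.

Definition gbc : gmod R := GMod gbc_gpr gbc_sum.

End GBaseChange.
Record cplx (K : pzRingType) := Cplx {
  cmod :> nat -> lmodType K;
  cdiff : forall n, {linear cmod n.+1 -> cmod n} }.
Arguments cdiff {K} C n : rename.

Definition is_projective (K : pzRingType) (P : lmodType K) : Prop :=
  forall (U W : lmodType K) (p : {linear U -> W}) (f : {linear P -> W}),
    (forall w, exists u, p u = w) ->
  exists h : {linear P -> U}, forall x, p (h x) = f x.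

Definition is_free (K : pzRingType) (F : lmodType K) : Prop :=
  exists (X : choiceType) (f : {linear freemod K X -> F}), bijective f.

Definition is_complex (K : pzRingType) (C : cplx K) : Prop :=
  forall n x, cdiff C n (cdiff C n.+1 x) = 0.

Definition is_resolution (K : pzRingType) (C : cplx K) (M : lmodType K)
    (eps : {linear C 0 -> M}) : Prop :=
  [/\ is_complex C,
      forall n x, cdiff C n x = 0 -> exists y, x = cdiff C n.+1 y,
      forall x, eps x = 0 <-> exists y, x = cdiff C 0 y
    & forall z, exists x, eps x = z].

Definition is_projective_resolution (K : pzRingType) (C : cplx K)
    (M : lmodType K) (eps : {linear C 0 -> M}) : Prop :=
  (forall n, is_projective (C n)) /\ is_resolution eps.

Definition cplx_bc (Q R : comPzRingType) (phi : {rmorphism Q -> R}) (C : cplx Q) :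
    cplx R :=
  @Cplx R (fun n => bchange phi (C n)) (fun n => bcmap phi (cdiff C n)).

Section Homology.
Context (K : pzRingType) (C : cplx K).

Definition cout n : {linear C n -> C n.-1} :=
  match n with
  | 0 => (\0 : {linear C 0 -> C 0})
  | n'.+1 => cdiff C n'
  end.

Definition homology (n : nat) : lmodType K :=
  quotmod (fun z : kermod (cout n) => exists y, ker_incl _ z = cdiff C n y).

End Homology.

(** The canonical free resolution of M: F_n is the free module on the n-th
    syzygy module, syz_{n+1} being the kernel of F_n -> syz_n. *)
Section CanonicalResolution.
Context (K : pzRingType) (M : lmodType K).

Fixpoint syz (n : nat) : lmodType K :=
  if n is n'.+1 then kermod (flift (fun x : syz n' => x)) else M.

Definition canres : cplx K :=
  @Cplx K (fun n => freemod K (syz n))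
    (fun n => ker_incl (flift (fun x : syz n => x)) \o
              flift (fun x : syz n.+1 => x)).

End CanonicalResolution.

(** Tor^K_n(M, L) for a K-algebra L. *)
Definition tor (K L : comPzRingType) (kappa : {rmorphism K -> L})
    (M : lmodType K) (n : nat) : lmodType L :=
  homology (cplx_bc kappa (canres M)) n.

Definition has_dim (k : fieldType) (V : lmodType k) (n : nat) : Prop :=
  exists f : {linear 'rV[k]_n -> V}, bijective f.

(** Dimension; 0 by convention in the infinite-dimensional case. *)
Definition kdim (k : fieldType) (V : lmodType k) : nat :=
  if pselect (exists n, has_dim V n) is left h then projT1 (cid h) else 0%N.

Definition fps := nat -> int.
Definition fps_one : fps := fun n => (n == 0%N)%:Z.
Definition fps_sub (p q : fps) : fps := fun n => p n - q n.
Definition fps_mul (p q : fps) : fps := fun n => \sum_(i < n.+1) p i * q (n - i)%N.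
Definition fps_mult (p : fps) : fps := fun n => if n is n'.+1 then p n' else 0.

Fixpoint fps_div_seq (p q : fps) (n : nat) : seq int :=
  if n is n'.+1 then
    let s := fps_div_seq p q n' in
    rcons s (p n' - \sum_(i < n') s`_i * q (n' - i)%N)
  else [::].
(** Quotient p / q, for q with constant coefficient 1; see [fps_divK]. *)
Definition fps_div (p q : fps) : fps := fun n => (fps_div_seq p q n.+1)`_n.

Lemma size_fps_div_seq p q n : size (fps_div_seq p q n) = n.
Proof. by elim: n => //= n IH; rewrite size_rcons IH. Qed.

Lemma nth_fps_div_seq p q n i : (i < n)%N -> (fps_div_seq p q n)`_i = fps_div p q i.
Proof.
elim: n => // n IH; rewrite ltnS leq_eqVlt => /orP[/eqP->//|ni].
by rewrite /= nth_rcons size_fps_div_seq ni IH.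
Qed.

Lemma fps_divK (p q : fps) : q 0%N = 1 -> fps_mul (fps_div p q) q =1 p.
Proof.
move=> q0 n; rewrite /fps_mul big_ord_recr /= subnn q0 mulr1.
rewrite {2}/fps_div /= nth_rcons size_fps_div_seq ltnn eqxx.
rewrite (eq_bigr (fun i : 'I_n => (fps_div_seq p q n)`_i * q (n - i)%N)).
  by rewrite addrC subrK.
by move=> i _; rewrite nth_fps_div_seq.
Qed.

Definition poincare (K : comPzRingType) (k : fieldType) (kappa : {rmorphism K -> k})
    (M : lmodType K) : fps :=
  fun n => (kdim (tor kappa M n))%:Z.

Definition ideal (K : comPzRingType) (J : K -> Prop) : Prop :=
  [/\ J 0, forall x y, J x -> J y -> J (x + y) & forall a x, J x -> J (a * x)].

Definition maximal_ideal (K : comPzRingType) (J : K -> Prop) : Prop :=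
  [/\ ideal J, ~ J 1
    & forall J', ideal J' -> ~ J' 1 -> (forall x, J x -> J' x) ->
      forall x, J' x -> J x].

(** K is local and kappa is the projection onto its residue field. *)
Definition local_residue (K : comPzRingType) (k : fieldType)
    (kappa : {rmorphism K -> k}) : Prop :=
  (forall c, exists x, kappa x = c) /\
  (forall J, maximal_ideal J <-> (forall x, J x <-> kappa x = 0)).

Definition fin_gen (K : pzRingType) (M : lmodType K) : Prop :=
  exists s : seq M, forall x, span (fun y => y \in s) x.

Definition noetherian (K : comPzRingType) : Prop :=
  forall J : K -> Prop, ideal J ->
  exists s : seq K^o, forall x, J x <-> span (fun y : K^o => y \in s) x.

(** Each differential has image in m C_n, where m = ker kappa. *)
Definition minimal (K : pzRingType) (k : fieldType) (kappa : {rmorphism K -> k})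
    (C : cplx K) : Prop :=
  forall n (x : C n.+1),
    span (fun z => exists a (y : C n), kappa a = 0 /\ z = a *: y) (cdiff C n x).

(** P^R_M(t) = P^Q_M(t) / (1 - t (P^Q_R(t) - 1)), where [kappa] and [rho] are the
    projections of Q and R onto their common residue field. *)
Definition golod (Q R : comPzRingType) (phi : {rmorphism Q -> R}) (k : fieldType)
    (kappa : {rmorphism Q -> k}) (rho : {rmorphism R -> k}) (M : lmodType R) : Prop :=
  poincare rho M =1
  fps_div (poincare kappa (restr phi M))
    (fps_sub fps_one
       (fps_mult (fps_sub (poincare kappa (restr phi R^o)) fps_one))).
Section KerLift.
Context (K : pzRingType) (U V W : lmodType K) (f : {linear U -> V}).
Context (h : {linear W -> U}) (fh : forall w, f (h w) = 0).

Lemma kerliftP w : h w \in kerp f. Proof. by rewrite unfold_in /kerp fh. Qed.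
Lemma kerlift_linear : linear (fun w => KerMod (kerliftP w)).
Proof. by move=> a x y; apply: val_inj; rewrite /= linearP. Qed.
Definition kerlift : {linear W -> kermod f} := mklin kerlift_linear.

End KerLift.

(** Complex of homogeneous components; [d] is meant to have degree -1, so that
    the projection [gpr X n] in [gcplx] is the identity on the values of [d]. *)
Section GradedComplex.
Context (K : pzRingType) (X : gmod K) (d : {linear X -> X}).

Lemma gdefect_linear n : linear (fun x => gpr X n x - x).
Proof. by move=> a x y; rewrite linearP scalerBr opprD addrACA. Qed.
Definition gdefect n : {linear X -> X} := mklin (gdefect_linear n).

Definition gcomp (n : nat) : lmodType K := kermod (gdefect n).

Lemma gcomp_homog n (x : gcomp n) : homog n (ker_incl _ x).
Proof. by apply/eqP; rewrite -subr_eq0; exact: (ker_valP x). Qed.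

Lemma gdefect_gpr n (x : X) : gdefect n (gpr X n x) = 0.
Proof. by rewrite mklinE gpr_gpr eqxx subrr. Qed.

Definition gcplx : cplx K :=
  @Cplx K gcomp (fun n =>
    kerlift (h := gpr X n \o d \o ker_incl (gdefect n.+1))
      (fun x => gdefect_gpr n (d (ker_incl _ x)))).

Lemma gcplx_diffE n (x : gcplx n.+1) :
  ker_incl _ (cdiff gcplx n x) = gpr X n (d (ker_incl _ x)).
Proof. by []. Qed.

End GradedComplex.

(** f has degree -1 (and X, Y live in nonnegative degrees). *)
Definition degm1 (K : pzRingType) (X Y : gmod K) (f : {linear X -> Y}) : Prop :=
  (forall x, homog 0 x -> f x = 0) /\
  (forall n x, homog n.+1 x -> homog n (f x)).

Lemma lincomb_linear (Q : comPzRingType) (U W : lmodType Q) (a : Q)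
  (f g : {linear U -> W}) : linear (fun t => a *: f t + g t).
Proof.
move=> b u v; rewrite (linearP f) (linearP g) !scalerDr !scalerA.
by rewrite [a * b]mulrC addrACA.
Qed.

Section TensorPowers.
Context (Q : comPzRingType) (X : gmod Q).

Fixpoint tpow (n : nat) : gmod Q :=
  if n is n'.+1 then gtens X (tpow n') else gbase Q.

Fixpoint ptens (s : seq X) : tpow (size s) :=
  if s is x :: s' then tens x (ptens s') else (1 : Q^o).

Definition gbar : gmod Q := gdsum tpow.

(** The element [x_1|...|x_n] of Bar, for s = x_1, ..., x_n. *)
Definition brk (s : seq X) : gbar := din (size s) (ptens s).

(** Length-indexed variant of [ptens], reading a sequence of size n. *)
Fixpoint ptn (n : nat) (s : seq X) : tpow n :=
  if n is n'.+1 then tens (head 0 s) (ptn n' (behead s)) else (1 : Q^o).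

Lemma ptensE s : ptens s = ptn (size s) s.
Proof. by elim: s => //= x s ->. Qed.

Lemma brkE n s : size s = n -> brk s = din n (ptn n s).
Proof. by move=> <-; rewrite /brk ptensE. Qed.

Lemma tpow_ext n (W : lmodType Q) (f g : {linear tpow n -> W}) :
  (forall s, size s = n -> f (ptn n s) = g (ptn n s)) -> f =1 g.
Proof.
elim: n W f g => [|n IH] W f g fg.
  move=> t; have -> : t = (t : Q) *: ((1 : Q^o) : tpow 0).
    by rewrite -[RHS]/((t : Q) * 1) mulr1.
  by rewrite !linearZ_LR; congr (_ *: _); apply: (fg [::]).
apply: tens_ext => x; apply: (IH _ (f \o tensr x) (g \o tensr x)) => s sn.
by apply: (fg (x :: s)); rewrite /= sn.
Qed.

(** Linearity in each entry, for every length. *)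
Definition slotlin (W : lmodType Q) (f : seq X -> W) : Prop :=
  forall s1 s2 a x x',
    f (s1 ++ (a *: x + x') :: s2) = a *: f (s1 ++ x :: s2) + f (s1 ++ x' :: s2).

Lemma ptn_slot n s1 s2 a x x' : size (s1 ++ x :: s2) = n ->
  ptn n (s1 ++ (a *: x + x') :: s2) =
  a *: ptn n (s1 ++ x :: s2) + ptn n (s1 ++ x' :: s2).
Proof.
elim: s1 n => [|y s1 IH] [|n] //= [E]; first exact: (tens_bilin X (tpow n)).2.
by rewrite IH //; apply: (tens_bilin X (tpow n)).1.
Qed.

Lemma brk_slotlin : slotlin brk.
Proof.
move=> s1 s2 a x x'; pose n := size (s1 ++ x :: s2).
have E z : size (s1 ++ z :: s2) = n by rewrite /n !size_cat.
by rewrite !(brkE (E _)) ptn_slot // linearP.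
Qed.

Lemma tpow_lift_ex (W : lmodType Q) n (f : seq X -> W) : slotlin f ->
  exists L : {linear tpow n -> W}, forall s, size s = n -> L (ptn n s) = f s.
Proof.
elim: n f => [|n IH] f hf.
  exists (mklin (scalel_linear (f [::]))) => -[|//] _.
  by rewrite mklinE scale1r.
have hx x : slotlin (fun s => f (x :: s)).
  by move=> s1 s2 a y y'; apply: (hf (x :: s1)).
pose L x := projT1 (cid (IH _ (hx x))).
have LE x s : size s = n -> L x (ptn n s) = f (x :: s).
  by rewrite /L; case: cid => /= l hl; apply: hl.
have hb : bilin (fun x (t : tpow n) => L x t).
  split=> [x|t a x x']; first by move=> a t t'; rewrite linearP.
  apply: (tpow_ext (g := mklin (lincomb_linear a (L x) (L x')))) => s sn.
  by rewrite mklinE !LE //; apply: (hf [::]).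
exists (tlift hb) => -[|x s] //= [sn].
by rewrite [LHS](tliftE hb) LE.
Qed.

Lemma bar_lift_ex (Y W : lmodType Q) (D : seq X -> Y -> W) :
    (forall y, slotlin (D^~ y)) -> (forall s, linear (D s)) ->
  exists L : {linear tensor gbar Y -> W}, forall s y, L (tens (brk s) y) = D s y.
Proof.
move=> hD1 hD2.
pose l n y := projT1 (cid (tpow_lift_ex n (hD1 y))).
have lE n y s : size s = n -> l n y (ptn n s) = D s y.
  by rewrite /l; case: cid => /= f hf; apply: hf.
pose L y : {linear gbar -> W} := dlift (fun n => l n y).
have LE y n t : L y (din n t) = l n y t by apply: dlift_din.
have hb : bilin (fun (b : gbar) y => L y b).
  split=> [b a y y'|y]; last by move=> a b b'; rewrite linearP.
  apply: (dsum_lin_ext (g := mklin (lincomb_linear a (L y) (L y')))) => n t.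
  rewrite mklinE; apply: etrans (LE _ _ _) _.
  apply: etrans (_ : a *: l n y t + l n y' t = _); last first.
    by congr (_ *: _ + _); apply/esym/LE.
  have T : l n (a *: y + y') =1 mklin (lincomb_linear a (l n y) (l n y')).
    by apply: tpow_ext => s sn; rewrite mklinE !lE //; apply: hD2.
  exact: T.
exists (tlift hb) => s y.
by rewrite tliftE (brkE (erefl (size s))) LE lE.
Qed.

End TensorPowers.
(** A complex A of Q-modules with A_0 = Q; [upos A n] is A_{n+1}. *)
Record ucplx (Q : comPzRingType) := UCplx {
  upos : nat -> lmodType Q;
  udiff1 : {linear upos 0%N -> Q^o};
  udiff : forall n, {linear upos n.+1 -> upos n} }.
Arguments udiff1 {Q} A : rename.
Arguments udiff {Q} A n : rename.

Section UCplx.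
Context (Q : comPzRingType) (A : ucplx Q).

Definition umod (n : nat) : lmodType Q := if n is n'.+1 then upos A n' else Q^o.

Definition ucplx_cplx : cplx Q :=
  @Cplx Q umod (fun n =>
    match n return {linear umod n.+1 -> umod n} with
    | 0 => udiff1 A
    | n'.+1 => udiff A n'
    end).

Context (R : comPzRingType) (phi : {rmorphism Q -> R}).

Lemma uaug_linear : linear (fun q : Q^o => phi q : restr phi R^o).
Proof. by move=> a x y; rewrite rmorphD rmorphM. Qed.

(** The canonical projection A_0 = Q -> R. *)
Definition uaug : {linear ucplx_cplx 0%N -> restr phi R^o} := mklin uaug_linear.

End UCplx.
Coercion ucplx_cplx : ucplx >-> cplx.

Definition totdiff (K : pzRingType) (C : nat -> lmodType K)
    (d : forall n, {linear C n.+1 -> C n}) : {linear dsum C -> dsum C} :=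
  dlift (fun n =>
    match n return {linear C n -> dsum C} with
    | 0 => (\0 : {linear C 0%N -> dsum C})
    | n'.+1 => (din n' \o d n' : {linear C n'.+1 -> dsum C})
    end).

Section AInfinity.
Context (Q : comPzRingType) (A : ucplx Q).

(** A_+[1]: the component [upos A n] = A_{n+1} sits in degree n + 2. *)
Definition susp : gmod Q := gtot 2 (upos A).

Lemma sgn_linear n : linear (fun x : upos A n => (-1) ^+ n.+2 *: x).
Proof. by move=> a x y; rewrite scalerDr !scalerA mulrC. Qed.

(** x |-> (-1)^(|x| + 1) x, where |x| = n + 1 is the degree in A. *)
Definition sgn : {linear susp -> susp} := dmap (fun n => mklin (@sgn_linear n)).

Definition susp_diff (x : susp) : susp := - totdiff (udiff A) x.

(** d_1^A, as a map on A_+[1]. *)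
Definition susp_d1 (x : susp) : Q := udiff1 A (x 0%N).

(** [m n] is m_{n+1} : A_+[1]^{\otimes n+1} -> A_+[1]. *)
Definition ainf_maps := forall n, {linear tpow susp n.+1 -> susp}.

(** m_n ([x_1|...|x_n]), for s = x_1, ..., x_n with n >= 1. *)
Definition mapp (m : ainf_maps) (s : seq susp) : susp :=
  if s is x :: s' then m (size s') (ptens (x :: s')) else 0.

(** The entries of (1^{\otimes j} \otimes m_i \otimes 1^{\otimes n-i-j}) (s); as
    m_i has odd degree, the first j entries get the sign [sgn]. *)
Definition minsert (m : ainf_maps) (i j : nat) (s : seq susp) : seq susp :=
  map sgn (take j s) ++ mapp m (take i (drop j s)) :: drop (j + i) s.

Definition ainf_algebra (m : ainf_maps) : Prop :=
  [/\ forall n, degm1 (m n),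
      forall x, mapp m [:: x] = susp_diff x,
      forall x y,
        mapp m [:: mapp m [:: x; y]] +
        (mapp m [:: mapp m [:: x]; y] + mapp m [:: sgn x; mapp m [:: y]]) =
        susp_d1 x *: y - susp_d1 y *: x
    & forall s, (3 <= size s)%N ->
        \sum_(1 <= i < (size s).+1) \sum_(0 <= j < (size s - i).+1)
          mapp m (minsert m i j s) = 0].

Context (G : cplx Q).

Definition gmodule : gmod Q := gtot 0 G.

(** [mG n] is m^G_{n+1} : A_+[1]^{\otimes n} \otimes G -> G. *)
Definition amod_maps := forall n, {linear gtens (tpow susp n) gmodule -> gmodule}.

(** m^G_{n+1} ([x_1|...|x_n] \otimes g), for s = x_1, ..., x_n. *)
Definition gapp (mG : amod_maps) (s : seq susp) (g : gmodule) : gmodule :=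
  mG (size s) (tens (ptens s) g).

(** In the last sum, the term of index i is m^G_{n-i+1} (1^{\otimes n-i} \otimes m^G_i)
    for n = size s + 1. *)
Definition ainf_module (m : ainf_maps) (mG : amod_maps) : Prop :=
  [/\ forall n, degm1 (mG n),
      forall g, gapp mG [::] g = totdiff (cdiff G) g,
      forall x g,
        gapp mG [::] (gapp mG [:: x] g) +
        (gapp mG [:: mapp m [:: x]] g + gapp mG [:: sgn x] (gapp mG [::] g)) =
        susp_d1 x *: g
    & forall s g, (2 <= size s)%N ->
        \sum_(1 <= i < (size s).+1) \sum_(0 <= j < (size s - i).+1)
          gapp mG (minsert m i j s) g +
        \sum_(1 <= i < (size s).+2)
          gapp mG (map sgn (take ((size s).+1 - i) s))
                  (gapp mG (drop ((size s).+1 - i) s) g) = 0].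

Definition barG : gmod Q := gtens (gbar susp) gmodule.

Context (m : ainf_maps) (mG : amod_maps).

(** The differential on [x_1|...|x_n] \otimes g, for s = x_1, ..., x_n. *)
Definition bar_formula (s : seq susp) (g : gmodule) : barG :=
  \sum_(1 <= i < (size s).+1) \sum_(0 <= j < (size s - i).+1)
    tens (brk (minsert m i j s)) g +
  \sum_(1 <= i < (size s).+2)
    tens (brk (map sgn (take ((size s).+1 - i) s)))
         (gapp mG (drop ((size s).+1 - i) s) g).

Lemma mapp_slotlin : slotlin (mapp m).
Proof.
have E n s : size s = n.+1 -> mapp m s = m n (ptn n.+1 s).
  by case: s => // x s [<-]; rewrite /mapp ptensE.
move=> s1 s2 a x x'; pose n := (size s1 + size s2)%N.
have Es z : size (s1 ++ z :: s2) = n.+1 by rewrite size_cat /= addnS.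
by rewrite !(E _ _ (Es _)) ptn_slot // linearP.
Qed.

Lemma gapp_slotlin g : slotlin (fun s => gapp mG s g).
Proof.
have E n s : size s = n -> gapp mG s g = mG n (tens (ptn n s) g).
  by move=> <-; rewrite /gapp ptensE.
move=> s1 s2 a x x'; pose n := (size s1 + size s2).+1.
have Es z : size (s1 ++ z :: s2) = n by rewrite size_cat /= addnS.
rewrite !(E _ _ (Es _)) ptn_slot //.
by rewrite (tens_bilin (tpow susp n) gmodule).2 linearP.
Qed.

Lemma take_slot T k (s1 s2 : seq T) z : take k (s1 ++ z :: s2) =
  if (k <= size s1)%N then take k s1 else s1 ++ z :: take (k - (size s1).+1) s2.
Proof.
rewrite take_cat; case: ltngtP => [//|lt|->]; last by rewrite subnn take_size cats0.
by rewrite -(subnSK lt).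
Qed.

Lemma drop_slot T k (s1 s2 : seq T) z : drop k (s1 ++ z :: s2) =
  if (k <= size s1)%N then drop k s1 ++ z :: s2 else drop (k - (size s1).+1) s2.
Proof.
rewrite drop_cat; case: ltngtP => [//|lt|->]; last by rewrite subnn drop_size.
by rewrite -(subnSK lt).
Qed.

Lemma slotlin_sgn (W : lmodType Q) (f : seq susp -> W) (t : seq susp) s1 s2 a x x' :
  slotlin f ->
  f (map sgn (s1 ++ (a *: x + x') :: s2) ++ t) =
  a *: f (map sgn (s1 ++ x :: s2) ++ t) + f (map sgn (s1 ++ x' :: s2) ++ t).
Proof. by move=> hf; rewrite !map_cat !map_cons -!catA !cat_cons (linearP sgn) hf. Qed.

Lemma minsert_slotlin (W : lmodType Q) (f : seq susp -> W) i j :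
  slotlin f -> slotlin (fun s => f (minsert m i j s)).
Proof.
move=> hf s1 s2 a x x'; rewrite /minsert !take_slot !drop_slot.
case: (leqP j (size s1)) => hj; last first.
  by rewrite leqNgt ltn_addr //=; apply: slotlin_sgn.
rewrite !take_slot size_drop leq_subRL //; case: leqP => hi; last first.
  by rewrite mapp_slotlin hf.
by rewrite -!cat_cons !catA hf.
Qed.

Lemma bar_formula_slotlin g : slotlin (bar_formula^~ g).
Proof.
move=> s1 s2 a x x'; rewrite /bar_formula.
have Es z : size (s1 ++ z :: s2) = (size s1 + size s2).+1 by rewrite size_cat /= addnS.
rewrite !Es scalerDr addrACA !scaler_sumr -!big_split; congr (_ + _).
  apply: eq_bigr => i _; rewrite /= scaler_sumr -big_split; apply: eq_bigr => j _ /=.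
  rewrite -(tens_bilin (gbar susp) gmodule).2; congr (tens _ _).
  exact: (minsert_slotlin i j (@brk_slotlin _ susp)).
apply: eq_bigr => i _ /=; move: ((size s1 + size s2).+2 - i)%N => k.
rewrite !take_slot !drop_slot; case: leqP => hk.
  rewrite gapp_slotlin.
  exact: (tens_bilin (gbar susp) gmodule).1.
rewrite -(tens_bilin (gbar susp) gmodule).2; congr (tens _ _).
have := @slotlin_sgn _ _ [::] s1 (take (k - (size s1).+1) s2) a x x'
  (@brk_slotlin _ susp).
by rewrite !cats0.
Qed.

Lemma bar_formula_linear s : linear (bar_formula s).
Proof.
move=> a g g'; rewrite /bar_formula scalerDr addrACA !scaler_sumr -!big_split.
congr (_ + _).
  apply: eq_bigr => i _; rewrite /= scaler_sumr -big_split; apply: eq_bigr => j _ /=.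
  exact: (tens_bilin (gbar susp) gmodule).1.
apply: eq_bigr => i _ /=; rewrite -(tens_bilin (gbar susp) gmodule).1; congr (tens _ _).
by rewrite /gapp (tens_bilin (tpow susp _) gmodule).1 linearP.
Qed.

Definition bar_diffQ : {linear barG -> barG} :=
  projT1 (cid (bar_lift_ex bar_formula_slotlin bar_formula_linear)).

Lemma bar_diffQE s g : bar_diffQ (tens (brk s) g) = bar_formula s g.
Proof. by rewrite /bar_diffQ; case: cid. Qed.

Context (R : comPzRingType) (phi : {rmorphism Q -> R}) (M : lmodType R).
Context (epsG : {linear G 0%N -> restr phi M}).

Definition bar : gmod R := gbc phi barG.
Definition bar_diff : {linear bar -> bar} := bcmap phi bar_diffQ.
Definition bar_cplx : cplx R := gcplx bar_diff.

Lemma bar_diffE (r : R) s g :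
  bar_diff (btens phi r (tens (brk s) g)) = btens phi r (bar_formula s g).
Proof. by rewrite [LHS]bcmapE bar_diffQE. Qed.

Lemma bar_epsQ_bilin :
  bilin (fun (b : gbar susp) (g : gmodule) =>
    (b 0%N : Q^o) *: (epsG (g 0%N)) : restr phi M).
Proof.
split=> [b a g g'|g a b b']; first by rewrite /= linearP scalerDr !scalerA mulrC.
by rewrite /= scalerDl scalerA.
Qed.

Definition bar_eps : {linear bar -> M} := bclift (tlift bar_epsQ_bilin).

Lemma bar_epsE (r : R) (s : seq susp) (g : gmodule) :
  bar_eps (btens phi r (tens (brk s) g)) =
  if s is [::] then r *: (epsG (g 0%N) : M) else 0.
Proof.
rewrite [LHS]bcliftE tliftE; case: s => [|x s].
  by rewrite [brk _ _]din_in scale1r.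
by rewrite [brk _ _]din_out // scale0r scaler0.
Qed.

Definition bar_aug : {linear bar_cplx 0%N -> M} := bar_eps \o ker_incl _.

End AInfinity.

(* Main.v *)
Require Import Defs.
From mathcomp Require Import all_boot all_order all_algebra.
From mathcomp Require Import boolp.

Set Implicit Arguments.
Unset Strict Implicit.
Unset Printing Implicit Defensive.
Import GRing.Theory.
Local Open Scope ring_scope.

(** Write X = A_+[1], V = Bar A (x) G and D for the Q-linear map on V given by the bar
    formula.  The A_infinity relations say that D^2 is the curvature
    [x_1|...|x_n](x)g |-> d_1(x_1) [x_2|...|x_n](x)g, whose image is I V; so D becomes a
    differential on R (x) V.  Stripping the first bar entry identifies V with G (+) (X (x) V),
    and D makes A (x) V = V (+) (X (x) V) into a complex over Q that contracts onto G.
    The kernel I V (+) (X (x) V) of A (x) V -> R (x) V is acyclic: filter it by the degree of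
    the factor V, where the leading part of the differential is d_A (x) 1, and use that V is
    flat and A resolves R.  Hence a cycle of R (x) V lifts to a cycle of A (x) V, and this is
    homologous to a cycle of G.

    Over a local ring, the decomposition V = G (+) (X (x) V) shows that the bar resolution has
    in degree n a free module of rank the n-th coefficient of P_M / (1 - t (P_R - 1)).
    A free resolution F with these finite ranks is minimal iff k (x) F has zero differential,
    iff its homology Tor has these dimensions. *)

(** * Projective modules *)

(** No differential on A (x) V is given, because A carries no strict product, and over [Q] the bar
    formula alone is not a differential. What makes A (x) V usable is that the curvature factors as
    D D = c u, where u : V -> X (x) V strips the first entry and c : X (x) V -> V multiplies by d_1.
    With D' the operator that D induces on X (x) V through u, the map (v, w) |-> (D v - c w, u v -
    D' w) squares to zero formally. Once this factorization is proved, the acyclicity argument uses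
    of the operations only m_1, m_1^G and the degrees.

    In the Golod part the delicate point is finiteness: [kdim] is 0 on infinite-dimensional spaces,
    so an equality of Poincaré series says nothing until the ranks involved are known to be finite.
    The Noetherian hypothesis and the minimality of A and G yield these ranks. *)

Section Projective.
Context (K : pzRingType).

(** The free module on the underlying set of [P] surjects onto [P], and a section of this surjection
    is a dual basis: [s v x] is the coordinate of [v] at the generator [x], and only finitely many
    coordinates are nonzero. Tensor products, flatness and kernels of reductions are all computed on
    these coordinates. *)
Lemma projective_dual_basis (P : lmodType K) : is_projective P ->
  exists s : {linear P -> freemod K P}, forall v, flift id (s v) = v.
Proof.
move=> hP; have [s hs] : exists h : {linear P -> freemod K P},
    forall x, flift id (h x) = (idfun : {linear P -> P}) x.
  by apply: hP => w; exists (fgen K w); rewrite fliftE.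
by exists s.
Qed.

Lemma projective_retract (P N : lmodType K) (i : {linear N -> P}) (r : {linear P -> N}) :
  is_projective P -> (forall x, r (i x) = x) -> is_projective N.
Proof.
move=> hP ri U W p f hp; have [h hh] := hP U W p (f \o r) hp.
by exists (h \o i) => x; rewrite /= hh /= ri.
Qed.

(** [d] need not be onto, so projectivity is applied to the pullback of [f] and [d], which surjects
    onto [P] because every [f x] lies in the image of [d]. *)
Lemma projective_lift (P U W : lmodType K) (d : {linear U -> W}) (f : {linear P -> W}) :
  is_projective P -> (forall x, exists y, f x = d y) ->
  exists h : {linear P -> U}, forall x, d (h x) = f x.
Proof.
move=> hP fd.
have hl : linear (fun z : (P * U)%type => f z.1 - d z.2).
  move=> a x y; rewrite -[f _]/(f (a *: x.1 + y.1)) -[d _]/(d (a *: x.2 + y.2)).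
  by rewrite (linearP f) (linearP d) scalerBr opprD addrACA.
pose N := kermod (mklin hl).
have l1 : linear (fun z : N => (ker_incl (mklin hl) z).1) by move=> a x y; rewrite linearP.
have l2 : linear (fun z : N => (ker_incl (mklin hl) z).2) by move=> a x y; rewrite linearP.
have [x|h hh] := hP N P (mklin l1) idfun.
  have [y fx] := fd x.
  have E : (x, y) \in kerp (mklin hl) by rewrite unfold_in /kerp /= fx subrr.
  by exists (KerMod E).
exists (mklin l2 \o h) => x; move: (ker_valP (h x)) (hh x).
by rewrite unfold_in /kerp /= subr_eq0 => /eqP <- ->.
Qed.

Lemma free_projective (X : choiceType) : is_projective (freemod K X).
Proof.
move=> U W p f hp.
have /choice[u hu] : forall x, exists v, p v = f (fgen K x) by move=> x; apply: hp.
exists (flift u) => x; apply: (fmod_ext (g := p \o flift u)) => y.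
by rewrite -[LHS]/(p (flift u (fgen K y))) fliftE hu.
Qed.

Lemma dsum_projective (I : choiceType) (V : I -> lmodType K) :
  (forall i, is_projective (V i)) -> is_projective (dsum V).
Proof.
move=> hV U W p f hp.
pose h i := projT1 (cid (hV i U W p (f \o din i) hp)).
have hE i v : p (h i v) = f (din i v) by rewrite /h; case: cid.
exists (dlift h) => x; apply: (dsum_lin_ext (f := p \o dlift h)) => i v.
by rewrite /= -hE; congr (p _); apply: dlift_din.
Qed.

End Projective.

(** * Tensor products, base change and flatness of projective modules *)

Section Flat.
Context (Q : comPzRingType).

Lemma tensorNl (M N : lmodType Q) (x : M) (z : N) : tens (- x) z = - tens x z.
Proof. exact: (linearN (tensl z)). Qed.
Lemma tensor0r (M N : lmodType Q) (x : M) : tens x (0 : N) = 0.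
Proof. exact: (linear0 (tensr x)). Qed.
Lemma tensor0l (M N : lmodType Q) (z : N) : tens (0 : M) z = 0.
Proof. exact: (linear0 (tensl z)). Qed.

Lemma flift_coordE (N W : lmodType Q) (f : N -> W) (t : freemod Q N) (s : seq N) :
  uniq s -> (forall x, x \notin s -> t x = 0) ->
  flift f t = \sum_(x <- s) (t x : Q) *: f x.
Proof. by move=> us hs; apply: etrans (dlift_sub _ us hs) _. Qed.

Lemma flift_lin (N W : lmodType Q) (f g : N -> W) a t :
  flift (fun x => a *: f x + g x) t = a *: flift f t + flift g t.
Proof.
rewrite !(flift_coordE _ (dsupp_uniq t) (@dsupp_out _ _ _ t)) scaler_sumr -big_split.
apply: eq_bigr => x _ /=; rewrite scalerDr !scalerA.
by congr (_ *: _ + _); rewrite mulrC.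
Qed.

Lemma tensor_projective (P N : lmodType Q) :
  is_projective P -> is_projective N -> is_projective (tensor P N).
Proof.
move=> /projective_dual_basis[s hs] /projective_dual_basis[t ht] U W p f hp.
have /choice[u hu] : forall x, exists v, p v = f (tens x.1 x.2) by move=> x; apply: hp.
(* Arbitrary preimages [u (a, b)] of [f (tens a b)] at pairs of generators are extended bilinearly
   along the dual-basis coordinates of [x] and [y]. *)
have hb : bilin (fun x y => flift (fun a => flift (fun b => u (a, b)) (t y)) (s x)).
  split=> [x a y y'|y a x x']; last by rewrite !linearP.
  rewrite -flift_lin; congr (flift _ _); apply/funext => z.
  by rewrite !linearP.
exists (tlift hb) => z; apply: (tens_ext (f := p \o tlift hb)) => x y.
rewrite -[LHS]/(p (tlift hb (tens x y))) tliftE; have hw c : p (flift (fun b => u (c, b)) (t y)) = f (tens c y).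
  have E : p \o flift (fun b => u (c, b)) =1 (f \o tensr c) \o flift id.
    apply: fmod_ext => b; rewrite -[LHS]/(p (flift _ (fgen Q b))) fliftE hu.
    by rewrite -[RHS]/(f (tens c (flift id (fgen Q b)))) fliftE.
  by rewrite -[RHS]/(f (tens c y)) -{2}[y]ht; apply: E.
have E : p \o flift (fun a => flift (fun b => u (a, b)) (t y)) =1
    (f \o tensl y) \o flift id.
    apply: fmod_ext => a; rewrite -[LHS]/(p (flift _ (fgen Q a))) fliftE hw.
  by rewrite -[RHS]/(f (tens (flift id (fgen Q a)) y)) fliftE.
by rewrite -{2}[x]hs; apply: E.
Qed.

Lemma base_projective (K : pzRingType) : is_projective K^o.
Proof.
move=> U W p f hp; have [u hu] := hp (f 1).
exists (mklin (scalel_linear u)) => x; rewrite mklinE linearZ_LR hu -linearZ_LR.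
by congr (f _); apply: mulr1.
Qed.

Lemma bchange_projective (R : comPzRingType) (phi : {rmorphism Q -> R}) (P : lmodType Q) :
  is_projective P -> is_projective (bchange phi P).
Proof.
move=> hP U W p f hp.
have lp : linear (p : restr phi U -> restr phi W) by move=> a x y; apply: linearP.
have lf : linear (fun v : P => f (btens phi 1 v) : restr phi W).
  move=> a x y; rewrite btensDr btensZr linearD mul1r -[phi a]mulr1 -bchangeZ.
  by rewrite linearZ_LR.
have [h hh] := hP _ _ (mklin lp) (mklin lf) hp.
exists (bclift h) => x; apply: (btens_ext (f := p \o bclift h)) => y.
by rewrite -[LHS]/(p (bclift h (btens phi 1 y))) bcliftE scale1r; apply: hh.
Qed.

(* The coordinates of t in a dual basis of P, taken in Y, lie in the kernel of f and f'. *)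
Lemma projective_flat (P X X' Y Z : lmodType Q) (f : {linear Y -> X})
    (f' : {linear Y -> X'}) (g : {linear Z -> Y}) :
    is_projective P ->
    (forall y, f y = 0 -> f' y = 0 -> exists z, y = g z) ->
  forall t : tensor Y P, tmap f idfun t = 0 -> tmap f' idfun t = 0 ->
  exists z, t = tmap g idfun z.
Proof.
move=> /projective_dual_basis[s hs] fg t ft f't.
have hb (W : lmodType Q) x : bilin (fun (y : W) (v : P) => (s v x : Q) *: y).
  split=> [y a v v'|v a y y'] /=; first by rewrite linearP scalerDl scalerA.
  by rewrite scalerDr !scalerA mulrC.
pose co (W : lmodType Q) x : {linear tensor W P -> W} := tlift (hb W x).
have coM (W W' : lmodType Q) (k : {linear W -> W'}) x u : co W' x (tmap k idfun u) = k (co W x u).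
  apply: (tens_ext (M := W) (N := P) (f := co W' x \o tmap k idfun) (g := k \o co W x)) => y v.
  rewrite -[LHS]/(co W' x (tmap k idfun (tens y v))) tmapE /co tliftE.
  by rewrite -[RHS]/(k (tlift (hb W x) (tens y v))) tliftE linearZ_LR.
have [S [uS tS]] : exists S : seq P, uniq S /\ t = \sum_(x <- S) tens (co Y x t) x.
  case: (tens_elt t) => l ->; pose S := undup (flatten [seq dsupp (s p.2) | p <- l]).
  exists S; split; first exact: undup_uniq.
  under [RHS]eq_bigr do rewrite linear_sum -[tens _ _]/(tensl _ _) linear_sum.
  rewrite exchange_big /= big_seq [RHS]big_seq; apply: eq_bigr => -[y v] lp /=.
  rewrite -{1}(hs v) (flift_coordE (s := S) _ (undup_uniq _)) => [|x]; last first.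
    rewrite mem_undup => /negP nS; apply: dsupp_out; apply/negP => xs; apply: nS.
    by apply/flattenP; exists (dsupp (s v)) => //; apply/mapP; exists (y, v).
  rewrite -[LHS]/(tensr _ _) linear_sum; apply: eq_bigr => x _.
  rewrite -[RHS]/(tens (tlift (hb Y x) (tens y v)) x) tliftE.
  by rewrite -[RHS]/(tensl x (_ *: y)) [LHS]linearZ_LR [RHS]linearZ_LR.
have /choice[z hz] : forall x, exists w, co Y x t = g w.
  move=> x; apply: fg; first by rewrite -coM ft linear0.
  by rewrite -coM f't linear0.
exists (\sum_(x <- S) tens (z x) x); rewrite {1}tS linear_sum.
by apply: eq_bigr => x _; rewrite hz tmapE.
Qed.

End Flat.

(** * Splittings and homogeneous sequences *)

Section Splits.
Context {T : Type}.

(** Deconcatenation of words. Its coassociativity lets nested sums of bar terms be regrouped without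
    index arithmetic. *)
Definition splits (s : seq T) : seq (seq T * seq T) :=
  [seq (take j s, drop j s) | j <- index_iota 0 (size s).+1].

Context {V : zmodType}.

Lemma splits_nil (F : seq T * seq T -> V) :
  \sum_(p <- splits [::]) F p = F ([::], [::]).
Proof. exact: big_seq1. Qed.

Lemma splits_cons (F : seq T * seq T -> V) x s :
  \sum_(p <- splits (x :: s)) F p =
  F ([::], x :: s) + \sum_(p <- splits s) F (x :: p.1, p.2).
Proof.
have -> : splits (x :: s) = ([::], x :: s) :: [seq (x :: p.1, p.2) | p <- splits s].
  rewrite /splits /index_iota !subn0 -[(size (x :: s)).+1]/(1 + (size s).+1)%N.
  rewrite iotaD map_cat add0n -[iota 1 _]/(iota (1 + 0) (size s).+1) iotaDl.
  by rewrite -!map_comp.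
by rewrite big_cons big_map.
Qed.
#[local] Arguments splits : simpl never.

Lemma splits_coassoc (F : seq T -> seq T -> seq T -> V) s :
  \sum_(p <- splits s) \sum_(q <- splits p.1) F q.1 q.2 p.2 =
  \sum_(p <- splits s) \sum_(q <- splits p.2) F p.1 q.1 q.2.
Proof.
elim: s F => [|x s IH] F; first by rewrite !splits_nil.
rewrite splits_cons [RHS]splits_cons /= splits_nil splits_cons /= -addrA; congr (_ + _).
under eq_bigr do rewrite splits_cons.
by rewrite big_split /= (IH (fun a => F (x :: a))).
Qed.

(** A cut falls either before or after the marked entry [y]. With [y] the value of an inserted
    operation, this separates disjoint from nested pairs of operations. *)
Lemma splits_cat (F : seq T -> seq T -> V) a y b :
  \sum_(p <- splits (a ++ y :: b)) F p.1 p.2 =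
  \sum_(p <- splits a) F p.1 (p.2 ++ y :: b) + \sum_(p <- splits b) F (a ++ y :: p.1) p.2.
Proof.
elim: a F => [|x a IH] F; first by rewrite splits_nil splits_cons.
by rewrite cat_cons !splits_cons /= (IH (fun a => F (x :: a))) addrA.
Qed.

(** The defining sums start at i = 1, whereas two successive cuts also produce an empty middle
    block; hence the assumption on [F]. *)
Lemma splits_triangle (F : seq T -> seq T -> seq T -> V) s :
    (forall a c, F a [::] c = 0) ->
  \sum_(1 <= i < (size s).+1) \sum_(0 <= j < (size s - i).+1)
    F (take j s) (take i (drop j s)) (drop (j + i) s) =
  \sum_(p <- splits s) \sum_(q <- splits p.2) F p.1 q.1 q.2.
Proof.
move=> F0; set n := size s; rewrite [RHS]big_map.
transitivity (\sum_(0 <= i < n.+1) \sum_(0 <= j < n.+1 | (i + j <= n)%N)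
    F (take j s) (take i (drop j s)) (drop (j + i) s)).
  rewrite [RHS]big_ltn // [X in _ = X + _]big1 ?add0r => [|j _]; last by rewrite take0.
  apply: eq_big_nat => i /andP[i1 iN].
  rewrite [LHS](big_nat_widen _ _ n.+1) ?ltnS ?leq_subr //.
  by apply: eq_bigl => j; rewrite ltnS leq_subRL.
rewrite (exchange_big_dep_nat xpredT) //=.
apply: eq_big_nat => j /andP[_ jN].
rewrite big_map size_drop -/n [RHS](big_nat_widen _ _ n.+1) ?ltnS ?leq_subr //.
apply: eq_big => [i|i _]; first by rewrite addnC ltnS leq_subRL.
by rewrite drop_drop addnC.
Qed.

(** In the module sums, i is one more than the length of the suffix handed to m^G, so cuts are
    listed from right to left. Empty suffixes do occur here, as m_1^G acts on G alone. *)
Lemma splits_rev (F : seq T -> seq T -> V) s :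
  \sum_(1 <= i < (size s).+2)
    F (take ((size s).+1 - i) s) (drop ((size s).+1 - i) s) =
  \sum_(p <- splits s) F p.1 p.2.
Proof.
rewrite [RHS]big_map [RHS]big_nat_rev /= big_add1 /=.
by apply: eq_bigr => i _; rewrite add0n subSS.
Qed.

End Splits.
#[local] Arguments splits : simpl never.

Lemma splits_map (T T' : Type) (h : T' -> T) s :
  splits (map h s) = [seq (map h p.1, map h p.2) | p <- splits s].
Proof.
rewrite /splits size_map -map_comp; apply: eq_map => j /=.
by rewrite map_take map_drop.
Qed.

(** * Homogeneous words and Koszul signs *)

Section Homogeneous.
Context (Q : comPzRingType).

Lemma homog_tens (X Y : gmod Q) a b (x : X) (y : Y) :
  homog a x -> homog b y -> homog (X := gtens X Y) (a + b) (tens x y).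
Proof.
move=> hx hy; rewrite /homog -{1}hx -{1}hy.
by rewrite [LHS]gtens_pr_homog eqxx hx hy.
Qed.

Lemma homog_din (X : nat -> gmod Q) n i (v : X i) :
  homog n v -> homog (X := gdsum X) n (din i v).
Proof. by move=> hv; rewrite /homog [LHS]gdsum_din hv. Qed.

Lemma gpr_homog (X : gmod Q) n k (x : X) :
  homog n x -> gpr X k x = if k == n then x else 0.
Proof. by move=> hx; rewrite -{1}hx gpr_gpr hx. Qed.

End Homogeneous.

Section HomogeneousSeq.
Context (Q : comPzRingType) (A : ucplx Q).
Let X := susp A.

(* The degrees of entries start at 2, as those of [susp A] do. *)
Inductive hseq : nat -> seq X -> Prop :=
| hseq_nil : hseq 0 [::]
| hseq_cons n k x s : homog n.+2 x -> hseq k s -> hseq (n.+2 + k) (x :: s).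

Lemma slotlin_cons (W : lmodType Q) (f : seq X -> W) s :
  slotlin f -> linear (fun x => f (x :: s)).
Proof. by move=> hf a x y; apply: (hf [::]). Qed.

Lemma slotlin_tail (W : lmodType Q) (f : seq X -> W) x :
  slotlin f -> slotlin (fun s => f (x :: s)).
Proof. by move=> hf s1 s2; apply: (hf (x :: s1)). Qed.

(** Every entry is a finite sum of homogeneous components, and those of degree 0 and 1 vanish
    because A_+[1] starts in degree 2. Signs and degree arguments can therefore be checked on [hseq]
    alone. *)
Lemma slotlin_homog_ext (W : lmodType Q) (f g : seq X -> W) :
    slotlin f -> slotlin g -> (forall n s, hseq n s -> f s = g s) -> f =1 g.
Proof.
move=> + + + s; elim: s f g => [|x s IH] f g hf hg fg; first by apply: (fg 0); constructor.
have [N ->] := gpr_sum x.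
rewrite -(mklinE (slotlin_cons s hf)) -(mklinE (slotlin_cons s hg)) !linear_sum.
have E k : (k < 2)%N -> gpr X k x = 0 by case: k => [|[|]].
apply: eq_bigr => i _; move: (i : nat) => {}i; case: (ltnP i 2) => [/E ->|i2]; first by rewrite !linear0.
rewrite !mklinE; apply: (IH (fun s => f (_ :: s)) (fun s => g (_ :: s))).
- exact: slotlin_tail.
- exact: slotlin_tail.
move=> n t ht; rewrite -(subnK i2) addn2; apply: (fg ((i - 2).+2 + n)).
by constructor=> //; rewrite /homog gpr_gpr eqxx.
Qed.

Lemma homog_ptens n s : hseq n s -> homog (X := tpow X (size s)) n (ptens s).
Proof. by elim=> // {}n k x {}s hx _ IH; apply: (homog_tens hx IH). Qed.

Lemma homog_brk n s : hseq n s -> homog (X := gbar X) n (brk s).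
Proof. by move/homog_ptens; apply: (homog_din (X := tpow X)). Qed.

(** The degree in A_+[1] exceeds the degree in A by one, so the sign in the bar formula is the
    Koszul sign of the shifted degree. *)
Lemma sgn_homog n x : homog n x -> sgn A x = (-1) ^+ n *: x.
Proof.
move=> hx; apply: dsum_ext => i.
rewrite -{1 2}hx [(gpr _ n x)]/(gtot_pr 2 _ n x) dmapE mklinE.
rewrite -[RHS]/((-1) ^+ n *: (gtot_pr 2 (upos A) n x) i) gtot_prE.
by rewrite addn2; case: eqP => [<-|_] //; rewrite !scaler0.
Qed.

Lemma homog_sgn n x : homog n x -> homog (X := X) n (sgn A x).
Proof. by move=> hx; rewrite (sgn_homog hx) /homog linearZ_LR hx. Qed.

Lemma sgnK x : sgn A (sgn A x) = x.
Proof. by apply: dsum_ext => i; rewrite !dmapE !mklinE scalerA -signr_odd -expr2 sqrr_sign scale1r. Qed.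

Lemma ptens_sgn n s : hseq n s -> ptn (size s) (map (sgn A) s) = (-1) ^+ n *: ptn (size s) s.
Proof.
elim=> [|{}n k x {}s hx _ IH]; first by rewrite scale1r.
rewrite -[LHS]/(tens (sgn A x) (ptn (size s) (map (sgn A) s))) IH (sgn_homog hx).
rewrite -[LHS]/(tensr _ (_ *: _)) linearZ_LR -[tensr _ _]/(tensl (ptn (size s) s) (_ *: x)).
by rewrite linearZ_LR scalerA mulrC -exprD.
Qed.

Context (m : ainf_maps A) (m_deg : forall n, degm1 (m n)).

Lemma homog_mapp n s : hseq n.+1 s -> homog (X := X) n (mapp m s).
Proof.
case: s => [|x s] h; first by rewrite /homog linear0.
exact: (m_deg (size s)).2 (homog_ptens h).
Qed.

Lemma mappE n s : size s = n.+1 -> mapp m s = m n (ptn n.+1 s).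
Proof. by case: s => // x s [<-]; rewrite /mapp ptensE. Qed.

(** [sgn] is (-1) to the degree and every [m n] has odd degree. This anticommutation is the source
    of all sign cancellations in the square of the bar differential. *)
Lemma sgn_mapp s : sgn A (mapp m s) = - mapp m (map (sgn A) s).
Proof.
apply: (slotlin_homog_ext (f := fun s => sgn A (mapp m s))
  (g := fun s => - mapp m (map (sgn A) s))).
- by move=> s1 s2 a x y; rewrite mapp_slotlin linearP.
- move=> s1 s2 a x y; have := slotlin_sgn [::] s1 s2 a x y (mapp_slotlin m).
  by rewrite !cats0 => ->; rewrite opprD scalerN.
move=> _ _ [|n k x {}s hx hs']; first by rewrite linear0 oppr0.
have hxs : hseq (n.+2 + k) (x :: s) by constructor.
rewrite (sgn_homog (homog_mapp hxs)).
rewrite !(@mappE (size s)) ?size_map // -[(size s).+1]/(size (x :: s)) (ptens_sgn hxs).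
by rewrite linearZ_LR -scaleNr addSn [in RHS]exprS mulN1r opprK.
Qed.

End HomogeneousSeq.

(** * The curvature of the bar differential *)

Lemma totdiff_din (K : pzRingType) (C : nat -> lmodType K) d n x :
  @totdiff K C d (din n.+1 x) = din n (d n x).
Proof. exact: dlift_din. Qed.

Lemma totdiffE (K : pzRingType) (C : nat -> lmodType K) d x n :
  @totdiff K C d x n = d n (x n.+1).
Proof.
have E : dcomp n \o totdiff d =1 d n \o dcomp n.+1.
  apply: dsum_lin_ext => i v; rewrite -[LHS]/(totdiff d (din i v) n).
  rewrite -[RHS]/(d n (din i v n.+1)); case: i v => [|i] v.
    rewrite (_ : totdiff d (din 0%N v) = 0); last exact: dlift_din.
    by rewrite din_out // linear0.
  rewrite totdiff_din; have [E|ne] := eqVneq i n; first by case: n / E; rewrite !din_in.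
  by rewrite !din_out // linear0.
exact: E.
Qed.

Section BarCurvature.
Context (Q : comPzRingType) (A : ucplx Q) (G : cplx Q).
Let X := susp A.
Let V := barG A G.

Definition bel (s : seq X) (g : gmodule G) : V := tens (brk s) g.

Lemma bel_slotlin g : slotlin (bel^~ g).
Proof.
by move=> s1 s2 a x x'; rewrite /bel brk_slotlin (tens_bilin (gbar X) (gmodule G)).2.
Qed.

Lemma bel_linear s : linear (bel s).
Proof. exact: (tens_bilin (gbar X) (gmodule G)).1. Qed.

Lemma bel_ext (W : lmodType Q) (f h : {linear V -> W}) :
  (forall s g, f (bel s g) = h (bel s g)) -> f =1 h.
Proof.
move=> fh; apply: (tens_ext (M := gbar X) (N := gmodule G)) => b g.
have E : f \o tensl g =1 h \o tensl g.
  apply: (dsum_lin_ext (V := tpow X)) => n t.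
  have E' : f \o tensl g \o din n =1 h \o tensl g \o din n.
    apply: tpow_ext => s sn; move: (fh s g); rewrite /bel (brkE sn).
    by [].
  exact: E'.
exact: E.
Qed.

Lemma slotlin_mid (W : lmodType Q) (f : seq X -> W) a c :
  slotlin f -> linear (fun y => f (a ++ y :: c)).
Proof. by move=> hf b y y'; apply: hf. Qed.

Lemma slotlin0 (W : lmodType Q) (f : seq X -> W) a c : slotlin f -> f (a ++ 0 :: c) = 0.
Proof. by move=> hf; apply: (linear0 (mklin (slotlin_mid a c hf))). Qed.

Lemma bel0 a c g : bel (a ++ 0 :: c) g = 0.
Proof. exact: (slotlin0 a c (bel_slotlin g)). Qed.

Lemma belN a y c g : bel (a ++ (- y) :: c) g = - bel (a ++ y :: c) g.
Proof. exact: (linearN (mklin (slotlin_mid a c (bel_slotlin g)))). Qed.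

Lemma belD s g g' : bel s (g + g') = bel s g + bel s g'.
Proof. exact: (linearD (mklin (bel_linear s))). Qed.

Lemma belZ s a g : bel s (a *: g) = a *: bel s g.
Proof. exact: (linearZ_LR (mklin (bel_linear s))). Qed.

Lemma bel_sum (I : Type) (r : seq I) (F : I -> gmodule G) s :
  bel s (\sum_(i <- r) F i) = \sum_(i <- r) bel s (F i).
Proof. exact: (linear_sum (mklin (bel_linear s))). Qed.

Lemma bel_suml (I : Type) (r : seq I) (F : I -> X) c g :
  bel ((\sum_(i <- r) F i) :: c) g = \sum_(i <- r) bel (F i :: c) g.
Proof. exact: (linear_sum (mklin (slotlin_mid [::] c (bel_slotlin g)))). Qed.

Lemma bcons_ex (x : X) : exists L : {linear V -> V}, forall s g, L (bel s g) = bel (x :: s) g.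
Proof.
apply: (bar_lift_ex (D := fun s g => bel (x :: s) g)) => [g|s].
  exact: (slotlin_tail x (bel_slotlin g)).
exact: bel_linear.
Qed.

Definition bcons x : {linear V -> V} := projT1 (cid (bcons_ex x)).

Lemma bconsE x s g : bcons x (bel s g) = bel (x :: s) g.
Proof. by rewrite /bcons; case: cid. Qed.

Context (m : ainf_maps A) (mG : amod_maps A G).
Let D := bar_diffQ m mG.

(* The terms of [D] that involve the first bar entry (all of them if [s = [::]]);
   the empty prefix contributes nothing since [mapp m [::] = 0]. *)
Definition bhead (s : seq X) g : V :=
  \sum_(p <- splits s) bel (mapp m p.1 :: p.2) g + bel [::] (gapp mG s g).

(** The coderivation of the tensor coalgebra determined by [m], followed by [F]. Empty middle blocks
    are included; they contribute 0 when [F] is linear in each slot, since [mapp m [::]] is 0. *)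
Definition inserts (W : zmodType) (F : seq X -> W) (s : seq X) : W :=
  \sum_(p <- splits s) \sum_(q <- splits p.2) F (map (sgn A) p.1 ++ mapp m q.1 :: q.2).

Lemma insertsE (W : lmodType Q) (F : seq X -> W) s : slotlin F ->
  \sum_(1 <= i < (size s).+1) \sum_(0 <= j < (size s - i).+1) F (minsert m i j s) =
  inserts F s.
Proof.
move=> hF.
apply: (splits_triangle (F := fun a b c => F (map (sgn A) a ++ mapp m b :: c))) => a c.
exact: slotlin0.
Qed.

Lemma bar_formulaE s g :
  D (bel s g) = inserts (bel^~ g) s +
    \sum_(p <- splits s) bel (map (sgn A) p.1) (gapp mG p.2 g).
Proof.
rewrite [LHS]bar_diffQE; congr (_ + _); first exact: (insertsE s (bel_slotlin g)).
exact: (splits_rev (fun a b => bel (map (sgn A) a) (gapp mG b g))).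
Qed.

(** A term of the differential either leaves the first entry in place up to its Koszul sign, and
    then comes from the shorter word, or absorbs it. This recursion drives the inductions on words
    below. *)
Lemma bar_diff_cons x s g :
  D (bel (x :: s) g) = bcons (sgn A x) (D (bel s g)) + bhead (x :: s) g.
Proof.
rewrite !bar_formulaE /inserts splits_cons.
have -> : \sum_(p <- splits (x :: s)) bel (map (sgn A) p.1) (gapp mG p.2 g) =
    bel [::] (gapp mG (x :: s) g) +
    bcons (sgn A x) (\sum_(p <- splits s) bel (map (sgn A) p.1) (gapp mG p.2 g)).
  by rewrite splits_cons linear_sum; under [in RHS]eq_bigr do rewrite bconsE.
rewrite linearD [in RHS]linear_sum /= addrACA addrC; congr (_ + _ + _).
by apply: eq_bigr => p _; rewrite linear_sum; apply: eq_bigr => q _; rewrite bconsE.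
Qed.

Lemma bar_diff_nil g : D (bel [::] g) = bel [::] (gapp mG [::] g).
Proof.
by rewrite bar_formulaE /inserts !splits_nil (bel0 [::]) add0r.
Qed.

Lemma bhead_nil g : bhead [::] g = bel [::] (gapp mG [::] g).
Proof. by rewrite /bhead splits_nil (bel0 [::]) add0r. Qed.

(** The graded commutator of [D] with prepending [x]. Defining it this way gives linearity on all of
    [V] for free, while [bhead] is only available on words. *)
Definition bhead_op x : {linear V -> V} :=
  mklin (lincomb_linear (-1) (bcons (sgn A x) \o D) (D \o bcons x)).

Lemma bhead_opE x s g : bhead_op x (bel s g) = bhead (x :: s) g.
Proof.
rewrite -[LHS]/(-1 *: bcons (sgn A x) (D (bel s g)) + D (bcons x (bel s g))).
by rewrite bconsE bar_diff_cons scaleN1r addKr.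
Qed.

Lemma bar_diff_bcons x v : D (bcons x v) = bcons (sgn A x) (D v) + bhead_op x v.
Proof.
rewrite -[bhead_op x v]/(-1 *: bcons (sgn A x) (D v) + D (bcons x v)).
by rewrite scaleN1r addNKr.
Qed.

Definition alg_rel (s : seq X) : X := inserts (mapp m) s.
Definition mod_rel (s : seq X) g : gmodule G :=
  inserts (gapp mG ^~ g) s + \sum_(p <- splits s) gapp mG (map (sgn A) p.1) (gapp mG p.2 g).

Context (m_deg : forall n, degm1 (m n)).

(* Insertions into disjoint blocks cancel because [sgn] anticommutes with [mapp m];
   nested ones are grouped into the A_infinity relations. *)
Lemma bar_curvature_rel s g :
  inserts (bhead ^~ g) s + \sum_(p <- splits s) bhead (map (sgn A) p.1) (gapp mG p.2 g)
  + \sum_(p <- splits s) bcons (sgn A (mapp m p.1)) (D (bel p.2 g)) =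
  \sum_(p <- splits s) bel (alg_rel p.1 :: p.2) g + bel [::] (mod_rel s g).
Proof.
have hd (f : seq X -> seq X -> V) a :
    \sum_(q <- splits (map (sgn A) a)) f q.1 q.2 =
    \sum_(q <- splits a) f (map (sgn A) q.1) (map (sgn A) q.2).
  by rewrite splits_map big_map.
have -> : inserts (bhead ^~ g) s =
    \sum_(p <- splits s) \sum_(q <- splits p.2) \sum_(d <- splits p.1)
      bel (mapp m (map (sgn A) d.1) :: map (sgn A) d.2 ++ mapp m q.1 :: q.2) g
    + (\sum_(p <- splits s) \sum_(q <- splits p.2) \sum_(d <- splits q.2)
        bel (mapp m (map (sgn A) p.1 ++ mapp m q.1 :: d.1) :: d.2) g
      + bel [::] (inserts (gapp mG ^~ g) s)).
  rewrite [in X in _ = _ + (_ + X)]/inserts bel_sum -!big_split; apply: eq_bigr => p _ /=.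
  rewrite bel_sum -!big_split; apply: eq_bigr => q _ /=; rewrite addrA; congr (_ + _).
  rewrite (splits_cat (fun a b => bel (mapp m a :: b) g)); congr (_ + _).
  exact: (hd (fun a b => bel (mapp m a :: b ++ mapp m q.1 :: q.2) g)).
have -> : \sum_(p <- splits s) bhead (map (sgn A) p.1) (gapp mG p.2 g) =
    \sum_(p <- splits s) \sum_(d <- splits p.1)
      bel (mapp m (map (sgn A) d.1) :: map (sgn A) d.2) (gapp mG p.2 g)
    + bel [::] (\sum_(p <- splits s) gapp mG (map (sgn A) p.1) (gapp mG p.2 g)).
  rewrite bel_sum -big_split; apply: eq_bigr => p _ /=; congr (_ + _).
  exact: (hd (fun a b => bel (mapp m a :: b) (gapp mG p.2 g))).
(* The pairs of disjoint operations once more, now with the left one applied first: [sgn_mapp] gives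
   them the opposite sign and coassociativity matches the indexing. *)
have -> : \sum_(p <- splits s) bcons (sgn A (mapp m p.1)) (D (bel p.2 g)) =
    - (\sum_(p <- splits s) \sum_(q <- splits p.2) \sum_(d <- splits p.1)
      bel (mapp m (map (sgn A) d.1) :: map (sgn A) d.2 ++ mapp m q.1 :: q.2) g)
    - \sum_(p <- splits s) \sum_(d <- splits p.1)
      bel (mapp m (map (sgn A) d.1) :: map (sgn A) d.2) (gapp mG p.2 g).
  rewrite -opprD.
  under [in RHS]eq_bigr do rewrite exchange_big.
  rewrite (splits_coassoc (fun a b c => \sum_(q <- splits c)
    bel (mapp m (map (sgn A) a) :: map (sgn A) b ++ mapp m q.1 :: q.2) g)).
  rewrite (splits_coassoc (fun a b c =>
    bel (mapp m (map (sgn A) a) :: map (sgn A) b) (gapp mG c g))).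
  rewrite -big_split -sumrN; apply: eq_bigr => p _; cbv beta.
  rewrite bar_formulaE linearD !linear_sum sgn_mapp // opprD -!sumrN.
  congr (_ + _); apply: eq_bigr => q _; last by rewrite bconsE (belN [::]).
  rewrite linear_sum -sumrN; apply: eq_bigr => r _.
  by rewrite bconsE (belN [::]).
have -> : \sum_(p <- splits s) bel (alg_rel p.1 :: p.2) g =
    \sum_(p <- splits s) \sum_(q <- splits p.2) \sum_(d <- splits q.2)
        bel (mapp m (map (sgn A) p.1 ++ mapp m q.1 :: d.1) :: d.2) g.
  under [in RHS]eq_bigr => p _ do rewrite -(splits_coassoc (fun b c d =>
    bel (mapp m (map (sgn A) p.1 ++ mapp m b :: c) :: d) g)).
  rewrite -(splits_coassoc (fun a b d => \sum_(q <- splits b)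
    bel (mapp m (map (sgn A) a ++ mapp m q.1 :: q.2) :: d) g)).
  apply: eq_bigr => p _; rewrite bel_suml; apply: eq_bigr => q _.
  exact: bel_suml.
rewrite /mod_rel belD.
set a1 := \sum_(p <- _) _; set a2 := \sum_(p <- _) _; set a3 := bel _ _.
set a4 := \sum_(p <- _) _; set a5 := bel _ _.
by rewrite -opprD [_ + (a4 + a5)]addrACA [LHS]addrAC subrr add0r addrA.
Qed.

Context (m_ainf : ainf_algebra m) (mG_ainf : ainf_module m mG).
Context (A_cplx : is_complex A) (G_cplx : is_complex G).

Lemma susp_diffK (x : X) : susp_diff (susp_diff x) = 0.
Proof.
rewrite /susp_diff linearN opprK; apply: dsum_ext => n; rewrite !totdiffE.
exact: (A_cplx (n := n.+1) (x n.+2)).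
Qed.

(** For one entry the relation is d d = 0 and comes from A being a complex; for two entries it is
    the failure of d_1 to vanish; all longer ones are zero by assumption. *)
Lemma alg_relE s : alg_rel s =
  match s with
  | [:: x; y] => susp_d1 x *: y - susp_d1 y *: x
  | _ => 0
  end.
Proof.
have [_ m1 m2 mn] := m_ainf; have sl := mapp_slotlin m.
have m0 a c : mapp m (a ++ 0 :: c) = 0 by apply: slotlin0.
case: s => [|x [|y [|z s]]].
- by rewrite /alg_rel /inserts !splits_nil (m0 [::] [::]).
- rewrite /alg_rel /inserts !(splits_cons, splits_nil).
  rewrite -[LHS]/(mapp m ([::] ++ 0 :: [:: x]) + mapp m [:: mapp m [:: x]] +
    mapp m ([:: sgn A x] ++ 0 :: [::])).
  by rewrite !m0 add0r addr0 !m1 susp_diffK.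
- by rewrite /alg_rel -insertsE // -m2 unlock /= !addr0 addrC.
by rewrite /alg_rel -insertsE // mn.
Qed.

Lemma mod_relE s g : mod_rel s g = if s is [:: x] then susp_d1 x *: g else 0.
Proof.
have [_ g1 g2 gn] := mG_ainf; have sl h := gapp_slotlin mG h.
have m0 a c h : gapp mG (a ++ 0 :: c) h = 0 by apply: (slotlin0 a c (sl h)).
case: s => [|x [|y s]].
- rewrite /mod_rel /inserts !splits_nil -[LHS]/(gapp mG ([::] ++ 0 :: [::]) g +
    gapp mG [::] (gapp mG [::] g)) m0 add0r !g1.
  by apply: dsum_ext => n; rewrite !totdiffE; apply: G_cplx.
- rewrite -g2 /mod_rel -insertsE //.
  rewrite -(splits_rev (fun a b => gapp mG (map (sgn A) a) (gapp mG b g))).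
  by rewrite unlock /= !addr0 addrA addrC.
rewrite /mod_rel -insertsE //.
by rewrite -(splits_rev (fun a b => gapp mG (map (sgn A) a) (gapp mG b g))) gn.
Qed.

Lemma splits_bel_alg_rel s g :
  \sum_(p <- splits s) bel (alg_rel p.1 :: p.2) g =
  if s is x :: y :: s' then bel ((susp_d1 x *: y - susp_d1 y *: x) :: s') g else 0.
Proof.
have z c : bel (0 :: c) g = 0 by apply: (bel0 [::]).
case: s => [|x [|y s]]; rewrite !(splits_cons, splits_nil) !alg_relE.
- exact: z.
- by rewrite !z addr0.
rewrite !z !add0r; case: s => [|w s]; first by rewrite splits_nil alg_relE.
rewrite splits_cons alg_relE /= big1 ?addr0 // => p _.
by rewrite alg_relE z.
Qed.

(** The relation on the first two entries contributes d_1(x) y - d_1(y) x, and its second half is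
    cancelled by the induction hypothesis for the tail, so that only the curvature of the first
    entry survives. When the word has a single entry, the module relation supplies this term
    instead. *)
Lemma bar_diff2 s g :
  D (D (bel s g)) = if s is x :: s' then susp_d1 x *: bel s' g else 0.
Proof.
elim: s => [|x s IH].
  rewrite !bar_diff_nil; have := mod_relE [::] g; rewrite /mod_rel /inserts !splits_nil.
  rewrite -[X in X + _ = _]/(gapp mG ([::] ++ 0 :: [::]) g) (slotlin0 _ _ (gapp_slotlin mG g)).
  by rewrite add0r => ->; apply: (linear0 (mklin (bel_linear [::]))).
rewrite bar_diff_cons linearD bar_diff_bcons sgnK.
have := bar_curvature_rel (x :: s) g.
rewrite splits_bel_alg_rel mod_relE.
(* Among these terms, those that keep [x] in place (with its sign) assemble into
   [bhead_op (sgn A x)] applied to [D (bel s g)]. *)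
have -> : inserts (bhead ^~ g) (x :: s) +
    \sum_(p <- splits (x :: s)) bhead (map (sgn A) p.1) (gapp mG p.2 g) =
    \sum_(p <- splits (x :: s)) bhead (mapp m p.1 :: p.2) g +
    bhead [::] (gapp mG (x :: s) g) + bhead_op (sgn A x) (D (bel s g)).
  rewrite /inserts !splits_cons addrACA bar_formulaE linearD; congr (_ + (_ + _)).
    rewrite linear_sum; apply: eq_bigr => p _; rewrite linear_sum.
    by apply: eq_bigr => q _; rewrite bhead_opE.
  by rewrite linear_sum; apply: eq_bigr => p _; rewrite bhead_opE.
have -> : D (bhead (x :: s) g) =
    \sum_(p <- splits (x :: s)) bhead (mapp m p.1 :: p.2) g +
    \sum_(p <- splits (x :: s)) bcons (sgn A (mapp m p.1)) (D (bel p.2 g)) +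
    bhead [::] (gapp mG (x :: s) g).
  rewrite {1}/bhead linearD linear_sum bar_diff_nil bhead_nil -big_split.
  by congr (_ + _); apply: eq_bigr => p _; rewrite bar_diff_cons addrC.
set H := \sum_(p <- _) bhead _ g; set B := bhead [::] _; set O := bhead_op _ _.
set C := \sum_(p <- _) _ => E.
rewrite IH -addrA [O + _]addrC (addrAC H) [_ + C + O]addrAC E.
move: s {E IH H B O C} => [|y s].
  by rewrite linear0 !add0r belZ.
rewrite -[bel [::] 0]/(mklin (bel_linear [::]) 0) linear0 addr0 linearZ_LR bconsE.
have hl := slotlin_mid [::] s (bel_slotlin g).
rewrite -[bel (_ - _ :: s) g]/(mklin hl _) linearB 2!(linearZ_LR (mklin hl)) /=.
by rewrite addrC subrK.
Qed.

End BarCurvature.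
Arguments bcons {Q A G} x.

(** * Degrees *)

Section HomogeneousMore.
Context (K : pzRingType).

Lemma homogD (X : gmod K) n (x y : X) : homog n x -> homog n y -> homog n (x + y).
Proof. by move=> hx hy; rewrite /homog linearD hx hy. Qed.

Lemma homog0 (X : gmod K) n : homog n (0 : X).
Proof. exact: linear0. Qed.

Lemma homog_sum (X : gmod K) n (I : eqType) (r : seq I) (F : I -> X) :
  (forall i, i \in r -> homog n (F i)) -> homog n (\sum_(i <- r) F i).
Proof. by move=> h; rewrite /homog linear_sum; apply: eq_big_seq. Qed.

Lemma exhaust_trunc (V : lmodType K) (pr : nat -> {linear V -> V}) n x :
  exhaust pr x -> (forall q, (n <= q)%N -> pr q x = 0) -> x = \sum_(i < n) pr i x.
Proof.
case=> N h h0; rewrite {1}(h (maxn N n) (leq_maxl _ _)).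
rewrite -!(big_mkord xpredT (fun i => pr i x)) (@big_cat_nat _ _ _ n) ?leq_maxr //=.
by rewrite [X in _ + X]big_nat_cond [X in _ + X]big1 ?addr0 // => i /andP[/andP[/h0]].
Qed.

Lemma gpr_ext (W : lmodType K) (X : gmod K) (f h : {linear X -> W}) :
  (forall n x, homog n x -> f x = h x) -> f =1 h.
Proof.
move=> fh x; have [N ->] := gpr_sum x; rewrite !linear_sum; apply: eq_bigr => i _.
by apply: (fh i); rewrite /homog gpr_gpr eqxx.
Qed.

End HomogeneousMore.

Lemma mem_splits (T : eqType) (p : seq T * seq T) s : p \in splits s -> p.1 ++ p.2 = s.
Proof. by case/mapP=> j _ ->; apply: cat_take_drop. Qed.

Section BarGrading.
Context (Q : comPzRingType) (A : ucplx Q) (G : cplx Q).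
Let X := susp A.
Let V := barG A G.

Lemma hseq_cat n (s t : seq X) : hseq n (s ++ t) ->
  exists a b, [/\ n = (a + b)%N, hseq a s & hseq b t].
Proof.
elim: s n => [|x s IH] n /=; first by move=> h; exists 0%N, n; split=> //; constructor.
move=> h; inversion h as [|n' k x' s' hx hs E1 E2].
case: (IH _ hs) => a [b [-> ha hb]]; exists (n'.+2 + a)%N, b; split=> //.
  by rewrite addnA.
by constructor.
Qed.

Lemma hseq_gt1 n x (s : seq X) : hseq n (x :: s) -> (1 < n)%N.
Proof. by move=> h; inversion h. Qed.

(** The first entry may have any degree [a], so that a value of [mapp m] can be put there without
    exhibiting it as an entry of an [hseq]. *)
Lemma homog_bel a b k x s g : homog a x -> hseq b s -> homog (X := gmodule G) k g ->
  homog (X := V) (a + b + k) (bel (x :: s) g).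
Proof.
move=> hx hs hg; apply: (homog_tens (X := gbar X)) hg.
apply: (homog_din (X := tpow X) (i := (size s).+1)).
exact: (homog_tens (Y := tpow X (size s)) hx (homog_ptens hs)).
Qed.

Lemma homog_hbel n k s g : hseq n s -> homog (X := gmodule G) k g ->
  homog (X := V) (n + k) (bel s g).
Proof. by move=> hs hg; apply: (homog_tens (homog_brk hs) hg). Qed.

Lemma bel_homog_ext (W : lmodType Q) (f h : {linear V -> W}) :
    (forall n k s g, hseq n s -> homog (X := gmodule G) k g -> f (bel s g) = h (bel s g)) ->
  f =1 h.
Proof.
move=> fh; apply: bel_ext => s g.
apply: (gpr_ext (X := gmodule G) (f := f \o mklin (bel_linear s))
  (h := h \o mklin (bel_linear s))) => k {}g hg.
apply: (slotlin_homog_ext (f := fun s => f (bel s g)) (g := fun s => h (bel s g))).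
- by move=> *; rewrite bel_slotlin linearP.
- by move=> *; rewrite bel_slotlin linearP.
by move=> n {}s hs; apply: fh hs hg.
Qed.

Lemma gpr_bcons a x q v : homog a x -> gpr V (a + q) (bcons x v) = bcons x (gpr V q v).
Proof.
move=> hx; apply: (bel_homog_ext (f := gpr V (a + q) \o bcons x) (h := bcons x \o gpr V q)).
move=> n k s g hs hg; rewrite -[LHS]/(gpr V (a + q) (bcons x (bel s g))) bconsE.
rewrite -[RHS]/(bcons x (gpr V q (bel s g))) (gpr_homog _ (homog_bel hx hs hg)).
rewrite (gpr_homog _ (homog_hbel hs hg)) -addnA eqn_add2l.
by case: eqP => _; rewrite ?linear0 ?bconsE.
Qed.

Context (m : ainf_maps A) (mG : amod_maps A G).
Context (m_deg : forall n, degm1 (m n)) (mG_deg : forall n, degm1 (mG n)).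
Let D := bar_diffQ m mG.

Lemma homog_gapp n k N s g : hseq n s -> homog k g -> (n + k)%N = N.+1 ->
  homog N (gapp mG s g).
Proof.
move=> hs hg E; apply: (mG_deg (size s)).2; rewrite -E.
exact: homog_tens (homog_ptens hs) hg.
Qed.

Lemma homog_bhead n k N s g : hseq n s -> homog k g -> (n + k)%N = N.+1 ->
  homog (X := V) N (bhead m mG s g).
Proof.
move=> hs hg E; apply: homogD; last first.
  by rewrite -[N]add0n; apply: homog_hbel (homog_gapp hs hg E); constructor.
apply: homog_sum => p /mem_splits sp; rewrite -sp in hs.
case: (hseq_cat hs) => a [b [nE ha hb]]; case: (p.1) ha => [|x s'] ha.
  by rewrite (bel0 [::]); apply: homog0.
case: a nE ha (hseq_gt1 ha) => // a nE ha _.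
have -> : N = (a + b + k)%N by apply: succn_inj; rewrite -E nE -addSn.
exact: homog_bel (homog_mapp m_deg ha) hb hg.
Qed.

(** Degrees are natural numbers, so the case of total degree 0, where the value must vanish, is
    stated apart. It occurs only for the empty word, as entries have degree at least 2. *)
Lemma bar_diff_homog n k s g : hseq n s -> homog k g ->
  (n + k = 0)%N /\ D (bel s g) = 0 \/
  exists2 N, (n + k)%N = N.+1 & homog (X := V) N (D (bel s g)).
Proof.
move=> hs hg; elim: hs => [|{}n l x {}s hx hs IH].
  rewrite /D bar_diff_nil; case: k hg => [|k] hg; last first.
    by right; exists k => //; rewrite -(bhead_nil m); apply: (homog_bhead (n := 0) _ hg) => //; constructor.
  left; split=> //; rewrite [gapp _ _ _](mG_deg 0).1 ?belZ //.
    exact: (linear0 (mklin (bel_linear [::]))).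
  apply: (homog_tens (X := tpow X 0) (a := 0) (b := 0) _ hg).
  by apply: (homog_ptens (s := [::])); constructor.
right; exists (n.+1 + l + k)%N => //.
have hxs : hseq (n.+2 + l) (x :: s) by constructor.
rewrite /D bar_diff_cons; apply: homogD; last exact: homog_bhead hxs hg _.
case: IH => [[_ ->]|[N E hN]]; first by rewrite linear0; apply: homog0.
have -> : (n.+1 + l + k)%N = (n.+2 + N)%N by rewrite -addnA E addnS.
by rewrite /homog gpr_bcons ?hN //; apply: homog_sgn.
Qed.

Lemma gpr_bar_diff n v : gpr V n (D v) = D (gpr V n.+1 v).
Proof.
apply: (bel_homog_ext (f := gpr V n \o D) (h := D \o gpr V n.+1)) => a k s g hs hg.
rewrite -[LHS]/(gpr V n (D (bel s g))) -[RHS]/(D (gpr V n.+1 (bel s g))).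
rewrite (gpr_homog _ (homog_hbel hs hg)).
case: (bar_diff_homog hs hg) => [[-> ->]|[N -> /gpr_homog->]]; first by rewrite !linear0.
by rewrite eqSS; case: eqP => _; rewrite ?linear0.
Qed.

Lemma bar_diff_gpr0 v : D (gpr V 0 v) = 0.
Proof.
apply: (bel_homog_ext (f := D \o gpr V 0) (h := \0)) => a k s g hs hg.
rewrite -[LHS]/(D (gpr V 0 (bel s g))) (gpr_homog _ (homog_hbel hs hg)).
case: (bar_diff_homog hs hg) => [[-> ->]|[N -> _]] //.
by rewrite linear0.
Qed.

Context (R : comPzRingType) (phi : {rmorphism Q -> R}).

Lemma gpr_bar_diffR n z :
  gpr (bar A G phi) n (bar_diff m mG phi z) = bar_diff m mG phi (gpr (bar A G phi) n.+1 z).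
Proof.
apply: (btens_ext (f := gpr (bar A G phi) n \o bar_diff m mG phi)
  (g := bar_diff m mG phi \o gpr (bar A G phi) n.+1)) => v.
transitivity (btens phi 1 (gpr V n (D v))).
  rewrite -[LHS]/(bcmap phi _ (bcmap phi D (btens phi 1 v))) bcmapE.
  by rewrite [LHS]bcmapE.
rewrite gpr_bar_diff -[RHS]/(bcmap phi D (bcmap phi (gpr V n.+1) (btens phi 1 v))).
by rewrite !bcmapE.
Qed.

Lemma bar_degm1 : degm1 (bar_diff m mG phi).
Proof.
split=> [z hz|n z hz]; last by rewrite /homog gpr_bar_diffR hz.
rewrite -hz; apply: (btens_ext (f := bar_diff m mG phi \o gpr (bar A G phi) 0) (g := \0)) => v.
rewrite -[LHS]/(bcmap phi D (bcmap phi (gpr V 0) (btens phi 1 v))) !bcmapE bar_diff_gpr0.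
exact: (linear0 (tensr (1 : restr phi R^o))).
Qed.

End BarGrading.

(** * Acyclicity *)

Section BarAcyclic.
Context (Q : comPzRingType) (A : ucplx Q) (G : cplx Q).
Let X := susp A.
Let V := barG A G.
Let XV : lmodType Q := tensor X V.

Lemma bcons_bilin : bilin (fun (x : X) (v : V) => bcons x v : V).
Proof.
split=> [x|v a x y]; first by move=> a u v; rewrite linearP.
apply: (bel_ext (f := bcons (a *: x + y)) (h := mklin (lincomb_linear a (bcons x) (bcons y)))).
by move=> s g; rewrite mklinE !bconsE (bel_slotlin g [::]).
Qed.

Definition bjoin : {linear XV -> V} := tlift bcons_bilin.

Lemma bjoinE x v : bjoin (tens x v) = bcons x v.
Proof. exact: tliftE. Qed.

Lemma buncons_ex : exists L : {linear V -> XV},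
  forall s g, L (bel s g) = if s is x :: s' then tens x (bel s' g) else 0.
Proof.
apply: (bar_lift_ex (D := fun s g => if s is x :: s' then tens x (bel s' g) else 0 : XV)).
  move=> g [|y s1] s2 a x x' /=; first exact: (tens_bilin X V).2.
  by rewrite bel_slotlin (tens_bilin X V).1.
case=> [|x s] a g g'; first by rewrite scaler0 addr0.
by rewrite bel_linear (tens_bilin X V).1.
Qed.

Definition buncons : {linear V -> XV} := projT1 (cid buncons_ex).

Lemma bunconsE s g :
  buncons (bel s g) = if s is x :: s' then tens x (bel s' g) else 0.
Proof. by rewrite /buncons; case: cid. Qed.

Lemma bjoinK t : buncons (bjoin t) = t.
Proof.
apply: (tens_ext (M := X) (N := V) (f := buncons \o bjoin) (g := idfun)) => x v.
apply: (bel_ext (f := buncons \o bjoin \o tensr x) (h := tensr x)) => s g.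
rewrite -[LHS]/(buncons (bjoin (tens x (bel s g)))) bjoinE bconsE.
exact: bunconsE.
Qed.

Lemma bbot_ex : exists L : {linear V -> gmodule G},
  forall s g, L (bel s g) = if s is [::] then g else 0.
Proof.
apply: (bar_lift_ex (D := fun (s : seq X) g => if s is [::] then g else 0 : gmodule G)).
  by move=> g [|y s1] s2 a x x'; rewrite scaler0 addr0.
by case=> [|x s] a g g' //; rewrite scaler0 addr0.
Qed.

Definition bbot : {linear V -> gmodule G} := projT1 (cid bbot_ex).

Lemma bbotE s g : bbot (bel s g) = if s is [::] then g else 0.
Proof. by rewrite /bbot; case: cid. Qed.

Lemma bel_nil_linear : linear (fun g => bel [::] g : V).
Proof. exact: bel_linear. Qed.
Definition bunit : {linear gmodule G -> V} := mklin bel_nil_linear.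

Lemma bunconsK v : bjoin (buncons v) + bunit (bbot v) = v.
Proof.
have l := lincomb_linear 1 (bjoin \o buncons) (bunit \o bbot).
transitivity (mklin l v); first by rewrite mklinE scale1r.
apply: (bel_ext (h := idfun)) => s g; rewrite mklinE scale1r.
rewrite -[LHS]/(bjoin (buncons (bel s g)) + bel [::] (bbot (bel s g))).
rewrite bunconsE bbotE; case: s => [|x s]; first by rewrite linear0 add0r.
by rewrite bjoinE bconsE -[bel [::] 0]/(bunit 0) linear0 addr0.
Qed.

Lemma bcurv_bilin : bilin (fun (x : X) (v : V) => susp_d1 x *: v).
Proof.
split=> [x a u v|v a x y]; first by rewrite scalerDr !scalerA mulrC.
by rewrite /susp_d1 -[(a *: x + y) 0%N]/(a *: x 0%N + y 0%N) linearP scalerDl scalerA.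
Qed.

(** The map d_1 (x) 1 under Q (x) V = V. Its image is I V once A resolves R, so elements of I V are
    handled below through preimages under [bcurv]. *)
Definition bcurv : {linear XV -> V} := tlift bcurv_bilin.

Lemma bcurvE x v : bcurv (tens x v) = susp_d1 x *: v.
Proof. exact: tliftE. Qed.

Definition gprr q : {linear XV -> XV} := tmap idfun (gpr V q).

Lemma gprrE q x v : gprr q (tens x v) = tens x (gpr V q v).
Proof. exact: tmapE. Qed.

Lemma gprr_exhaust t : exhaust gprr t.
Proof.
case: (tens_elt t) => l ->; apply: exhaust_sum => -[x v] /=.
case: (gpr_exhaust v) => N h; exists N => N' /h {1}->.
rewrite -[LHS]/(tensr x _) linear_sum; apply: eq_bigr => i _.
by rewrite gprrE.
Qed.

Lemma gprr_gprr i j t : gprr i (gprr j t) = if i == j then gprr j t else 0.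
Proof.
case: (tens_elt t) => l ->; rewrite (linear_sum (gprr j)) (linear_sum (gprr i)).
transitivity (\sum_(p <- l) if i == j then gprr j (tens p.1 p.2) else 0).
  by apply: eq_bigr => p _; rewrite !gprrE gpr_gpr; case: ifP => // _; rewrite tensor0r.
by case: ifP => // _; rewrite big1.
Qed.

Lemma bcurv_gpr q t : gpr V q (bcurv t) = bcurv (gprr q t).
Proof.
apply: (tens_ext (M := X) (N := V) (f := gpr V q \o bcurv) (g := bcurv \o gprr q)) => x v.
rewrite -[LHS]/(gpr V q (bcurv (tens x v))) -[RHS]/(bcurv (gprr q (tens x v))).
by rewrite gprrE !bcurvE linearZ_LR.
Qed.

Definition sdiff : {linear XV -> XV} := tmap (totdiff (udiff A)) idfun.

Lemma sdiffE x v : sdiff (tens x v) = tens (totdiff (udiff A) x) v.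
Proof. exact: tmapE. Qed.

Lemma sdiff_gprr q t : sdiff (gprr q t) = gprr q (sdiff t).
Proof.
apply: (tens_ext (M := X) (N := V) (f := sdiff \o gprr q) (g := gprr q \o sdiff)) => x v.
rewrite -[LHS]/(sdiff (gprr q (tens x v))) -[RHS]/(gprr q (sdiff (tens x v))).
by rewrite sdiffE !gprrE sdiffE.
Qed.

Context (m : ainf_maps A) (mG : amod_maps A G).
Context (m_ainf : ainf_algebra m) (mG_ainf : ainf_module m mG).
Context (A_cplx : is_complex A) (G_cplx : is_complex G).
Let D := bar_diffQ m mG.
Let m_deg : forall n, degm1 (m n). Proof. by case: m_ainf. Qed.
Let mG_deg : forall n, degm1 (mG n). Proof. by case: mG_ainf. Qed.

Lemma bar_diffK v : D (D v) = bcurv (buncons v).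
Proof.
apply: (bel_ext (f := D \o D) (h := bcurv \o buncons)) => s g.
rewrite -[LHS]/(D (D (bel s g))) -[RHS]/(bcurv (buncons (bel s g))).
rewrite /D bar_diff2 // bunconsE; case: s => [|x s]; first by rewrite linear0.
by rewrite bcurvE.
Qed.

Lemma bar_diff_bunit g : D (bunit g) = bunit (totdiff (cdiff G) g).
Proof. by have [_ g1 _ _] := mG_ainf; rewrite -g1 [LHS]bar_diff_nil. Qed.

(* Up to sign, the component A_+ (x) V -> A_+ (x) V of the differential of A (x) V. *)
Definition bdiffr : {linear XV -> XV} := buncons \o D \o bjoin.

Lemma buncons_diff v : bdiffr (buncons v) = buncons (D v).
Proof.
rewrite -{2}(bunconsK v) linearD linearD bar_diff_bunit.
by rewrite [buncons (bunit _)]bunconsE addr0.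
Qed.

(** Together with [bar_diffK], [buncons_diff] and [bar_diff_bcurv], this says exactly that (v, w)
    |-> (D v - bcurv w, buncons v - bdiffr w) squares to zero. *)
Lemma bdiffr2 t : bdiffr (bdiffr t) = buncons (bcurv t).
Proof.
by rewrite {2}/bdiffr -[LHS]/(bdiffr (buncons (D (bjoin t)))) buncons_diff bar_diffK bjoinK.
Qed.

Lemma bar_diff_bcurv t : D (bcurv t) = bcurv (bdiffr t).
Proof. by rewrite -{1}(bjoinK t) -bar_diffK bar_diffK. Qed.

Lemma buncons_bhead x s g : buncons (bhead m mG (x :: s) g) =
  \sum_(p <- splits s) tens (mapp m (x :: p.1)) (bel p.2 g).
Proof.
rewrite /bhead linearD [buncons (bel [::] _)]bunconsE addr0 linear_sum splits_cons.
rewrite [X in X + _ = _]bunconsE [X in X + _ = _]tensor0l add0r.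
by apply: eq_bigr => p _; rewrite bunconsE.
Qed.

(** If the first block absorbs entries of [v] besides [x], what remains has strictly smaller degree
    in the factor V. In degrees [q] at least [p] only m_1 is left, and it is minus the differential
    of A_+ because of the shift. *)
Lemma buncons_bhead_op x v p q : (p <= q)%N -> homog (X := V) p v ->
  gprr q (buncons (bhead_op m mG x v)) = if q == p then - tens (totdiff (udiff A) x) v else 0.
Proof.
(* Replacing [v] by its projection turns the claim into an equation of linear maps, which can be
   tested on homogeneous words. *)
move=> pq hv; rewrite -hv.
pose h := if q == p then (tensr (mapp m [:: x]) \o gpr V p : {linear V -> XV})
  else (\0 : {linear V -> XV}).
have -> : (if q == p then - tens (totdiff (udiff A) x) (gpr V p v) else 0) = h v.
  by case: m_ainf => _ + _ _; rewrite /h; case: eqP => // _ m1; rewrite -tensorNl -[RHS]/(tens _ _) m1.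
apply: (bel_homog_ext (f := gprr q \o buncons \o bhead_op m mG x \o gpr V p)) => n k s g hs hg.
rewrite -[LHS]/(gprr q (buncons (bhead_op m mG x (gpr V p (bel s g))))).
transitivity ((if q == p then tens (mapp m [:: x]) (gpr V p (bel s g)) else 0) : XV); last first.
  by rewrite /h; case: eqP.
rewrite (gpr_homog _ (homog_hbel hs hg)); case: eqP => [E|_]; last first.
  by rewrite tensor0r !linear0 if_same.
have rest (y : X) (t r : seq X) : hseq n (y :: t ++ r) ->
    gprr q (tens (mapp m [:: x, y & t]) (bel r g)) = 0.
  move=> hn; rewrite gprrE; have [a [b [nE ha hb]]] := hseq_cat (s := y :: t) hn.
  rewrite (gpr_homog _ (homog_hbel hb hg)) ifN ?tensor0r //; apply: contraTneq pq => ->.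
  by rewrite E -ltnNge nE ltn_add2r -[b in leqLHS]add0n ltn_add2r (ltnW (hseq_gt1 ha)).
rewrite bhead_opE buncons_bhead linear_sum; case: s hs rest => [|y s] hs rest.
  by rewrite splits_nil gprrE (gpr_homog _ (homog_hbel hs hg)) E; case: eqP => // _; rewrite tensor0r.
rewrite splits_cons gprrE (gpr_homog _ (homog_hbel hs hg)) -E big_seq big1 ?addr0.
  by case: eqP => // _; rewrite tensor0r.
by move=> r /mem_splits sr; apply: rest; rewrite sr.
Qed.

(** The leading part of the filtration by the degree of V is minus d_A (x) 1: the part sgn (x) D
    lands in degree p - 1, and [buncons_bhead_op] handles the terms that absorb the first entry. *)
Lemma bdiffr_lead p q t : (p <= q)%N ->
  gprr q (bdiffr (gprr p t)) = if q == p then - sdiff (gprr p t) else 0.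
Proof.
move=> pq; case: (tens_elt t) => l ->; rewrite (linear_sum (gprr p)).
rewrite (linear_sum sdiff) (linear_sum bdiffr) (linear_sum (gprr q)) -sumrN.
have -> : (if q == p then \sum_(i <- l) - sdiff (gprr p (tens i.1 i.2)) else 0) =
    \sum_(i <- l) if q == p then - sdiff (gprr p (tens i.1 i.2)) else 0.
  by case: ifP => // _; rewrite big1.
apply: eq_bigr => -[x v] _; rewrite -[tens _ _]/(tens x v) gprrE sdiffE.
have hv : homog (X := V) p (gpr V p v) by rewrite /homog gpr_gpr eqxx.
rewrite -[bdiffr _]/(buncons (D (bjoin (tens x (gpr V p v))))) bjoinE bar_diff_bcons linearD.
rewrite linearD (buncons_bhead_op x pq hv) -bjoinE bjoinK gprrE gpr_bar_diff //.
by rewrite gpr_gpr gtn_eqF ?ltnS // linear0 tensor0r add0r.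
Qed.

Lemma gprr_bdiffr n t : (forall q, (n < q)%N -> gprr q t = 0) ->
  (forall q, (n < q)%N -> gprr q (bdiffr t) = 0) /\
  gprr n (bdiffr t) = - sdiff (gprr n t).
Proof.
move=> ht; rewrite {1 2}(exhaust_trunc (n := n.+1) (gprr_exhaust t) ht).
rewrite (linear_sum bdiffr); split=> [q nq|].
  rewrite (linear_sum (gprr q)) big1 // => i _.
  have iq : (i < q)%N by apply: leq_ltn_trans nq; rewrite -ltnS.
  by rewrite bdiffr_lead ?(ltnW iq) // gtn_eqF.
rewrite (linear_sum (gprr n)) big_ord_recr big1 => [|i _].
  by rewrite [LHS]add0r bdiffr_lead // eqxx.
have iN : (i < n)%N by [].
by rewrite (bdiffr_lead t (ltnW iN)) gtn_eqF.
Qed.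

Lemma gpr_bar_diff_bound n v : (forall q, (n < q)%N -> gpr V q v = 0) ->
  forall q, (n <= q)%N -> gpr V q (D v) = 0.
Proof. by move=> hv q nq; rewrite gpr_bar_diff // hv ?linear0. Qed.

Lemma gprr_buncons n v : (forall q, (n < q)%N -> gpr V q v = 0) ->
  forall q, (n <= q)%N -> gprr q (buncons v) = 0.
Proof.
move=> hv q nq.
rewrite (exhaust_trunc (n := n.+1) (gpr_exhaust v) hv).
rewrite (linear_sum buncons) (linear_sum (gprr q)) big1 // => i _.
have iq : (i <= q)%N by rewrite (leq_trans _ nq) // -ltnS.
pose f := gprr q \o buncons \o gpr V i.
suff E : f =1 (\0 : {linear V -> XV}) by apply: E.
apply: bel_homog_ext => a k s g hs hg.
rewrite -[LHS]/(gprr q (buncons (gpr V i (bel s g)))) (gpr_homog _ (homog_hbel hs hg)).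
case: eqP => [E|_]; last by rewrite !linear0.
rewrite bunconsE; case: s hs => [|x s] hs; first by rewrite linear0.
rewrite gprrE; have [b [c [aE hb hc]]] := hseq_cat (s := [:: x]) hs.
rewrite (gpr_homog _ (homog_hbel hc hg)) ifN ?tensor0r //; apply: contraTneq iq => ->.
by rewrite E -ltnNge aE ltn_add2r -[c in leqLHS]add0n ltn_add2r (ltnW (hseq_gt1 hb)).
Qed.

Context (X_exact : forall x : X, totdiff (udiff A) x = 0 -> susp_d1 x = 0 ->
  exists y, x = totdiff (udiff A) y).
Context (V_proj : is_projective V).

(** Projection onto the component A_1, the only one seen by d_1 and one on which the differential of
    A_+ is zero. Adding a value of [bott] thus changes the curvature without changing [sdiff]. *)
Let bot : {linear X -> X} := din 0%N \o dcomp 0%N.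

Let totdiff_bot x : totdiff (udiff A) (bot x) = 0.
Proof. exact: dlift_din. Qed.

Let susp_d1_bot x : susp_d1 (bot x) = susp_d1 x.
Proof. by rewrite /susp_d1 [bot x 0%N]din_in. Qed.

Let bott : {linear XV -> XV} := tmap bot idfun.

Let sdiff_bott t : sdiff (bott t) = 0.
Proof.
apply: (tens_ext (M := X) (N := V) (f := sdiff \o bott) (g := \0)) => x v.
by rewrite -[LHS]/(sdiff (bott (tens x v))) /bott tmapE sdiffE totdiff_bot tensor0l.
Qed.

Let bcurv_bott t : bcurv (bott t) = bcurv t.
Proof.
apply: (tens_ext (M := X) (N := V) (f := bcurv \o bott)) => x v.
by rewrite -[LHS]/(bcurv (bott (tens x v))) /bott tmapE !bcurvE susp_d1_bot.
Qed.

(** Exactness of A in positive degrees, tensored with the flat module V. A_+ omits A_0, so cycles of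
    A in positive degrees are the joint kernel of the differential of A_+ and of d_1. *)
Lemma sdiff_exact t : sdiff t = 0 -> bcurv t = 0 -> exists z, t = sdiff z.
Proof.
move=> t1 t2; have ld : linear (fun x : X => susp_d1 x : Q^o).
  by move=> a x y; rewrite /susp_d1 -[(a *: x + y) 0%N]/(a *: x 0%N + y 0%N) linearP.
apply: (projective_flat (f := totdiff (udiff A)) (f' := mklin ld) V_proj) => //.
have E : tmap (mklin ld) idfun =1 tensr (1 : Q^o) \o bcurv.
  apply: tens_ext => x v; rewrite -[RHS]/(tens (1 : Q^o) (bcurv (tens x v))) bcurvE tmapE.
  rewrite -[RHS]/(tensr (1 : Q^o) (_ *: v)) linearZ_LR -[tensr _ v]/(tensl v (1 : Q^o)).
  by rewrite -linearZ_LR; congr (tens _ v); rewrite -[RHS]/(_ * 1) mulr1.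
by rewrite E -[LHS]/(tens (1 : Q^o) (bcurv t)) t2 tensor0r.
Qed.

(* On A (x) V = V (+) (X (x) V), whose first summand is A_0 (x) V, the differential is
   (v, w) |-> (D v - bcurv w, buncons v - bdiffr w). *)
Lemma bar_kernel_acyclic n (a0 b : XV) :
    (forall q, (n <= q)%N -> gpr V q (bcurv a0) = 0) ->
    (forall q, (n <= q)%N -> gprr q b = 0) ->
    D (bcurv a0) = bcurv b -> buncons (bcurv a0) = bdiffr b ->
  exists w0 w, bcurv a0 = D (bcurv w0) - bcurv w /\ b = buncons (bcurv w0) - bdiffr w.
Proof.
elim: n a0 b => [|n IH] a0 b ha hb Da ua.
  exists 0, 0; rewrite (linear0 bcurv) (linear0 D) (linear0 buncons) (linear0 bdiffr) !subr0; split.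
    by rewrite (exhaust_trunc (n := 0) (gpr_exhaust _) ha) big_ord0.
  by rewrite (exhaust_trunc (n := 0) (gprr_exhaust _) hb) big_ord0.
have [hEb lEb] := gprr_bdiffr hb.
(* [D] and [buncons] lower the degree of the factor V, so in degree n the two cycle equations say
   that the top component of [b] is killed by d_A (x) 1, including its part d_1 (x) 1. *)
have [z hz] : exists z, gprr n b = sdiff z.
  apply: sdiff_exact; last by rewrite -bcurv_gpr -Da (gpr_bar_diff_bound ha).
  by apply/eqP; rewrite -oppr_eq0 -lEb -ua (gprr_buncons ha).
(* Two requirements determine [w]: [sdiff w] must be the top component of [b], and [bcurv w] must
   cancel that of [bcurv a0]. The difference [z - bott z] keeps [sdiff z] and has no curvature;
   subtracting [bott a0] inserts the desired curvature. *)
pose w := gprr n (z - bott z - bott a0).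
have hw q : gprr q w = if q == n then w else 0 by apply: gprr_gprr.
have w_hi q : (n < q)%N -> gprr q w = 0 by move=> nq; rewrite hw gtn_eqF.
have cw : bcurv w = - gpr V n (bcurv a0).
  by rewrite /w -bcurv_gpr 2!(linearB bcurv) !bcurv_bott subrr sub0r linearN.
have sw : sdiff w = gprr n b.
  rewrite /w sdiff_gprr 2!(linearB sdiff) !sdiff_bott !subr0 -hz.
  by rewrite gprr_gprr eqxx.
have [hEw lEw] := gprr_bdiffr w_hi.
(* The boundary of (0, w) is (- bcurv w, - bdiffr w); subtracting it removes the components of
   V-degree n from both coordinates. *)
have [||||w0 [w1 [e1 e2]]] := IH (a0 + w) (b + bdiffr w).
- move=> q; rewrite leq_eqVlt (linearD bcurv) linearD [X in _ + X]bcurv_gpr hw => /orP[/eqP <-|nq].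
    by rewrite eqxx cw subrr.
  by rewrite ha // gtn_eqF // linear0 addr0.
- move=> q; rewrite leq_eqVlt linearD => /orP[/eqP <-|nq].
    by rewrite lEw hw eqxx sw subrr.
  by rewrite hb // hEw // addr0.
- by rewrite !(linearD bcurv) (linearD D) Da bar_diff_bcurv.
- by rewrite (linearD bcurv) (linearD buncons) (linearD bdiffr) ua bdiffr2.
exists w0, (w1 + w); rewrite (linearD bcurv) (linearD bdiffr) !opprD !addrA -e1 -e2.
by rewrite (linearD bcurv) !addrK.
Qed.

(** The boundary of (v, 0) is (D v, buncons v), a cycle of the acyclic kernel I V (+) (X (x) V),
    hence also the boundary of some (bcurv w0, w) there. So (v - bcurv w0, - w) is a cycle of A (x)
    V. Adding the boundary of (bjoin w, 0) makes its second coordinate zero, and the first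
    coordinate [v2] is then killed by [buncons] and by [D], that is, a cycle of G. *)
Lemma bar_exactQ v t : D v = bcurv t ->
  exists w y g, [/\ v = bcurv w + D y + bunit g & totdiff (cdiff G) g = 0].
Proof.
move=> Dv; have [N hN] := gpr_exhaust v.
have [M hM] := gpr_exhaust (D v).
have hi (u : V) n : u = \sum_(i < n) gpr V i u -> forall q, (n <= q)%N -> gpr V q u = 0.
  move=> -> q nq; rewrite linear_sum big1 // => i _.
  by rewrite gpr_gpr gtn_eqF // (leq_trans (ltn_ord i)).
pose n := (maxn N M).+1.
have [q nq|q nq|||w0 [w [e1 e2]]] := bar_kernel_acyclic (n := n) (a0 := t) (b := buncons v).
- by rewrite -Dv (hi _ _ (hM M (leqnn _))) // (leq_trans _ nq) // leqW // leq_maxr.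
- apply: (gprr_buncons (n := N)); last by rewrite (leq_trans _ nq) // leqW // leq_maxl.
  by move=> q' nq'; rewrite (hi _ _ (hN N (leqnn _))) // ltnW.
- by rewrite -Dv bar_diffK.
- by rewrite -Dv buncons_diff.
pose v2 := v - bcurv w0 + D (bjoin w).
have u2 : buncons v2 = 0 by rewrite /v2 linearD linearB e2 [X in X + _]addrAC subrr sub0r addNr.
have D2 : D v2 = 0.
  by rewrite /v2 linearD linearB Dv e1 bar_diffK bjoinK [X in X + _]addrAC subrr sub0r addNr.
have v2E : v2 = bunit (bbot v2) by rewrite -{1}(bunconsK v2) u2 linear0 add0r.
exists w0, (- bjoin w), (bbot v2); split.
  by rewrite -v2E linearN /v2 [RHS]addrC addrACA subrK subrr addr0.
have := bar_diff_bunit (bbot v2); rewrite -v2E D2 => /esym/(congr1 bbot).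
by rewrite bbotE linear0.
Qed.

End BarAcyclic.
Arguments bunit {Q} A {G}.
Arguments bcurv {Q A G}.
Arguments bjoin {Q A G}.
Arguments buncons {Q A G}.
Arguments bbot {Q A G}.

(** * The bar resolution *)

Lemma totdiff_exact (K : pzRingType) (C : nat -> lmodType K)
    (d : forall n, {linear C n.+1 -> C n}) (x : dsum C) :
  (forall n, exists y, x n = d n y) -> exists y, x = totdiff d y.
Proof.
move=> h; pose y n := projT1 (cid (h n)).
have yE n : x n = d n (y n) by rewrite /y; case: cid.
exists (\sum_(n <- dsupp x) din n.+1 (y n)); rewrite linear_sum {1}[x]dsumE.
by apply: eq_bigr => n _; rewrite totdiff_din yE.
Qed.

Section GradedComponents.
Context (K : pzRingType) (X : gmod K) (d : {linear X -> X}).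

Definition gcomp_proj n : {linear X -> gcomp X n} :=
  kerlift (f := gdefect X n) (h := gpr X n) (gdefect_gpr n).

Lemma ker_inclI (U W : lmodType K) (f : {linear U -> W}) : injective (ker_incl f).
Proof. exact: val_inj. Qed.

Lemma gcomp_projE n x : ker_incl (gdefect X n) (gcomp_proj n x) = gpr X n x.
Proof. by []. Qed.

Lemma gcomp_projK n (x : gcomp X n) : gcomp_proj n (ker_incl _ x) = x.
Proof. by apply: ker_inclI; rewrite gcomp_projE; apply: gcomp_homog. Qed.

Lemma gcomp_projective n : is_projective X -> is_projective (gcomp X n).
Proof. by move=> hX; apply: projective_retract hX (gcomp_projK (n := n)). Qed.

End GradedComponents.

Section BarProjective.
Context (Q : comPzRingType) (A : ucplx Q) (G : cplx Q).
Context (A_proj : forall n, is_projective (A n)) (G_proj : forall n, is_projective (G n)).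

Lemma susp_projective : is_projective (susp A).
Proof. by apply: dsum_projective => i; apply: (@A_proj i.+1). Qed.

Lemma barG_projective : is_projective (barG A G).
Proof.
apply: tensor_projective; apply: dsum_projective => // n.
elim: n => [|n IH] /=; first exact: base_projective.
exact: tensor_projective susp_projective IH.
Qed.

End BarProjective.

Section BarResolution.
Context (Q R : comPzRingType) (phi : {rmorphism Q -> R}).
Context (phi_surj : forall r, exists q, phi q = r) (M : lmodType R).
Context (A : ucplx Q) (A_res : is_projective_resolution (uaug A phi)).
Context (G : cplx Q) (epsG : {linear G 0%N -> restr phi M}).
Context (G_res : is_projective_resolution epsG).
Context (m : ainf_maps A) (m_ainf : ainf_algebra m).
Context (mG : amod_maps A G) (mG_ainf : ainf_module m mG).
Let X := susp A.
Let V := barG A G.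
Let D := bar_diffQ m mG.
Let B := bar A G phi.
Let d : {linear B -> B} := bar_diff m mG phi.
Let eps : {linear B -> M} := bar_eps A epsG.
Let V_proj : is_projective V. Proof. exact: barG_projective A_res.1 G_res.1. Qed.
Let A_cplx : is_complex A. Proof. by case: A_res => _ []. Qed.
Let G_cplx : is_complex G. Proof. by case: G_res => _ []. Qed.
Let m_deg : forall n, degm1 (m n). Proof. by case: m_ainf. Qed.
Let mG_deg : forall n, degm1 (mG n). Proof. by case: mG_ainf. Qed.

Let X_exact (x : X) : totdiff (udiff A) x = 0 -> susp_d1 x = 0 ->
  exists y, x = totdiff (udiff A) y.
Proof.
case: A_res => _ [_ ex _ _] dx d1x; apply: totdiff_exact => -[|n].
  exact: (ex 0%N (x 0%N) d1x).
by apply: (ex n.+1 (x n.+1)); rewrite -[LHS](totdiffE (udiff A)) dx.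
Qed.

Lemma phi_eq0 q : phi q = 0 <-> exists y, q = udiff1 A y.
Proof. by case: A_res => _ [_ _ h _]; apply: (h q). Qed.

Lemma btens1_surj (N : lmodType Q) (z : bchange phi N) : exists v, z = btens phi 1 v.
Proof.
elim/bscale_elt: z => [x y|s t [u ->] [v ->]|].
- have [q qx] := phi_surj x; exists (q *: y).
  by rewrite btensZr mul1r qx.
- by exists (u + v); rewrite btensDr.
by exists 0; rewrite /btens tensor0r.
Qed.

Lemma btens_curv t : btens phi 1 (bcurv (t : tensor X V)) = 0.
Proof.
have l : linear (fun v : V => btens phi 1 v : restr phi B).
  by move=> a x y; rewrite btensDr btensZr mul1r restrZ bchangeZ mulr1.
apply: (tens_ext (M := X) (N := V) (f := mklin l \o bcurv) (g := \0)) => x v.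
rewrite -[LHS]/(btens phi 1 (bcurv (tens x v))) bcurvE btensZr mul1r.
rewrite (_ : phi _ = 0) /btens ?tensor0l //.
by apply/phi_eq0; exists (x 0%N).
Qed.

(** Since V is projective, vanishing in R (x) V can be read off on dual-basis coordinates: each one
    maps to 0 in R, hence is a value of d_1. *)
Lemma btens_eq0 v : btens phi 1 (v : V) = 0 -> exists t : tensor X V, v = bcurv t.
Proof.
move=> v0; have [s hs] := projective_dual_basis V_proj.
have lx x : linear (fun v : V => phi (s v x) : restr phi R^o).
  by move=> a u w; rewrite linearP -[_ x]/(a * s u x + s w x) rmorphD rmorphM.
have sx x : exists y, s v x = udiff1 A y.
  apply/phi_eq0; have := bcliftE (mklin (lx x)) 1 v.
  by rewrite v0 linear0 mklinE [1 *: _]mul1r.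
have /choice[y yE] := sx.
exists (\sum_(x <- dsupp (s v)) tens (din 0%N (y x) : X) x).
rewrite -{1}(hs v) (flift_coordE _ (dsupp_uniq _) (@dsupp_out _ _ _ _)) linear_sum.
by apply: eq_bigr => x _; rewrite bcurvE /susp_d1 [din _ _ _]din_in -yE.
Qed.

Lemma bar_diffRE v : d (btens phi 1 v) = btens phi 1 (D v).
Proof. exact: bcmapE. Qed.

Lemma bar_diffRK z : d (d z) = 0.
Proof.
have [v ->] := btens1_surj z; rewrite !bar_diffRE bar_diffK //.
exact: btens_curv.
Qed.

Lemma bar_epsQ_linear : linear (fun v : V => eps (btens phi 1 v) : restr phi M).
Proof. by move=> a u v; rewrite btensDr btensZr mul1r linearD -[phi a]mulr1 -bchangeZ linearZ_LR. Qed.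

Lemma bar_epsQE s g : eps (btens phi 1 (bel s g)) = if s is [::] then epsG (g 0%N) else 0 :> M.
Proof. by rewrite [LHS]bar_epsE scale1r. Qed.

Lemma bar_eps_gpr n z : eps (gpr B n z) = if n == 0%N then eps z else 0.
Proof.
have [v ->] := btens1_surj z; rewrite [gpr B n _]bcmapE.
pose h := if n == 0%N then mklin bar_epsQ_linear else (\0 : {linear V -> restr phi M}).
transitivity (h v); last by rewrite /h; case: eqP.
apply: (bel_homog_ext (f := mklin bar_epsQ_linear \o gpr V n)) => a k s g hs hg.
rewrite -[LHS]/(eps (btens phi 1 (gpr V n (bel s g)))) (gpr_homog _ (homog_hbel hs hg)).
transitivity (if n == 0%N then eps (btens phi 1 (bel s g)) else 0); last by rewrite /h; case: eqP.
have z0 : eps (btens phi 1 0) = 0 by rewrite /btens tensor0r linear0.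
case: (eqVneq n 0%N) => [->|n0].
  case: (eqVneq 0%N (a + k)%N) => // ak; rewrite z0 bar_epsQE; case: s hs => // hs.
  have -> : g 0%N = 0; last by rewrite linear0.
  rewrite -hg [LHS]gtot_prE; case: eqP => // k0.
  by move: ak; rewrite -k0; inversion hs.
case: eqP => // nE; rewrite bar_epsQE; case: s hs => // hs.
have -> : g 0%N = 0; last by rewrite linear0.
rewrite -hg [LHS]gtot_prE; case: eqP => // k0.
by move: nE n0; rewrite -k0; inversion hs => ->.
Qed.

(** Only the degree 1 part of [z] matters, and it lives on the empty word because bar entries have
    degree at least 2. There the claim is that the augmentation of G kills boundaries. *)
Lemma bar_eps_diff z : eps (d z) = 0.
Proof.
have := bar_eps_gpr 0 (d z); rewrite eqxx => <-; rewrite gpr_bar_diffR //.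
have [v ->] := btens1_surj z; rewrite [gpr _ _ _]bcmapE -/d bar_diffRE.
apply: (bel_homog_ext (f := mklin bar_epsQ_linear \o D \o gpr V 1) (h := \0)) => a k s g hs hg.
rewrite -[LHS]/(eps (btens phi 1 (D (gpr V 1 (bel s g))))) (gpr_homog _ (homog_hbel hs hg)).
have z0 : eps (btens phi 1 0) = 0 by rewrite /btens tensor0r linear0.
case: eqP => [E|_]; last by rewrite linear0 z0.
case: s hs => [|x s] hs; last by have := hseq_gt1 hs; case: (a) E => [|[]].
rewrite [D _](bar_diff_bunit mG_ainf) [LHS]bar_epsQE totdiffE.
by case: G_res => _ [_ _ h _]; apply/h; exists (g 1%N).
Qed.

(** [bar_exactQ] leaves a cycle of G. Its components in positive degree are boundaries, and the
    vanishing of [eps z] makes the component in degree 0 one as well. As [eps] is zero in positive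
    degrees, this single ungraded statement covers exactness everywhere. *)
Lemma bar_exactR z : d z = 0 -> eps z = 0 -> exists y, z = d y.
Proof.
have [v ->] := btens1_surj z; rewrite bar_diffRE => /btens_eq0[t Dv] ev.
have [w [y [g [vE dg]]]] := bar_exactQ m_ainf mG_ainf A_cplx G_cplx X_exact V_proj Dv.
have zE : btens phi 1 v = d (btens phi 1 y) + btens phi 1 (bunit A g).
  by rewrite vE !btensDr btens_curv add0r bar_diffRE.
have g0 : exists y0, g 0%N = cdiff G 0 y0.
  case: G_res => _ [_ _ h _]; apply/h; rewrite -ev zE linearD bar_eps_diff add0r.
  by rewrite [RHS]bar_epsQE.
have [y' gE] : exists y', g = totdiff (cdiff G) y'.
  apply: totdiff_exact => -[//|n]; case: G_res => _ [_ h _ _]; apply: h.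
  by rewrite -[LHS](totdiffE (cdiff G)) dg.
exists (btens phi 1 (y + bunit A y')).
by rewrite zE btensDr linearD !bar_diffRE gE [D (bunit _ _)]bar_diff_bunit.
Qed.

Lemma bar_projective_resolution : is_projective_resolution (bar_aug m mG epsG).
Proof.
split=> [n|]; first by apply/gcomp_projective/bchange_projective.
have dK n (x : gcomp B n.+1) : gpr B n (d (ker_incl _ x)) = d (ker_incl _ x).
  by rewrite gpr_bar_diffR //; congr (d _); apply: gcomp_homog.
split=> [n x|n x dx|x|z].
- apply: ker_inclI; rewrite [LHS]gcplx_diffE [X in bar_diff _ _ _ X]gcplx_diffE.
  rewrite [X in bar_diff _ _ _ X]dK bar_diffRK.
  by rewrite linear0 [RHS]linear0.
- have dx0 : d (ker_incl _ x) = 0 by rewrite -dK -gcplx_diffE dx linear0.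
  have [|y yE] := bar_exactR dx0.
    by have := bar_eps_gpr n.+1 (ker_incl _ x); rewrite gcomp_homog.
  (* The preimage [y] need not be homogeneous; since [d] has degree -1, its component one degree
     above [x] already bounds [x]. *)
  exists (gcomp_proj B n.+2 y); apply: ker_inclI.
  by rewrite gcplx_diffE gcomp_projE -gpr_bar_diffR // -yE [RHS]gpr_gpr eqxx gcomp_homog.
- split=> [ex|[y ->]]; last first.
    by rewrite -[LHS]/(eps (ker_incl _ (cdiff _ _ y))) gcplx_diffE dK bar_eps_diff.
  have dx0 : d (ker_incl _ x) = 0.
    by rewrite -(gcomp_homog x) (bar_degm1 m_deg mG_deg phi).1 // /homog gpr_gpr eqxx.
  have [y yE] := bar_exactR dx0 ex.
  exists (gcomp_proj B 1 y); apply: ker_inclI.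
  by rewrite gcplx_diffE gcomp_projE -gpr_bar_diffR // -yE [RHS]gpr_gpr eqxx gcomp_homog.
have [y <-] : exists y, epsG y = z by case: G_res => _ [_ _ _]; apply.
exists (gcomp_proj B 0 (btens phi 1 (bunit A (din 0%N y)))).
rewrite -[LHS]/(eps (ker_incl _ (gcomp_proj B 0 _))) gcomp_projE bar_eps_gpr eqxx.
by rewrite [LHS]bar_epsQE din_in.
Qed.

End BarResolution.

(** * Independence of Tor from the resolution *)

(** Dependent choice along a family of types. The invariant [P] is what allows the next step; for
    chain maps and homotopies it says that the next lifting problem is solvable. *)
Lemma dep_choice (T : nat -> Type) (P : forall n, T n -> Prop)
    (S : forall n, T n -> T n.+1 -> Prop) (x0 : T 0%N) : P 0%N x0 ->
    (forall n x, P n x -> exists y, P n.+1 y /\ S n x y) ->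
  exists f : forall n, T n, f 0%N = x0 /\ forall n, S n (f n) (f n.+1).
Proof.
move=> P0 step.
pose F := fix F n : {x : T n | P n x} :=
  match n return {x : T n | P n x} with
  | 0 => exist _ x0 P0
  | n'.+1 =>
    let: exist y h := cid (step n' (sval (F n')) (svalP (F n'))) in exist _ y h.1
  end.
exists (fun n => sval (F n)); split=> // n /=.
by case: cid => y [].
Qed.

Section Comparison.
Context (K : pzRingType) (M : lmodType K).

Definition chain_map (F F' : cplx K) (f : forall n, {linear F n -> F' n}) : Prop :=
  forall n x, cdiff F' n (f n.+1 x) = f n (cdiff F n x).

Definition homotopic (F F' : cplx K) (f g : forall n, {linear F n -> F' n}) : Prop :=
  exists h : forall n, {linear F n -> F' n.+1},
    (forall x, f 0%N x = g 0%N x + cdiff F' 0 (h 0%N x)) /\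
    (forall n x, f n.+1 x = g n.+1 x + (cdiff F' n.+1 (h n.+1 x) + h n (cdiff F n x))).

Context (F F' : cplx K) (e : {linear F 0%N -> M}) (e' : {linear F' 0%N -> M}).
Context (F_res : is_projective_resolution e) (F'_res : is_resolution e').

Lemma chain_lift : exists f : forall n, {linear F n -> F' n},
  chain_map f /\ forall x, e' (f 0%N x) = e x.
Proof.
case: F_res => F_proj [dd _ ee _]; case: F'_res => dd' ex' ee' surj'.
have [f0 f0E] := projective_lift (d := e') (f := e) (F_proj 0%N)
  (fun x => let: ex_intro y h := surj' (e x) in ex_intro _ y (esym h)).
(* This is the hypothesis of [projective_lift] for the next degree; exactness of [F'] restores it
   after each step. *)
pose P n (f : {linear F n -> F' n}) := forall x, exists y, f (cdiff F n x) = cdiff F' n y.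
pose S n (f : {linear F n -> F' n}) (f' : {linear F n.+1 -> F' n.+1}) :=
  forall x, cdiff F' n (f' x) = f (cdiff F n x).
have P0 : P 0%N f0 by move=> x; apply/ee'; rewrite f0E; apply/ee; exists x.
have step n f : P n f -> exists f', P n.+1 f' /\ S n f f'.
  move=> Pf; have [f' f'E] := projective_lift (f := f \o cdiff F n) (F_proj n.+1) Pf.
  exists f'; split=> // x; apply: ex'; rewrite f'E.
  by rewrite -[LHS]/(f (cdiff F n (cdiff F n.+1 x))) dd linear0.
have [f [f00 fS]] := dep_choice P0 step.
by exists f; split=> // x; rewrite f00.
Qed.

Lemma chain_homotopy (f g : forall n, {linear F n -> F' n}) :
  chain_map f -> chain_map g -> (forall x, e' (f 0%N x) = e' (g 0%N x)) -> homotopic f g.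
Proof.
case: F_res => F_proj [dd _ _ _]; case: F'_res => dd' ex' ee' _ cf cg fg.
have [h0 h0E] : exists h : {linear F 0%N -> F' 1%N},
    forall x, cdiff F' 0 (h x) = (f 0%N \- g 0%N) x.
  apply: projective_lift (F_proj 0%N) _ => x; apply/ee'.
  by rewrite -[LHS]/(e' (f 0%N x - g 0%N x)) linearB fg subrr.
pose P n (h : {linear F n -> F' n.+1}) :=
  forall x, exists y, f n.+1 x - g n.+1 x - h (cdiff F n x) = cdiff F' n.+1 y.
pose S n (h : {linear F n -> F' n.+1}) (h' : {linear F n.+1 -> F' n.+2}) :=
  forall x, cdiff F' n.+1 (h' x) = f n.+1 x - g n.+1 x - h (cdiff F n x).
have P0 : P 0%N h0.
  move=> x; apply: ex'; rewrite !linearB h0E cf cg.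
  exact: subrr.
have step n h : P n h -> exists h', P n.+1 h' /\ S n h h'.
  move=> Ph; have [h' h'E] := projective_lift
    (f := (f n.+1 \- g n.+1) \- (h \o cdiff F n)) (F_proj n.+1) Ph.
  exists h'; split=> // x; apply: ex'; rewrite !linearB h'E cf cg.
  rewrite -[X in _ - X]/(f n.+1 (cdiff F n.+1 x) - g n.+1 (cdiff F n.+1 x) -
    h (cdiff F n (cdiff F n.+1 x))).
  by rewrite dd linear0 subr0 subrr.
have [h [h00 hS]] := dep_choice P0 step.
exists h; split=> [x|n x]; first by rewrite h00 h0E addrC subrK.
by rewrite hS subrK addrC subrK.
Qed.

End Comparison.

Section HomologyMap.
Context (K : pzRingType) (C C' : cplx K) (f : forall n, {linear C n -> C' n}).
Context (cf : chain_map f).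

Lemma hmap_ker n (z : kermod (cout C n)) : cout C' n ((f n \o ker_incl _) z) = 0.
Proof.
case: n z => [|n] z //; rewrite -[LHS]/(cdiff C' n (f n.+1 (ker_incl _ z))) cf.
have -> : cdiff C n (ker_incl _ z) = 0 by apply/eqP; apply: (ker_valP z).
exact: linear0.
Qed.

Definition hker n : {linear kermod (cout C n) -> kermod (cout C' n)} := kerlift (@hmap_ker n).

Let bd (C : cplx K) n (z : kermod (cout C n)) := exists y, ker_incl _ z = cdiff C n y.

Lemma hmap_bd n z : bd z -> (qproj (@bd C' n) \o hker n) z = 0.
Proof.
case=> y zE; apply/qproj_eq0/span_gen; exists (f n.+1 y).
by rewrite cf -zE.
Qed.

Definition hmap n : {linear homology C n -> homology C' n} := qlift (@hmap_bd n).

Lemma hmapE n z : hmap n (qproj (@bd C n) z) = qproj (@bd C' n) (hker n z).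
Proof. exact: qliftE. Qed.

End HomologyMap.

Lemma hmap_cancel (K : pzRingType) (C C' : cplx K) (f : forall n, {linear C n -> C' n})
    (g : forall n, {linear C' n -> C n}) (cf : chain_map f) (cg : chain_map g) n :
  homotopic (fun n => g n \o f n) (fun n => idfun) -> cancel (hmap cf n) (hmap cg n).
Proof.
case=> h [h0 hS] x; have [z <-] := qproj_surj x.
rewrite !hmapE; apply/qpi_eq/span_gen; exists (h n (ker_incl _ z)).
rewrite linearB; apply/eqP; rewrite subr_eq addrC; apply/eqP.
rewrite -[LHS]/(g n (f n (ker_incl _ z))).
case: n z x => [|n] z x; first exact: h0.
rewrite -[LHS]/((g n.+1 \o f n.+1) (ker_incl _ z)) hS; congr (_ + _).
have -> : cdiff C n (ker_incl _ z) = 0 by apply/eqP; apply: (ker_valP z).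
by rewrite linear0 addr0.
Qed.

Section TorComparison.
Context (K L : comPzRingType) (kappa : {rmorphism K -> L}).

Let bc (F F' : cplx K) (f : forall n, {linear F n -> F' n}) n :
  {linear cplx_bc kappa F n -> cplx_bc kappa F' n} := bcmap kappa (f n).

Lemma bc_chain_map (F F' : cplx K) (f : forall n, {linear F n -> F' n}) :
  chain_map f -> chain_map (bc f).
Proof.
move=> cf n; apply: (btens_ext (f := cdiff (cplx_bc kappa F') n \o bc f n.+1)
  (g := bc f n \o cdiff (cplx_bc kappa F) n)) => y.
rewrite -[LHS]/(bcmap kappa (cdiff F' n) (bcmap kappa (f n.+1) (btens kappa 1 y))).
rewrite -[RHS]/(bcmap kappa (f n) (bcmap kappa (cdiff F n) (btens kappa 1 y))).
by rewrite !bcmapE cf.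
Qed.

Lemma bc_homotopic (F F' : cplx K) (f : forall n, {linear F n -> F' n})
    (g : forall n, {linear F' n -> F n}) :
  homotopic (fun n => g n \o f n) (fun n => idfun) ->
  homotopic (fun n => bc g n \o bc f n) (fun n => idfun).
Proof.
case=> h [h0 hS]; exists (fun n => bcmap kappa (h n)).
split=> [|n].
  apply: (btens_ext (f := bc g 0 \o bc f 0)
    (g := idfun \+ (cdiff (cplx_bc kappa F) 0 \o bcmap kappa (h 0%N)))) => y.
  rewrite -[LHS]/(bcmap kappa (g 0%N) (bcmap kappa (f 0%N) (btens kappa 1 y))) !bcmapE.
  rewrite -[RHS]/(btens kappa 1 y +
    bcmap kappa (cdiff F 0) (bcmap kappa (h 0%N) (btens kappa 1 y))) !bcmapE.
  by rewrite -btensDr -[g _ _]/((g 0%N \o f 0%N) y) h0.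
apply: (btens_ext (f := bc g n.+1 \o bc f n.+1)
  (g := idfun \+ ((cdiff (cplx_bc kappa F) n.+1 \o bcmap kappa (h n.+1)) \+
    (bcmap kappa (h n) \o cdiff (cplx_bc kappa F) n)))) => y.
rewrite -[LHS]/(bcmap kappa (g n.+1) (bcmap kappa (f n.+1) (btens kappa 1 y))) !bcmapE.
rewrite -[RHS]/(btens kappa 1 y +
  (bcmap kappa (cdiff F n.+1) (bcmap kappa (h n.+1) (btens kappa 1 y)) +
   bcmap kappa (h n) (bcmap kappa (cdiff F n) (btens kappa 1 y)))) !bcmapE.
by rewrite -!btensDr -[g _ _]/((g n.+1 \o f n.+1) y) hS.
Qed.

Lemma canres_resolution (M : lmodType K) :
  is_projective_resolution (flift (fun x : M => x) : {linear canres M 0%N -> M}).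
Proof.
have kz (N : lmodType K) (z : kermod (flift (fun x : N => x))) :
    flift (fun x : N => x) (ker_incl _ z) = 0.
  by have := ker_valP z; rewrite unfold_in => /eqP.
have surj (N : lmodType K) (w : N) : exists x, flift (fun x : N => x) x = w.
  by exists (fgen K w); rewrite fliftE.
split=> [n|]; first exact: free_projective.
have dE n (x : canres M n.+1) : cdiff (canres M) n x =
    ker_incl (flift (fun x : syz M n => x)) (flift (fun x : syz M n.+1 => x) x) by [].
split=> [n x|n x|x|z]; last exact: (surj M).
- rewrite dE [cdiff _ n.+1 x]dE (kz (syz M n.+1)).
  exact: linear0.
- rewrite dE => x0; have x1 : flift (fun x : syz M n.+1 => x) x = 0.
    by apply: val_inj; apply: x0.
  have kx : x \in kerp (flift (fun x : syz M n.+1 => x)) by rewrite unfold_in /kerp x1.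
  have [y yE] := surj (syz M n.+2) (KerMod kx).
  by exists y; rewrite dE yE.
split=> [x0|[y ->]]; last by rewrite dE kz.
have kx : x \in kerp (flift (fun x : syz M 0 => x)) by rewrite unfold_in /kerp x0.
have [y yE] := surj (syz M 1) (KerMod kx).
by exists y; rewrite dE yE.
Qed.

Lemma tor_resolution (M : lmodType K) (F : cplx K) (e : {linear F 0%N -> M}) n :
  is_projective_resolution e ->
  exists f : {linear homology (cplx_bc kappa F) n -> tor kappa M n}, bijective f.
Proof.
move=> F_res; have C_res := canres_resolution M.
have [f [cf fe]] := chain_lift F_res C_res.2.
have [g [cg ge]] := chain_lift C_res F_res.2.
exists (hmap (bc_chain_map cf) n).
exists (hmap (bc_chain_map cg) n); apply/hmap_cancel/bc_homotopic.
  apply: (chain_homotopy F_res F_res.2) => // [i x|x]; last by rewrite -[LHS]/(e (g _ (f _ x))) ge fe.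
  by rewrite -[LHS]/(cdiff F i (g i.+1 (f i.+1 x))) cg cf.
apply: (chain_homotopy C_res C_res.2) => // [i x|x].
  by rewrite -[LHS]/(cdiff _ i (f i.+1 (g i.+1 x))) cf cg.
by rewrite -[LHS]/(flift _ (f _ (g _ x))) fe ge.
Qed.

End TorComparison.

(** * Ranks of graded pieces *)

Lemma inj_surj_bij (T U : Type) (f : T -> U) :
  injective f -> (forall y, exists x, f x = y) -> bijective f.
Proof.
move=> fI /choice[g gK]; exists g => // x.
by apply: fI; rewrite gK.
Qed.

Lemma bijective_linear (K : pzRingType) (U V : lmodType K) (f : {linear U -> V}) :
  bijective f -> exists g : {linear V -> U}, cancel f g /\ cancel g f.
Proof.
case=> g fK gK; have lg : linear g by move=> a x y; apply: (can_inj fK); rewrite linearP !gK.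
by exists (mklin lg).
Qed.

Section Basis.
Context (K : comPzRingType).

(* [e] is a basis of the image of the projection [p]. *)
Definition proj_basis (V : lmodType K) (p : {linear V -> V}) (I : finType) : Prop :=
  exists (e : I -> V) (c : I -> {linear V -> K^o}),
    (forall v, p v = \sum_i (c i v : K) *: e i) /\
    (forall i j, c i (e j) = (i == j)%:R).

Lemma proj_basis_ext (V : lmodType K) (p q : {linear V -> V}) I :
  p =1 q -> proj_basis p I -> proj_basis q I.
Proof. by move=> pq [e [c [h1 h2]]]; exists e, c; split=> // v; rewrite -pq. Qed.

Lemma sum_delta (V : lmodType K) (I : finType) (e : I -> V) (c : I -> K) j :
  (forall i, c i = (i == j)%:R) -> \sum_i c i *: e i = e j.
Proof.
move=> h; rewrite (bigD1 j) //= h eqxx scale1r big1 ?addr0 // => i /negPf ij.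
by rewrite h ij scale0r.
Qed.

Lemma proj_basis_reindex (V : lmodType K) (p : {linear V -> V}) (I J : finType) :
  #|I| = #|J| -> proj_basis p I -> proj_basis p J.
Proof.
move=> IJ [e [c [h1 h2]]].
pose f (j : J) : I := enum_val (cast_ord (esym IJ) (enum_rank j)).
pose g (i : I) : J := enum_val (cast_ord IJ (enum_rank i)).
have fK : cancel f g by move=> j; rewrite /f /g enum_valK cast_ordKV enum_rankK.
have gK : cancel g f by move=> i; rewrite /f /g enum_valK cast_ordK enum_rankK.
exists (e \o f), (c \o f); split=> [v|i j]; last by rewrite /= h2 (can_eq fK).
rewrite h1 (reindex f) //=; exists g => x _; [exact: fK | exact: gK].
Qed.

Lemma proj_basis_conj (U V : lmodType K) (a : {linear U -> V}) (b : {linear V -> U})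
    (p : {linear U -> U}) I :
  (forall u, b (a u) = u) -> proj_basis p I -> proj_basis (a \o p \o b) I.
Proof.
move=> ab [e [c [h1 h2]]]; exists (a \o e), (fun i => c i \o b); split=> [v|i j].
  by rewrite -[LHS]/(a (p (b v))) h1 linear_sum; apply: eq_bigr => i _; rewrite linearZ_LR.
by rewrite -[LHS]/(c i (b (a (e j)))) ab h2.
Qed.

Lemma proj_basis_split (U V : lmodType K) (a : {linear U -> V}) (b : {linear V -> U})
    (p : {linear V -> V}) I :
  (forall u, b (a u) = u) -> (forall v, a (b v) = p v) -> proj_basis p I ->
  proj_basis (idfun : {linear U -> U}) I.
Proof.
move=> ab ba [e [c [h1 h2]]].
have pe j : p (e j) = e j by rewrite h1; apply: sum_delta => i; apply: h2.
exists (b \o e), (fun i => c i \o a); split=> [v|i j].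
  rewrite -[v in LHS]ab -[LHS]/(b (a v)) -(ab v) ba h1 linear_sum.
  by apply: eq_bigr => i _; rewrite linearZ_LR ab.
by rewrite -[LHS]/(c i (a (b (e j)))) ba pe h2.
Qed.

Lemma proj_basis_add (V : lmodType K) (p q : {linear V -> V}) (I J : finType) :
  (forall v, p (q v) = 0) -> (forall v, q (p v) = 0) ->
  proj_basis p I -> proj_basis q J -> proj_basis (p \+ q) (I + J)%type.
Proof.
move=> pq qp [e [c [h1 h2]]] [e' [c' [h1' h2']]].
have cp i v : c i (p v) = c i v.
  rewrite h1 linear_sum (bigD1 i) //= linearZ_LR h2 eqxx big1 => [|j ji].
    by rewrite addr0; apply: mulr1.
  by rewrite linearZ_LR h2 eq_sym (negPf ji) scaler0.
have cp' i v : c' i (q v) = c' i v.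
  rewrite h1' linear_sum (bigD1 i) //= linearZ_LR h2' eqxx big1 => [|j ji].
    by rewrite addr0; apply: mulr1.
  by rewrite linearZ_LR h2' eq_sym (negPf ji) scaler0.
have pe j : p (e j) = e j by rewrite h1; apply: sum_delta => i; apply: h2.
have pe' j : q (e' j) = e' j by rewrite h1'; apply: sum_delta => i; apply: h2'.
exists (fun x => match x with inl i => e i | inr j => e' j end).
exists (fun x => match x with inl i => c i | inr j => c' j end); split=> [v|].
  by rewrite big_sumType -h1 -h1'.
case=> i [] j //=.
- by rewrite -cp -pe' pq linear0.
- by rewrite -cp' -pe qp linear0.
Qed.

Lemma proj_basis0 (V : lmodType K) (p : {linear V -> V}) :
  (forall v, p v = 0) -> proj_basis p 'I_0.
Proof.
by move=> p0; exists (fun=> 0), (fun=> \0); split=> [v|[]//]; rewrite p0 big_ord0.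
Qed.

Lemma proj_basis_tens (U V : lmodType K) (p : {linear U -> U}) (q : {linear V -> V})
    (I J : finType) :
  proj_basis p I -> proj_basis q J -> proj_basis (tmap p q) (I * J)%type.
Proof.
move=> [e [c [h1 h2]]] [e' [c' [h1' h2']]].
have hb i j : bilin (fun x y => (c i x : K) * (c' j y : K) : K^o).
  split=> [x a y z|y a x z].
    by rewrite (linearP (c' j)) [LHS]mulrDr; congr (_ + _); apply: mulrCA.
  by rewrite (linearP (c i)) [LHS]mulrDl; congr (_ + _); rewrite -[RHS]/(_ * (_ * _)) mulrA.
exists (fun x => tens (e x.1) (e' x.2)), (fun x => tlift (hb x.1 x.2)); split=> [v|[i j] [i' j']].
  have lv : linear (fun v => \sum_x (tlift (hb x.1 x.2) v : K) *: tens (e x.1) (e' x.2)).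
    move=> a u w; rewrite scaler_sumr -big_split; apply: eq_bigr => x _.
    by rewrite linearP [LHS]scalerDl; congr (_ + _); rewrite [RHS]scalerA.
  apply: (tens_ext (g := mklin lv)) => x y; rewrite tmapE mklinE h1 h1'.
  rewrite -[LHS]/(tensl _ _) linear_sum.
  rewrite -(pair_bigA _ (fun i j => (tlift (hb i j) (tens x y) : K) *: tens (e i) (e' j))).
  apply: eq_bigr => i _; rewrite -[tensl _ _]/(tensr (_ *: e i) _) linear_sum.
  apply: eq_bigr => j _; rewrite tliftE linearZ_LR -[tensr _ _]/(tensl (e' j) (_ *: _)).
  by rewrite linearZ_LR scalerA mulrC.
rewrite tliftE /= h2 h2' xpair_eqE; case: eqP => _; case: eqP => _ /=;
  by rewrite ?mulr1 ?mulr0 ?mul0r.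
Qed.

Lemma proj_basis_bc (L : comPzRingType) (phi : {rmorphism K -> L}) (V : lmodType K)
    (p : {linear V -> V}) I : proj_basis p I ->
  exists (e : I -> bchange phi V) (c : I -> {linear bchange phi V -> L^o}),
    (forall v, bcmap phi p v = \sum_i (c i v : L) *: e i) /\
    (forall i j, c i (e j) = (i == j)%:R).
Proof.
move=> [e [c [h1 h2]]].
have lc i : linear (fun v => phi (c i v) : restr phi L^o).
  move=> a u v; rewrite linearP -[X in phi X]/(a * (c i u : K) + c i v).
  by rewrite rmorphD rmorphM.
exists (fun i => btens phi 1 (e i)), (fun i => bclift (mklin (lc i))); split=> [v|i j].
  have lv : linear (fun v => \sum_i (bclift (mklin (lc i)) v : L) *: btens phi 1 (e i)).
    move=> a u w; rewrite scaler_sumr -big_split; apply: eq_bigr => x _.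
    by rewrite linearP [LHS]scalerDl; congr (_ + _); rewrite [RHS]scalerA.
  apply: (btens_ext (g := mklin lv)) => y; rewrite bcmapE mklinE h1.
  rewrite -[LHS]/(tensr (1 : restr phi L^o) _) linear_sum; apply: eq_bigr => i _.
  rewrite -[LHS]/(btens phi 1 _) btensZr bcliftE mklinE bchangeZ mul1r mulr1.
  by congr (btens phi _ _); rewrite -[RHS]/(1 * _) mul1r.
by rewrite bcliftE mklinE h2 -[LHS]/(1 * _) mul1r rmorph_nat.
Qed.

(* The image of [p] is free of rank [z]; [z] is an integer so as to match [fps]. *)
Definition proj_rank (V : lmodType K) (p : {linear V -> V}) (z : int) : Prop :=
  exists r, proj_basis p 'I_r /\ r%:Z = z.

Lemma proj_basis_rank (V : lmodType K) (p : {linear V -> V}) (I : finType) z :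
  proj_basis p I -> #|I|%:Z = z -> proj_rank p z.
Proof. by move=> hp hz; exists #|I|; split=> //; apply: proj_basis_reindex hp; rewrite card_ord. Qed.

Lemma proj_rank_ext (V : lmodType K) (p q : {linear V -> V}) z :
  p =1 q -> proj_rank p z -> proj_rank q z.
Proof. by move=> pq [r [hr hz]]; exists r; split=> //; apply: proj_basis_ext hr. Qed.

Lemma proj_rank0 (V : lmodType K) (p : {linear V -> V}) : (forall v, p v = 0) -> proj_rank p 0.
Proof. by move=> p0; exists 0%N; split=> //; apply: proj_basis0. Qed.

Lemma proj_rank_add (V : lmodType K) (p q : {linear V -> V}) y z :
  (forall v, p (q v) = 0) -> (forall v, q (p v) = 0) ->
  proj_rank p y -> proj_rank q z -> proj_rank (p \+ q) (y + z).
Proof.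
move=> pq qp [r [hr <-]] [s [hs <-]].
apply: (proj_basis_rank (proj_basis_add pq qp hr hs)).
by rewrite card_sum !card_ord.
Qed.

Lemma proj_rank_tens (U V : lmodType K) (p : {linear U -> U}) (q : {linear V -> V}) y z :
  proj_rank p y -> proj_rank q z -> proj_rank (tmap p q) (y * z).
Proof.
move=> [r [hr <-]] [s [hs <-]]; apply: (proj_basis_rank (proj_basis_tens hr hs)).
by rewrite card_prod !card_ord.
Qed.

Lemma proj_rank_conj (U V : lmodType K) (a : {linear U -> V}) (b : {linear V -> U})
    (p : {linear U -> U}) z :
  (forall u, b (a u) = u) -> proj_rank p z -> proj_rank (a \o p \o b) z.
Proof. by move=> ab [r [hr <-]]; exists r; split=> //; apply: proj_basis_conj. Qed.

Lemma proj_rank_sum (V : lmodType K) (p : nat -> {linear V -> V}) (z : nat -> int) n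
    (s : {linear V -> V}) :
  (forall i j v, i != j -> p i (p j v) = 0) ->
  (forall i, (i < n)%N -> proj_rank (p i) (z i)) ->
  (forall v, s v = \sum_(i < n) p i v) -> proj_rank s (\sum_(i < n) z i).
Proof.
move=> pp; elim: n s => [|n IH] s hp hs.
  by rewrite big_ord0; apply: proj_rank0 => v; rewrite hs big_ord0.
have l : linear (fun v => \sum_(i < n) p i v).
  by move=> a u v; rewrite scaler_sumr -big_split; apply: eq_bigr => i _; rewrite linearP.
rewrite big_ord_recr; apply: (proj_rank_ext (p := mklin l \+ p n)) => [v|].
  by rewrite hs big_ord_recr.
apply: proj_rank_add => [v|v||].
- by rewrite mklinE big1 // => i _; rewrite pp // ltn_eqF.
- by rewrite mklinE linear_sum big1 // => i _; rewrite pp // gtn_eqF.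
- by apply: IH => // i iN; apply: hp; apply: leqW.
exact: hp.
Qed.

End Basis.

(** * Dimensions, minimality and finite ranks *)

Section Dimension.
Context (k : fieldType).

Lemma rV_surj_leq m n (f : {linear 'rV[k]_m -> 'rV[k]_n}) :
  (forall v, exists u, f u = v) -> (n <= m)%N.
Proof.
move=> fs; suff : row_full (lin1_mx f) by rewrite /row_full => /eqP <-; apply: rank_leq_row.
rewrite -sub1mx; apply/row_subP => i; have [u uE] := fs (row i 1%:M).
by rewrite -uE -mul_rV_lin1 submxMl.
Qed.

Lemma rV_inj_surj n (f : {linear 'rV[k]_n -> 'rV[k]_n}) :
  injective f -> forall v, exists u, f u = v.
Proof.
move=> fI; have : row_free (lin1_mx f).
  rewrite -kermx_eq0; apply/rowV0P => v /sub_kermxP; rewrite mul_rV_lin1 => fv.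
  by apply: fI; rewrite fv linear0.
rewrite row_free_unit => fU v; exists (v *m invmx (lin1_mx f)).
by rewrite -mul_rV_lin1 mulmxKV.
Qed.

Lemma has_dim_iso (U V : lmodType k) (f : {linear U -> V}) n :
  bijective f -> has_dim U n -> has_dim V n.
Proof. by move=> fb [g gb]; exists (f \o g); apply: bij_comp. Qed.

Lemma has_dim_uniq (V : lmodType k) m n : has_dim V m -> has_dim V n -> m = n.
Proof.
have h a b : has_dim V a -> has_dim V b -> (b <= a)%N.
  move=> [f fb] [g /bijective_linear[g' [gK g'K]]]; apply: (rV_surj_leq (f := g' \o f)) => v.
  by case: fb => f' fK f'K; exists (f' (g v)); rewrite /= f'K gK.
by move=> hm hn; apply/eqP; rewrite eqn_leq !h.
Qed.

Lemma kdimE (V : lmodType k) n : has_dim V n -> kdim V = n.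
Proof.
move=> hn; rewrite /kdim; case: pselect => [ex|[]]; last by exists n.
by case: cid => n' hn' /=; apply: has_dim_uniq hn' hn.
Qed.

(** A positive value rules out the default 0 of the infinite-dimensional case. *)
Lemma kdim_gt0 (V : lmodType k) : (0 < kdim V)%N -> has_dim V (kdim V).
Proof. by rewrite /kdim; case: pselect => // ex; case: cid. Qed.

Lemma kdim_iso (U V : lmodType k) (f : {linear U -> V}) : bijective f -> kdim U = kdim V.
Proof.
move=> fb; have [g [fK gK]] := bijective_linear fb.
rewrite {2}/kdim; case: pselect => [ex|nex].
  case: cid => n hn /=; apply/kdimE/(has_dim_iso (f := g)) => //.
  by exists f.
rewrite /kdim; case: pselect => // -[n hn]; case: nex.
by exists n; apply: has_dim_iso fb hn.
Qed.

Lemma basis_has_dim (V : lmodType k) n :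
  proj_basis (idfun : {linear V -> V}) 'I_n -> has_dim V n.
Proof.
move=> [e [c [h1 h2]]].
have lf : linear (fun u : 'rV[k]_n => \sum_i u 0 i *: e i).
  move=> a u v; rewrite scaler_sumr -big_split; apply: eq_bigr => i _.
  by rewrite !mxE scalerDl scalerA.
exists (mklin lf); exists (fun v => \row_i (c i v : k)) => [u|v].
  apply/rowP => i; rewrite mxE mklinE linear_sum (bigD1 i) //= linearZ_LR h2 eqxx.
  rewrite big1 ?addr0 => [|j ji]; first exact: mulr1.
  by rewrite linearZ_LR h2 eq_sym (negPf ji) scaler0.
by rewrite mklinE -[RHS]/(idfun v) h1; apply: eq_bigr => i _; rewrite mxE.
Qed.

End Dimension.

Section MinimalReduction.
Context (K : comPzRingType) (k : fieldType) (kappa : {rmorphism K -> k}).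

Definition msub (V : lmodType K) : V -> Prop :=
  Defs.span (fun z => exists a (y : V), kappa a = 0 /\ z = a *: y).

Lemma btens1_linear (V : lmodType K) :
  linear (fun v : V => btens kappa 1 v : restr kappa (bchange kappa V)).
Proof. by move=> a x y; rewrite btensDr btensZr mul1r restrZ bchangeZ mulr1. Qed.

Lemma btens1_msub (V : lmodType K) (v : V) : msub v -> btens kappa 1 v = 0.
Proof.
apply: (span_lin (f := mklin (@btens1_linear V))) => _ [a [y [a0 ->]]].
by rewrite linearZ_LR restrZ a0 scale0r.
Qed.

Lemma kappa_msub (V : lmodType K) (c : {linear V -> K^o}) v : msub v -> kappa (c v) = 0.
Proof.
have lc : linear (fun v => kappa (c v) : restr kappa k^o).
  move=> a x y; rewrite linearP -[X in kappa X]/(a * (c x : K) + c y).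
  by rewrite rmorphD rmorphM.
apply: (span_lin (f := mklin lc)) => _ [a [y [a0 ->]]].
by rewrite linearZ_LR restrZ a0 scale0r.
Qed.

(** Vanishing in k (x) V forces all dual-basis coordinates of [v] into the kernel of [kappa], and
    [v] is the combination of generators with these coefficients. *)
Lemma msub_btens1 (V : lmodType K) (v : V) :
  is_projective V -> btens kappa 1 v = 0 -> msub v.
Proof.
move=> /projective_dual_basis[s hs] v0.
have lx x : linear (fun v : V => kappa (s v x) : restr kappa k^o).
  by move=> a u w; rewrite linearP -[_ x]/(a * s u x + s w x) rmorphD rmorphM.
have sx x : kappa (s v x) = 0.
  by have := bcliftE (mklin (lx x)) 1 v; rewrite v0 linear0 mklinE [1 *: _]mul1r.
rewrite -(hs v) (flift_coordE _ (dsupp_uniq _) (@dsupp_out _ _ _ _)).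
elim/big_ind: _ => [|x y|x _]; [exact: span_0 | exact: spanD |].
by apply: span_gen; exists (s v x), x.
Qed.

Lemma minimalP (C : cplx K) : (forall n, is_projective (C n)) ->
  minimal kappa C <-> forall n x, cdiff (cplx_bc kappa C) n x = 0.
Proof.
move=> C_proj; split=> h n x; last first.
  by apply: msub_btens1 => //; rewrite -bcmapE; apply: (h n (btens kappa 1 x)).
apply: (btens_ext (f := cdiff (cplx_bc kappa C) n) (g := \0)) => y.
by rewrite [LHS]bcmapE; apply/btens1_msub/h.
Qed.

End MinimalReduction.

Lemma homology_zero_diff (K : pzRingType) (C : cplx K) n :
  (forall n x, cdiff C n x = 0) ->
  exists f : {linear C n -> homology C n}, bijective f.
Proof.
move=> d0; have c0 x : cout C n (idfun x) = 0 by case: n x => [|n] x //; apply: d0.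
exists (qproj (fun z : kermod (cout C n) => exists y, ker_incl _ z = cdiff C n y)
  \o kerlift (f := cout C n) (h := idfun) c0).
apply: inj_surj_bij => [x y|y].
  move/qpi_eq; set S := fun z => _; move=> sxy.
  have := span_lin (f := ker_incl (cout C n)) _ sxy; rewrite linearB.
  move/(_ _)/eqP; rewrite subr_eq0 => h; apply/eqP/h.
  by move=> z [w ->]; apply: d0.
have [z <-] := qproj_surj y; exists (ker_incl _ z).
by congr (qproj _ _); apply: val_inj.
Qed.

(** Cycles lifting a basis of the homology give an injection of k^b into [C n], which also has
    dimension b. It is therefore onto, and every element of [C n] is a cycle. *)
Lemma homology_full (k : fieldType) (C : cplx k) n b :
  has_dim (C n) b -> kdim (homology C n) = b -> forall x, cout C n x = 0.
Proof.
move=> [f /bijective_linear[g [fK gK]]] hb x.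
(* For b = 0 the value of [kdim] carries no information, but then [C n] itself is zero. *)
case: b => [|b] in f g fK gK hb *.
  by rewrite -(gK x) (_ : g x = 0) ?linear0 //; apply/rowP => -[].
have := kdim_gt0 (V := homology C n); rewrite hb => /(_ isT)[h hbij].
have /choice[z zE] := fun i : 'I_b.+1 => qproj_surj (h (delta_mx 0 i)).
have lz : linear (fun u : 'rV[k]_b.+1 => \sum_i u 0 i *: z i).
  move=> a u v; rewrite scaler_sumr -big_split; apply: eq_bigr => i _.
  by rewrite !mxE scalerDl scalerA.
pose Z := mklin lz.
have qZ u : qproj _ (Z u) = h u.
  rewrite [in RHS](row_sum_delta u) !linear_sum; apply: eq_bigr => i _.
  by rewrite !linearZ_LR zE.
have ZI : injective (g \o ker_incl (cout C n) \o Z).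
  move=> u v /(can_inj gK)/val_inj zuv; apply: (bij_inj hbij).
  by rewrite -!qZ; congr (qproj _ _).
have [u uE] := rV_inj_surj (f := g \o ker_incl (cout C n) \o Z) ZI (g x).
have -> : x = ker_incl (cout C n) (Z u) by apply: (can_inj gK); rewrite -uE.
by apply/eqP; apply: (ker_valP (Z u)).
Qed.

(** * Finite ranks of minimal free resolutions *)

Section FiniteRank.
Context (K : comPzRingType) (k : fieldType) (kappa : {rmorphism K -> k}).

Lemma span_mono (V : lmodType K) (S S' : V -> Prop) x :
  (forall y, S y -> S' y) -> Defs.span S x -> Defs.span S' x.
Proof. by move=> h; elim=> [|a u v /h Su _ IH]; constructor. Qed.

(** Induction on the generators: the coefficients of the first generator [x] in elements of [S] form
    the ideal [J]. Subtracting lifts of finitely many generators of [J] moves an element of [S] into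
    the span of the remaining generators. *)
Lemma noetherian_sub (V : lmodType K) (s : seq V) (S : V -> Prop) :
    noetherian K -> S 0 -> (forall x y, S x -> S y -> S (x + y)) ->
    (forall a x, S x -> S (a *: x)) ->
    (forall x, S x -> Defs.span (fun y => y \in s) x) ->
  exists t : seq V, (forall x, x \in t -> S x) /\ (forall x, S x -> Defs.span (fun y => y \in t) x).
Proof.
move=> hK; elim: s S => [|x s IH] S S0 SD SZ hS.
  by exists [::]; split=> // x Sx; apply: span_mono (hS x Sx).
pose J a := exists y, Defs.span (fun y => y \in s) y /\ S (a *: x + y).
have J_ideal : ideal J.
  split=> [|a b [y [sy Sy]] [z [sz Sz]]|a b [y [sy Sy]]].
  - by exists 0; rewrite scale0r addr0; split=> //; constructor.
  - exists (y + z); split; first exact: spanD.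
    by rewrite scalerDl addrACA; apply: SD.
  - exists (a *: y); split; first exact: spanZ.
    by rewrite -scalerA -scalerDr; apply: SZ.
have [l hl] := hK J J_ideal.
have hy (a : K^o) : exists y, a \in l -> Defs.span (fun y => y \in s) y /\ S (a *: x + y).
  case: (boolP (a \in l)) => al; last by exists 0.
  have /hl[y yP] : Defs.span (fun y : K^o => y \in l) a by apply: span_gen.
  by exists y.
have /choice[y yP] := hy.
pose S' v := S v /\ Defs.span (fun y => y \in s) v.
have [||||t [tS St]] := IH S'.
- by split=> //; constructor.
- by move=> u v [? ?] [? ?]; split; [apply: SD | apply: spanD].
- by move=> a u [? ?]; split; [apply: SZ | apply: spanZ].
- by move=> u [].
pose t1 := [seq (a : K) *: x + y a | a <- l].
have t1S v : v \in t1 -> S v by case/mapP => a al ->; apply: (yP a al).2.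
exists (t1 ++ t); split=> [v|v Sv].
  by rewrite mem_cat => /orP[/t1S|/tS[]].
have spanS (T : seq V) v' : (forall v, v \in T -> S v) -> Defs.span (fun y => y \in T) v' -> S v'.
  by move=> TS; elim=> // a u w /TS Su _ Sw; apply: SD => //; apply: SZ.
have [a [w [sw vE]]] : exists a w, Defs.span (fun y => y \in s) w /\ v = a *: x + w.
  elim: (hS v Sv) => [|b u w us _ [a [w' [sw ->]]]].
    by exists 0, 0; rewrite scale0r addr0; split=> //; constructor.
  move: us; rewrite inE => /orP[/eqP->|us].
    by exists (b + a), w'; rewrite scalerDl addrA.
  exists a, (b *: u + w'); rewrite addrCA; split=> //.
  by constructor.
have /hl Ja : J a by exists w; rewrite -vE.
have [w1 [sw1 sw1x]] : exists w1, Defs.span (fun y => y \in t1) w1 /\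
    Defs.span (fun y => y \in s) (w1 - a *: x).
  elim: Ja => [|b c d cl _ [w1 [h1 h2]]].
    by exists 0; rewrite scale0r subr0; split; constructor.
  exists ((b : K) *: ((c : K) *: x + y c) + w1); split.
    by constructor=> //; apply/mapP; exists c.
  rewrite [(_ *: _ + _ : K^o)]/(b * c + d) scalerDl scalerDr scalerA opprD addrACA.
  by rewrite [X in X + _]addrAC subrr add0r; apply: spanD => //; apply/spanZ/(yP c cl).1.
have : S' (v - w1).
  split; first by apply: SD => //; rewrite -scaleN1r; apply/SZ; apply: (spanS t1).
  rewrite vE -opprB -scaleN1r; apply: spanZ; rewrite opprD addrA.
  by apply: spanD => //; rewrite -scaleN1r; apply: spanZ.
move/St => h; rewrite -[v](subrK w1); apply: spanD; last first.
  by apply: span_mono sw1 => u; rewrite mem_cat => ->.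
by apply: span_mono h => u; rewrite mem_cat orbC => ->.
Qed.

Lemma span_coef (V : lmodType K) (s : seq V) y : Defs.span (fun z => z \in s) y ->
  exists a : 'I_(size s) -> K, y = \sum_i a i *: tnth (in_tuple s) i.
Proof.
elim=> [|b u v us _ [a ->]].
  by exists (fun=> 0); rewrite big1 // => i _; rewrite scale0r.
have ui : (index u s < size s)%N by rewrite index_mem.
exists (fun i => (if i == Ordinal ui then b else 0) + a i).
under [RHS]eq_bigr do rewrite scalerDl.
rewrite big_split /=; congr (_ + _); rewrite (bigD1 (Ordinal ui)) //= eqxx.
rewrite (tnth_nth 0) nth_index // big1 ?addr0 // => i /negPf ->.
by rewrite scale0r.
Qed.

(** Expressing basis vectors through [s] modulo m and taking coordinates again factors, over k, the
    identity matrix on any finite list of basis elements through k^(size s). This bounds such lists,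
    and one of maximal length exhausts the basis. *)
Lemma free_finite_rank (F : lmodType K) (s : seq F) :
    is_free F ->
    (forall x : F, exists2 y, Defs.span (fun z => z \in s) y & msub kappa (x - y)) ->
  exists r, proj_basis (idfun : {linear F -> F}) 'I_r.
Proof.
move=> [X [f fb]] hs; have [g [fK gK]] := bijective_linear fb.
pose c (x : X) : {linear F -> K^o} := dcomp x \o g.
have cE x x' : c x (f (fgen K x')) = (x == x')%:R.
  rewrite -[LHS]/(g (f (fgen K x')) x) fK /fgen; case: eqP => [->|/eqP ne].
    exact: din_in.
  by apply: din_out; rewrite eq_sym.
have bound (xs : seq X) : uniq xs -> (size xs <= size s)%N.
  move=> xsU; pose x j := tnth (in_tuple xs) j.
  have h j : exists a : 'I_(size s) -> K,
      msub kappa (f (fgen K (x j)) - \sum_i a i *: tnth (in_tuple s) i).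
    have [y /span_coef[a ->] hy] := hs (f (fgen K (x j))).
    by exists a.
  have /choice[a ha] := h.
  pose P := \matrix_(j, i) kappa (a j i).
  pose R := \matrix_(i, l) kappa (c (x l) (tnth (in_tuple s) i)).
  have PR : P *m R = 1%:M.
    apply/matrixP => j l; rewrite !mxE.
    have := kappa_msub (c (x l)) (ha j); rewrite linearB cE rmorphB rmorph_nat.
    rewrite linear_sum rmorph_sum => /eqP; rewrite subr_eq0 => /eqP E.
    have -> : (j == l) = (x l == x j).
      by rewrite eq_sym inj_eq //; apply/tuple_uniqP.
    rewrite E; apply: eq_bigr => i _; rewrite !mxE linearZ_LR.
    by rewrite -rmorphM.
  have := mxrankM_maxl P R; rewrite PR mxrank1 => /leq_trans; apply.
  exact: rank_leq_col.
pose pr n := `[< exists xs : seq X, uniq xs /\ size xs = n >].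
have pr0 : exists n, pr n by exists 0%N; apply/asboolP; exists [::].
have prb n : pr n -> (n <= size s)%N by move=> /asboolP[xs [/bound + <-]].
case: (ex_maxnP pr0 prb) => n /asboolP[xs [xsU xsn]] maxn.
have xs_all x : x \in xs.
  apply: contraT => nx; have : pr n.+1.
    by apply/asboolP; exists (x :: xs); rewrite /= nx xsU xsn.
  by move/maxn; rewrite ltnn.
exists (size xs), (fun i => f (fgen K (tnth (in_tuple xs) i))).
exists (fun i => c (tnth (in_tuple xs) i)); split=> [v|i j]; last first.
  by rewrite cE (inj_eq (f := tnth (in_tuple xs))) //; apply/tuple_uniqP.
rewrite -[LHS]gK [g v](dsum_sub xsU) => [|x]; last by rewrite xs_all.
rewrite linear_sum; apply: etrans (big_tuple _ _ (in_tuple xs) _ _) _.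
apply: eq_bigr => i _; rewrite -linearZ_LR; congr (f _).
by rewrite /fgen -linearZ_LR; congr (din _ _); rewrite /= [RHS]mulr1.
Qed.

Lemma basis_span (F : lmodType K) r : proj_basis (idfun : {linear F -> F}) 'I_r ->
  exists s : seq F, forall x, Defs.span (fun y => y \in s) x.
Proof.
move=> [e [c [h1 _]]]; exists (codom e) => x; rewrite -[x]/(idfun x) h1.
elim/big_ind: _ => [|u v|i _]; [exact: span_0 | exact: spanD |].
by apply/spanZ/span_gen/codom_f.
Qed.

(** Choose preimages in F_n of finitely many generators of the image of F_n (in [N] or in F_(n-1)).
    They span F_n up to the kernel, which is the image of F_(n+1) and so lies in m F_n by
    minimality. The image in F_(n-1) is finitely generated because [K] is Noetherian and F_(n-1) has
    finite rank by induction. *)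
Lemma minimal_finite_rank (N : lmodType K) (F : cplx K) (e : {linear F 0%N -> N}) :
    noetherian K -> fin_gen N -> is_resolution e ->
    (forall n, is_free (F n)) -> minimal kappa F ->
  forall n, exists r, proj_basis (idfun : {linear F n -> F n}) 'I_r.
Proof.
move=> hK [t ht] [dd ex ee surj] F_free F_min.
have step (W : lmodType K) n (p : {linear F n -> W}) (s : seq W) :
    (forall z, z \in s -> exists y, p y = z) ->
    (forall x, Defs.span (fun z => z \in s) (p x)) ->
    (forall x, p x = 0 -> exists y, x = cdiff F n y) ->
    exists r, proj_basis (idfun : {linear F n -> F n}) 'I_r.
  move=> hs sp pk.
  have /choice[q qE] : forall z, exists y, z \in s -> p y = z.
    by move=> z; case: (boolP (z \in s)) => [/hs[y]|_]; [exists y | exists 0].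
  apply: (free_finite_rank (s := map q s)) => // x.
  have [y ys py] : exists2 y, Defs.span (fun z => z \in map q s) y & p y = p x.
    elim: (sp x) => [|a u v us _ [y hy yE]]; first by exists 0; [constructor | rewrite linear0].
    exists (a *: q u + y); first by constructor=> //; apply: map_f.
    by rewrite linearP qE ?yE.
  exists y => //; have [|z ->] := pk (x - y); first by rewrite linearB py subrr.
  exact: F_min.
elim=> [|n [r /basis_span[s hs]]].
  apply: (step _ _ e t) => [z _|x|x /ee //]; [exact: surj | exact: ht].
have [||||u [us uS]] := noetherian_sub (s := s) (S := fun x => exists y, cdiff F n y = x) hK.
- by exists 0; rewrite linear0.
- by move=> _ _ [x <-] [y <-]; exists (x + y); rewrite linearD.
- by move=> a _ [x <-]; exists (a *: x); rewrite linearZ_LR.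
- by move=> x _; apply: hs.
apply: (step _ _ (cdiff F n) u) => [//|x|]; first by apply: uS; exists x.
exact: ex.
Qed.

End FiniteRank.

(** * Ranks of the bar resolution *)

Lemma fps_divE (p q : fps) n :
  fps_div p q n = p n - \sum_(i < n) fps_div p q i * q (n - i)%N.
Proof.
rewrite {1}/fps_div /= nth_rcons size_fps_div_seq ltnn eqxx; congr (_ - _).
by apply: eq_bigr => i _; rewrite nth_fps_div_seq.
Qed.

Lemma gtot_rank (K : comPzRingType) s (C : nat -> lmodType K) n z :
  proj_rank (idfun : {linear C n -> C n}) z -> proj_rank (gpr (gtot s C) (n + s)) z.
Proof.
move=> hz; have dK (u : C n) : dcomp n (din n u : dsum C) = u by apply: din_in.
apply: (proj_rank_ext (V := gtot s C) (p := din n \o (idfun : {linear C n -> C n}) \o dcomp n));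
  last exact: (proj_rank_conj (a := din n) (b := dcomp n) dK hz).
move=> v.
rewrite -[LHS]/(din n (v n)); apply: dsum_ext => i; rewrite [RHS]gtot_prE eqn_add2r.
by case: (eqVneq i n) => [->|ne]; rewrite ?din_in // din_out // eq_sym.
Qed.

Section BarRank.
Context (Q : comPzRingType) (A : ucplx Q) (G : cplx Q) (a g : fps).
Context (A_rank : forall n, proj_rank (idfun : {linear A n -> A n}) (a n)).
Context (G_rank : forall n, proj_rank (idfun : {linear G n -> G n}) (g n)).
Context (a0 : a 0%N = 1).
Let X := susp A.
Let V := barG A G.

(** The shift puts A_(n+1) in degree n + 2, and A_0 is left out. *)
Lemma susp_rank n : proj_rank (gpr X n) (if n is n'.+2 then a n'.+1 else 0).
Proof.
case: n => [|[|n]]; [exact: proj_rank0 | exact: proj_rank0 |].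
by rewrite -[n.+2]addn2; apply: gtot_rank; apply: (A_rank n.+1).
Qed.

Lemma gpr_barG_split n v : gpr V n v =
  bjoin (gpr (gtens X V) n (buncons v)) + bunit A (gpr (gmodule G) n (bbot v)).
Proof.
apply: (bel_homog_ext (f := gpr V n) (h := (bjoin \o gpr (gtens X V) n \o buncons) \+
  (bunit A \o gpr (gmodule G) n \o bbot))) => i k s w hs hw.
rewrite -[RHS]/(bjoin (gpr (gtens X V) n (buncons (bel s w))) +
  bunit A (gpr (gmodule G) n (bbot (bel s w)))).
rewrite (gpr_homog _ (homog_hbel hs hw)) bunconsE bbotE; inversion hs as [|j l x t hx ht E1 E2].
  rewrite linear0 linear0 add0r add0n (gpr_homog _ hw).
  by case: eqP => // _; rewrite linear0.
rewrite !linear0 addr0 (gpr_homog _ (homog_tens hx (homog_hbel ht hw))) addnA.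
by case: eqP => _; rewrite ?linear0 // bjoinE bconsE.
Qed.

(** V = G (+) (X (x) V) gives r_n = g_n + sum of x_i r_(n-i), with x_i the ranks of X, which is the
    recursion for the coefficients of g / (1 - t (a - 1)). As X starts in degree 2, only smaller
    degrees of V occur on the right. Working with ranks of projections avoids constructing the
    graded pieces of the tensor product. *)
Lemma barG_rank n : proj_rank (gpr V n)
  (fps_div g (fps_sub fps_one (fps_mult (fps_sub a fps_one))) n).
Proof.
set q := fps_sub _ _; elim/ltn_ind: n => n IH.
pose z i := (if i is i'.+2 then a i'.+1 else 0) * fps_div g q (n - i)%N.
have -> : fps_div g q n = (\sum_(i < n.+1) z i) + g n.
  rewrite fps_divE addrC -sumrN; congr (_ + _).
  (* The division recursion runs over the degree in V and [z] over the degree in X, hence the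
     reversal. In X-degree 1 the series gives a_0 - 1 = 0, in agreement with [z 1]. *)
  rewrite [RHS]big_ord_recl /z mul0r add0r [LHS](reindex_inj rev_ord_inj).
  apply: eq_bigr => i _; rewrite lift0 [rev_ord i : nat]/= subKn // mulrC -mulNr.
  congr (_ * _); rewrite /q /fps_sub /fps_mult [fps_one _.+1]/= sub0r opprK.
  by case: (i : nat) => [|j]; rewrite ?a0 ?subrr // [fps_one _]/= subr0.
have XV_rank : proj_rank (gpr (gtens X V) n) (\sum_(i < n.+1) z i).
  apply: (proj_rank_sum (p := fun i => tmap (gpr X i) (gpr V (n - i)%N))) => [i j v ij|i|v //].
    have E : tmap (gpr X i) (gpr V (n - i)) \o tmap (gpr X j) (gpr V (n - j)) =1
        (\0 : {linear tensor X V -> tensor X V}).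
      apply: tens_ext => x y.
      rewrite -[LHS]/(tmap _ _ (tmap (gpr X j) (gpr V (n - j)) (tens x y))) !tmapE.
      by rewrite gpr_gpr (negPf ij) tensor0l.
    exact: E.
  case: i => [_|[_|i iN]].
  - apply: (proj_rank_ext (p := \0)); last by rewrite /z mul0r; apply: proj_rank0.
    by apply: tens_ext => x y; rewrite tmapE [gpr X 0 x](_ : _ = 0) ?tensor0l.
  - apply: (proj_rank_ext (p := \0)); last by rewrite /z mul0r; apply: proj_rank0.
    by apply: tens_ext => x y; rewrite tmapE [gpr X 1 x](_ : _ = 0) ?tensor0l.
  apply: proj_rank_tens; first exact: (susp_rank i.+2).
  by apply: IH; rewrite ltn_subrL /=; case: (n) iN.
have jK (t : tensor X V) : buncons (bjoin t) = t by apply: bjoinK.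
have uK (w : gmodule G) : bbot (bunit A w) = w by rewrite bbotE.
have ju (w : gmodule G) : buncons (bunit A w) = 0 by rewrite bunconsE.
have uj (t : tensor X V) : bbot (bjoin t) = 0.
  apply: (tens_ext (M := X) (N := V) (f := bbot \o bjoin) (g := \0)) => x v.
  rewrite -[LHS]/(bbot (bjoin (tens x v))) bjoinE.
  apply: (bel_ext (f := bbot \o bcons x) (h := \0)) => s w.
  by rewrite -[LHS]/(bbot (bcons x (bel s w))) bconsE bbotE.
apply: (proj_rank_ext (p := (bjoin \o gpr (gtens X V) n \o buncons) \+
  (bunit A \o gpr (gmodule G) n \o bbot))) => [v|]; first by rewrite gpr_barG_split.
apply: (proj_rank_add (p := bjoin \o gpr (gtens X V) n \o buncons)
  (q := bunit A \o gpr (gmodule G) n \o bbot)) => [v|v||].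
- rewrite -[LHS]/(bjoin (gpr (gtens X V) n (buncons (bunit A _)))) ju.
  by rewrite !linear0.
- rewrite -[LHS]/(bunit A (gpr (gmodule G) n (bbot (bjoin _)))) uj.
  by rewrite !linear0.
- exact: proj_rank_conj jK XV_rank.
apply: proj_rank_conj uK _.
by have := gtot_rank 0 (G_rank n); rewrite addn0.
Qed.

End BarRank.

(** * Poincaré series and minimality *)

Section Poincare.
Context (K : comPzRingType) (k : fieldType) (kappa : {rmorphism K -> k}).

Lemma rank_has_dim_bc (V : lmodType K) r :
  proj_basis (idfun : {linear V -> V}) 'I_r -> has_dim (bchange kappa V) r.
Proof.
case/(proj_basis_bc kappa) => e [c [h1 h2]]; apply: basis_has_dim.
exists e, c; split=> // v; rewrite -h1.
pose f : {linear bchange kappa V -> bchange kappa V} := idfun.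
by apply: (btens_ext (f := f)) => y; rewrite [RHS]bcmapE.
Qed.

Lemma poincare_minimal (N : lmodType K) (F : cplx K) (e : {linear F 0%N -> N}) :
    noetherian K -> fin_gen N -> is_projective_resolution e ->
    (forall n, is_free (F n)) -> minimal kappa F ->
  forall n, proj_rank (idfun : {linear F n -> F n}) (poincare kappa N n).
Proof.
move=> hK hN F_res F_free F_min n.
have [r hr] := minimal_finite_rank hK hN F_res.2 F_free F_min n.
exists r; split=> //; rewrite /poincare.
have [f fb] := tor_resolution kappa n F_res.
have d0 := (minimalP kappa F_res.1).1 F_min.
have [h hb] := homology_zero_diff n d0.
by rewrite -(kdim_iso fb) -(kdim_iso hb) (kdimE (rank_has_dim_bc hr)).
Qed.

Lemma minimal_iff_kdim (N : lmodType K) (F : cplx K) (e : {linear F 0%N -> N}) (b : fps) :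
    is_projective_resolution e ->
    (forall n, proj_rank (idfun : {linear F n -> F n}) (b n)) ->
  minimal kappa F <-> poincare kappa N =1 b.
Proof.
move=> F_res hb; rewrite minimalP; last exact: F_res.1.
split=> [d0 n|pb n x].
  have [r [/rank_has_dim_bc hr <-]] := hb n.
  have [f fb] := tor_resolution kappa n F_res; have [h hbij] := homology_zero_diff n d0.
  by rewrite /poincare -(kdim_iso fb) -(kdim_iso hbij) (kdimE hr).
have [r [/rank_has_dim_bc hr rb]] := hb n.+1.
have [f fb] := tor_resolution kappa n.+1 F_res.
apply: (homology_full (C := cplx_bc kappa F) (n := n.+1) hr); rewrite (kdim_iso fb).
by have := pb n.+1; rewrite -rb /poincare => -[].
Qed.

End Poincare.

Lemma fin_gen_restr (Q R : comPzRingType) (phi : {rmorphism Q -> R}) (M : lmodType R) :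
  (forall r, exists q, phi q = r) -> fin_gen M -> fin_gen (restr phi M).
Proof.
move=> phi_surj [s hs]; exists s => x; elim: (hs x) => [|r u v us _ IH]; first exact: span_0.
by have [q <-] := phi_surj r; apply: (Defs.span_cons (V := restr phi M) q us IH).
Qed.

Theorem theoremA (Q R : comPzRingType) (phi : {rmorphism Q -> R})
    (phi_surj : forall r, exists q, phi q = r)
    (M : lmodType R)
    (A : ucplx Q) (A_res : is_projective_resolution (uaug A phi))
    (G : cplx Q) (epsG : {linear G 0%N -> restr phi M})
    (G_res : is_projective_resolution epsG)
    (m : ainf_maps A) (m_ainf : ainf_algebra m)
    (mG : amod_maps A G) (mG_ainf : ainf_module m mG) :
  (degm1 (bar_diff m mG phi) /\
   is_projective_resolution (bar_aug m mG epsG)) /\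
  (forall (k : fieldType) (kappa : {rmorphism Q -> k}) (rho : {rmorphism R -> k}),
     local_residue kappa -> (forall q, rho (phi q) = kappa q) ->
     noetherian Q -> fin_gen M ->
     (forall n, is_free (A n)) -> minimal kappa A ->
     (forall n, is_free (G n)) -> minimal kappa G ->
     (minimal rho (bar_cplx m mG phi) <-> golod phi kappa rho M)).
Proof.
have bar_res := bar_projective_resolution phi_surj A_res G_res m_ainf mG_ainf.
split.
  by split=> //; case: m_ainf mG_ainf => m_deg _ _ _ [mG_deg _ _ _]; apply: bar_degm1.
move=> k kappa rho _ _ Q_noeth M_fg A_free A_min G_free G_min.
have R_fg : fin_gen (restr phi R^o).
  apply: fin_gen_restr => //; exists [:: 1] => x; rewrite -[x]mulr1.
  by apply: spanZ; apply: span_gen; rewrite inE.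
have A_rank := poincare_minimal Q_noeth R_fg A_res A_free A_min.
have G_rank := poincare_minimal Q_noeth (fin_gen_restr phi_surj M_fg) G_res G_free G_min.
(* A_0 is Q, of rank 1; this is compared with the rank from [A_rank] after reduction to [k], where
   dimension is unique. *)
have a0 : poincare kappa (restr phi R^o) 0 = 1.
  have Q1 : proj_basis (idfun : {linear Q^o -> Q^o}) 'I_1.
    exists (fun=> 1), (fun=> idfun); split=> [v|i j]; last by rewrite !ord1.
    by rewrite big_ord1; apply: esym; apply: mulr1.
  have [r [hr <-]] := A_rank 0%N.
  by rewrite (has_dim_uniq (rank_has_dim_bc kappa hr) (rank_has_dim_bc kappa Q1)).
(* [golod] unfolds to the equality of the Poincaré series of M with the series of [barG_rank], so
   what remains is that the degree n part of R (x) V has that rank. It is split off by [gpr], whose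
   basis over Q survives base change. *)
apply: (minimal_iff_kdim rho bar_res) => n.
have [r [hr <-]] := barG_rank A_rank G_rank a0 n.
have [e [c [h1 h2]]] := proj_basis_bc phi hr.
exists r; split=> //.
apply: (proj_basis_split (a := ker_incl (gdefect (bar A G phi) n))
  (b := gcomp_proj (bar A G phi) n) (p := gpr (bar A G phi) n)).
- exact: gcomp_projK.
- by [].
by exists e, c.
Qed.
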